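(* Let $\mathcal{M}$ be a $d$-dimensional $C^\infty$ compact Riemannian manifold without boundary, let $a,m\in\mathbb{N}$, and let $\mathbf{k},\mathbf{r}^0,\ldots,\mathbf{r}^m\in\mathbb{R}^a$ be such that $\mathbf{k}+\frac{2d-1}{4}\cdot\mathbf{1}$ belongs to the interior of the convex hull of $\mathbf{r}^0,\ldots,\mathbf{r}^m$. Let $\lambda_0,\ldots,\lambda_m>0$ be such that $\lambda_0+\ldots+\lambda_m=1$ and $\mathbf{k}+\frac{2d-1}{4}\cdot\mathbf{1}\leqslant\lambda_0\mathbf{r}^0+\ldots+\lambda_m\mathbf{r}^m$ (coordinatewise). Then for every $x\in\bigcap_{l=0}^mH_0^{2\mathbf{r}^l}(\mathcal{M}^a)$ there holds the sharp inequality $$\|\mathbf{\Delta}^{\mathbf{k}}x\|_{C(\mathcal{M}^a)}\leqslant\sqrt{\mathcal{C}\cdot\prod_{j=0}^m\lambda_j^{-\lambda_j}}\cdot\prod_{j=0}^m\|\mathbf{\Delta}^{\mathbf{r}^j}x\|_{L_2(\mathcal{M}^a)}^{\lambda_j},$$ where $$\mathcal{C}=\sup_{\xi_1,\ldots,\xi_a\in\mathcal{M}}\ \sup_{\mathbf{h}\in\mathbb{R}_+^{m+1}}\ \prod_{j=0}^mh_j^{\lambda_j}\sum_{\mathbf{j}\in\mathbb{N}^a}\frac{\mu_{j_1}^{4k_1}\cdots\mu_{j_a}^{4k_a}\,\varphi_{j_1}^2(\xi_1)\cdots\varphi_{j_a}^2(\xi_a)}{\sum_{l=0}^mh_l\,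\mu_{j_1}^{4r_1^l}\cdots\mu_{j_a}^{4r_a^l}}.$$
   Context: $\mathbb{R}_+=(0,+\infty)$, $\mathbf{h}=(h_0,\ldots,h_m)$, $\mathbf{1}=(1,\ldots,1)\in\mathbb{R}^a$, $\mathbf{r}^l=(r_1^l,\ldots,r_a^l)$. $\Delta$ is the positive self-adjoint Laplace–Beltrami operator on $L_2(\mathcal{M})$ (with respect to the Riemannian volume), with eigenvalues counted with multiplicity $0=\mu_0^2<\mu_1^2\leqslant\mu_2^2\leqslant\ldots$, $\mu_j\geqslant0$ (in particular $\mathcal{M}$ is connected), and $L_2$-orthonormal basis $\{\varphi_j\}_{j=0}^\infty$ of real $C^\infty$ eigenfunctions, $\Delta\varphi_j=\mu_j^2\varphi_j$. $\mathcal{M}^a=\mathcal{M}\times\ldots\times\mathcal{M}$ ($a$ factors) with the product measure; $\|\cdot\|_{C(\mathcal{M}^a)}$ is the maximum norm. For $\mathbf{j}=(j_1,\ldots,j_a)$ with non-negative integer entries put $\varphi_{\mathbf{j}}(t_1,\ldots,t_a)=\varphi_{j_1}(t_1)\cdots\varphi_{j_a}(t_a)$ and, for $x\in L_2(\mathcal{M}^a)$, $a_{\mathbf{j}}=(x,\varphi_{\mathbf{j}})_{L_2(\mathcal{M}^a)}$. For $\mathbf{s}\in\mathbb{R}^a$, $H_0^{\mathbf{s}}(\mathcal{M}^a)$ is the space of functions $x$ with $a_{\mathbf{j}}=0$ whenever $j_1\cdots j_a=0$ and $\sum_{\mathbf{j}\in\mathbb{N}^a}|a_{\mathbf{j}}|^2\mu_{j_1}^{2s_1}\cdots\mu_{j_a}^{2s_a}<\infty$.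 For $x\in H_0^{2\mathbf{s}}(\mathcal{M}^a)$, $\mathbf{\Delta}^{\mathbf{s}}x:=\sum_{\mathbf{j}\in\mathbb{N}^a}a_{\mathbf{j}}\mu_{j_1}^{2s_1}\cdots\mu_{j_a}^{2s_a}\varphi_{\mathbf{j}}$. Sharp means that the constant in front of the product of norms cannot be reduced. *)

(* Defs.v *)
From HB Require Import structures.
From mathcomp Require Import all_boot all_order all_algebra.
From mathcomp Require Import all_classical all_reals all_analysis.

Set Implicit Arguments.
Unset Strict Implicit.
Unset Printing Implicit Defensive.

Import Order.TTheory GRing.Theory Num.Theory.
Import numFieldNormedType.Exports.

Local Open Scope classical_set_scope.
Local Open Scope ring_scope.

Section measure_cons.
Local Open Scope ereal_scope.
Context {disp} {T : measurableType disp} {R : realType} {n : nat}.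
Variable mu : {sigma_finite_measure set T -> \bar R}.
Variable nu : {sigma_finite_measure set (n.-tuple T) -> \bar R}.

Definition tuple_cons (p : T * n.-tuple T) : n.+1.-tuple T :=
  [the n.+1.-tuple T of p.1 :: p.2].

Lemma measurable_tuple_cons : measurable_fun setT tuple_cons.
Proof. exact: measurable_cons. Qed.

Definition measure_cons : set (n.+1.-tuple T) -> \bar R :=
  pushforward (mu \x nu) tuple_cons.

Let preimage_measurable (A : set (n.+1.-tuple T)) :
  measurable A -> measurable (tuple_cons @^-1` A).
Proof.
by move=> mA; rewrite -[X in measurable X]setTI; exact: measurable_tuple_cons.
Qed.

Let measure_cons0 : measure_cons set0 = 0.
Proof. by rewrite /measure_cons /pushforward preimage_set0 measure0. Qed.

Let measure_cons_ge0 A : 0 <= measure_cons A.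
Proof. by rewrite /measure_cons /pushforward; exact: measure_ge0. Qed.

Let measure_cons_sigma_additive : semi_sigma_additive measure_cons.
Proof.
move=> F mF tF mUF; rewrite /measure_cons /pushforward preimage_bigcup.
apply: measure_semi_sigma_additive.
- by move=> i; exact: preimage_measurable.
- apply/trivIsetP => /= i j _ _ ij; rewrite -preimage_setI.
  by move/trivIsetP : tF => /(_ _ _ _ _ ij) ->//; rewrite preimage_set0.
- by rewrite -preimage_bigcup; exact: preimage_measurable.
Qed.

HB.instance Definition _ := isMeasure.Build _ _ _ measure_cons
  measure_cons0 measure_cons_ge0 measure_cons_sigma_additive.

Let measure_cons_sigma_finite : sigma_finite setT measure_cons.
Proof.
have [H UH Hfin] : sigma_finite setT (mu \x nu).
  have /sigma_finiteP[F [UF ndF Ffin]] := sigma_finiteT mu.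
  have /sigma_finiteP[G [UG ndG Gfin]] := sigma_finiteT nu.
  exists (fun i => F i `*` G i).
    rewrite -setXTT UF UG predeqE => -[x y]; split.
      move=> [/= [i _ Fix] [j _ Gjy]]; exists (maxn i j) => //; split.
      - by move: x Fix; exact/subsetPset/ndF/leq_maxl.
      - by move: y Gjy; exact/subsetPset/ndG/leq_maxr.
    by move=> [i _ []/= ? ?]; split; exists i.
  move=> i; have [mF Fi] := Ffin i; have [mG Gi] := Gfin i.
  split; first exact: measurableX.
  by rewrite product_measure1E// lte_mul_pinfty// ge0_fin_numE.
pose uncons (t : n.+1.-tuple T) := (thead t, [tuple of behead t] : n.-tuple T).
have unconsK : cancel uncons tuple_cons by move=> t; rewrite [RHS]tuple_eta.
have consK : cancel tuple_cons uncons.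
  by move=> [x t]; congr (_, _); apply: val_inj.
have muncons : measurable_fun setT uncons.
  apply/measurable_fun_pairP; split.
    exact: measurable_tnth.
  exact: measurable_behead.
exists (fun i => uncons @^-1` H i).
  by rewrite -preimage_bigcup -UH preimage_setT.
move=> i; have [mHi Hi] := Hfin i; split.
  by rewrite -[X in measurable X]setTI; exact: muncons.
rewrite /measure_cons /pushforward -comp_preimage.
by rewrite (_ : uncons \o tuple_cons = id) //; apply/funext => p; exact: consK.
Qed.

HB.instance Definition _ := Measure_isSigmaFinite.Build _ _ _ measure_cons
  measure_cons_sigma_finite.

End measure_cons.

Section measure_power.
Context {disp} {T : measurableType disp} {R : realType}.
Variable mu : {sigma_finite_measure set T -> \bar R}.

Fixpoint measure_power n : {sigma_finite_measure set (n.-tuple T) -> \bar R} :=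
  match n with
  | 0 => [the sigma_finite_measure _ R of \d_[tuple]]
  | n'.+1 => [the sigma_finite_measure _ R of measure_cons mu (measure_power n')]
  end.

Lemma measure_power_box n (A : 'I_n -> set T) : (forall i, measurable (A i)) ->
  measure_power n [set t | forall i, A i (tnth t i)] = (\prod_(i < n) mu (A i))%E.
Proof.
elim: n A => [|n IH] A mA /=.
  rewrite big_ord0 diracE mem_set//= => -[]//.
rewrite big_ord_recl -IH// /measure_cons /pushforward.
rewrite -product_measure1E//; last first.
  rewrite (_ : mkset _ = \bigcap_(i in [set: 'I_n])
      ((fun t : n.-tuple T => tnth t i) @^-1` A (lift ord0 i))).
    apply: fin_bigcap_measurable => // i _.
    by rewrite -[X in measurable X]setTI; exact: measurable_tnth.
  by apply/seteqP; split=> [t At i _|t At i]; [exact: At|exact: (At i I)].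
congr (_ _); apply/seteqP; split => [[x t] /= At|[x t] /= [Ax At] i].
  split; first exact: (At ord0).
  by move=> i; have := At (lift ord0 i); rewrite /tuple_cons/= tnthS.
by case: (unliftP ord0 i) => [j ->|->]//; rewrite /tuple_cons/= tnthS.
Qed.

End measure_power.

Section euclidean.
Context {R : realType}.

(* The [C^n] condition only inspects [f] on a neighbourhood of each point of
   [U]; it is meant for [U] open. *)
Fixpoint Cn_on d (n : nat) (U : set 'rV[R]_d) (f : 'rV[R]_d -> R) : Prop :=
  (forall u, U u -> {for u, continuous f}) /\
  match n with
  | 0 => True
  | n'.+1 => forall i : 'I_d,
      (forall u, U u -> derivable f u (delta_mx ord0 i)) /\
      Cn_on n' U ('D_(delta_mx ord0 i) f)
  end.

Definition smooth_on d (U : set 'rV[R]_d) (f : 'rV[R]_d -> R) : Prop :=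
  forall n, Cn_on n U f.

Definition rV_of_tuple d (t : d.-tuple (measurableTypeR R)) : 'rV[R]_d :=
  \row_i tnth t i.

Definition lebesgue_measure_tuple d :
    {sigma_finite_measure set (d.-tuple (measurableTypeR R)) -> \bar R} :=
  measure_power (@lebesgue_measure R) d.

Definition convex_hull (V : lmodType R) m (r : 'I_m -> V) : set V :=
  [set v | exists w : 'I_m -> R, [/\ forall l, 0 <= w l,
     \sum_(l < m) w l = 1 & v = \sum_(l < m) w l *: r l]].

End euclidean.

Notation borel M := (g_sigma_algebraType (@open M)).

(* [chart i] and [param i] are meaningful only on [chart_dom i] and on its
   image under [chart i] respectively. *)
Record smooth_atlas (R : realType) (d : nat) (M : topologicalType) := SmoothAtlas {
  chart_index : Type;
  chart_dom : chart_index -> set M;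
  chart : chart_index -> M -> 'rV[R]_d;
  param : chart_index -> 'rV[R]_d -> M;
  chart_dom_open : forall i, open (chart_dom i);
  chart_dom_cover : forall p, exists i, chart_dom i p;
  chart_cod_open : forall i, open (chart i @` chart_dom i);
  chartK : forall i p, chart_dom i p -> param i (chart i p) = p;
  chart_continuous : forall i p, chart_dom i p -> {for p, continuous (chart i)};
  param_continuous : forall i u, (chart i @` chart_dom i) u ->
    {for u, continuous (param i)};
  transition_smooth : forall i j (c : 'I_d),
    smooth_on (chart i @` (chart_dom i `&` chart_dom j))
      (fun u => chart j (param i u) ord0 c)
}.

Section riemannian.
Context {R : realType} {d : nat} {M : ptopologicalType}.

(* [gram i u] is the matrix [(g_ab)] of the metric in the coordinate frame of
   the chart [i] at the point of coordinates [u].  The library's Jacobian acts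
   on row vectors from the right: ['D_v f u = v *m 'J f u]. *)
Record riemannian_metric (A : smooth_atlas R d M) := RiemannianMetric {
  gram : chart_index A -> 'rV[R]_d -> 'M[R]_d;
  gram_smooth : forall i (a b : 'I_d),
    smooth_on (chart i @` chart_dom i) (fun u => gram i u a b);
  gram_sym : forall i u, (chart i @` chart_dom i) u -> (gram i u)^T = gram i u;
  gram_posdef : forall i u (v : 'rV[R]_d), (chart i @` chart_dom i) u ->
    v != 0 -> 0 < (v *m gram i u *m v^T) ord0 ord0;
  gram_transition : forall i j u,
    (chart i @` (chart_dom i `&` chart_dom j)) u ->
    let tau := fun w => chart j (param i w) in
    gram i u = 'J tau u *m gram j (tau u) *m ('J tau u)^T
}.

Context {A : smooth_atlas R d M}.
Variable g : riemannian_metric A.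

Definition smooth (f : M -> R) : Prop :=
  forall i : chart_index A, smooth_on (chart i @` chart_dom i) (f \o param i).

Definition vol_density (i : chart_index A) (u : 'rV[R]_d) : R :=
  Num.sqrt (\det (gram g i u)).

(* The positive Laplacian [- div grad] in local coordinates,
   [- |g|^(-1/2) d_a (|g|^(1/2) g^ab d_b f)], as a function of the
   coordinates. *)
Definition laplacian (i : chart_index A) (f : M -> R) (u : 'rV[R]_d) : R :=
  - (vol_density i u)^-1 *
    \sum_(a < d) 'D_(delta_mx ord0 a) (fun w => vol_density i w *
      \sum_(b < d) (invmx (gram g i w)) a b *
                   'D_(delta_mx ord0 b) (f \o param i) w) u.

(* This determines [vol], as the chart domains cover [M]; [M] being compact,
   the measure is finite. *)
Definition is_riemannian_volume (vol : set (borel M) -> \bar R) : Prop :=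
  forall (i : chart_index A) (B : set (borel M)), measurable B ->
    B `<=` chart_dom i ->
    vol B = (\int[@lebesgue_measure_tuple R d]_(t in
               [set t | (chart i @` B) (rV_of_tuple t)])
               (vol_density i (rV_of_tuple t))%:E)%E.

End riemannian.
Arguments smooth {R d M} A f.

Section L2.
Context {disp} {T : measurableType disp} {R : realType}.
Variable nu : {measure set T -> \bar R}.

Definition L2 (f : T -> R) : Prop := f \in Lfun nu 2%:E.

Definition L2norm (f : T -> R) : R := fine ('N[nu]_2%:E [EFin \o f])%E.

Definition L2dot (f h : T -> R) : R := \int[nu]_t (f t * h t).

Definition L2cvg (F : nat -> T -> R) (f : T -> R) : Prop :=
  ((fun n => L2norm (F n \- f)) @ \oo --> (0 : R)).

End L2.

Section spectral.
Context {R : realType} {d : nat} {M : ptopologicalType}.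
Context {A : smooth_atlas R d M}.
Variable g : riemannian_metric A.
Variable vol : {finite_measure set (borel M) -> \bar R}.

Record is_eigenbasis (mu : nat -> R) (phi : nat -> M -> R) : Prop :=
  IsEigenbasis {
    eigenvalue0 : mu 0 = 0;
    eigenvalue1 : 0 < mu 1;
    eigenvalue_ndecr : forall j, mu j <= mu j.+1;
    eigenfunction_smooth : forall j, smooth A (phi j);
    eigenfunction_laplacian : forall j (i : chart_index A) p, chart_dom i p ->
      laplacian g i (phi j) (chart i p) = mu j ^+ 2 * phi j p;
    eigenfunction_orthonormal : forall j l,
      L2dot vol (phi j) (phi l) = (j == l)%:R;
    eigenfunction_complete : forall f : borel M -> R, L2 vol f ->
      L2cvg vol (fun n p => \sum_(j < n) L2dot vol f (phi j) * phi j p) f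
  }.

Variables (mu : nat -> R) (phi : nat -> M -> R) (a : nat).

Definition vol_pow : {sigma_finite_measure set (a.-tuple (borel M)) -> \bar R} :=
  measure_power vol a.

(* Membership in [N^a], where [N] starts at 1. *)
Definition pos_index (J : a.-tuple nat) : bool := [forall i, 0 < tnth J i]%N.

Definition mu_pow (s : 'rV[R]_a) (J : a.-tuple nat) : R :=
  \prod_(i < a) mu (tnth J i) `^ s ord0 i.

Definition phi_tensor (J : a.-tuple nat) (t : a.-tuple (borel M)) : R :=
  \prod_(i < a) phi (tnth J i) (tnth t i).

Definition coef (x : a.-tuple (borel M) -> R) (J : a.-tuple nat) : R :=
  L2dot vol_pow x (phi_tensor J).

Definition H0 (s : 'rV[R]_a) (x : a.-tuple (borel M) -> R) : Prop :=
  [/\ L2 vol_pow x,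
      forall J, ~~ pos_index J -> coef x J = 0 &
      (\esum_(J in [set J | pos_index J])
         (`|coef x J| ^+ 2 * mu_pow (2 *: s) J)%:E < +oo)%E].

(* The sum over [N^a] is taken along the cubes [1, n)^a; for orthogonal series
   the order of summation is immaterial. *)
Definition laplacian_pow_sum (s : 'rV[R]_a) (x : a.-tuple (borel M) -> R)
    (n : nat) (t : a.-tuple (borel M)) : R :=
  \sum_(J : a.-tuple 'I_n | pos_index (map_tuple val J))
    coef x (map_tuple val J) * mu_pow (2 *: s) (map_tuple val J) *
    phi_tensor (map_tuple val J) t.

(* A representative of the L2-sum of the series. *)
Definition laplacian_pow (s : 'rV[R]_a) (x : a.-tuple (borel M) -> R) :
    a.-tuple (borel M) -> R :=
  xget (cst 0) [set y | L2 vol_pow y /\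
                        L2cvg vol_pow (laplacian_pow_sum s x) y].

(* Continuity for the product topology. *)
Definition tuple_continuous (y : a.-tuple (borel M) -> R) : Prop :=
  continuous (fun f : prod_topology (fun _ : 'I_a => M) => y (mktuple f)).

Definition continuous_version (f y : a.-tuple (borel M) -> R) : Prop :=
  tuple_continuous y /\ (y = f %[ae vol_pow]).

Definition maxnorm (y : a.-tuple (borel M) -> R) : R :=
  sup [set `|y t| | t in [set: a.-tuple (borel M)]].

Definition sharp_const m (lambda : 'I_m -> R) (k : 'rV[R]_a)
    (r : 'I_m -> 'rV[R]_a) : \bar R :=
  ereal_sup [set e | exists (xi : a.-tuple (borel M)) (h : 'I_m -> R),
    (forall l, 0 < h l) /\
    e = ((\prod_(l < m) h l `^ lambda l)%:E *
         \esum_(J in [set J | pos_index J])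
           (mu_pow (4 *: k) J * phi_tensor J xi ^+ 2 /
            \sum_(l < m) h l * mu_pow (4 *: r l) J)%:E)%E].

End spectral.

(* Main.v *)
(** The proof rests on a local Weyl bound: the sum of phi_j(xi)^2 over the
    j >= 1 with mu_j <= T is at most W T^d, uniformly in xi.  It follows from two
    estimates that can be proved in charts.  The first one is the inequality
    |u|_2^2 <= C (2^(qd) |u|_1^2 + 16^(-q) |Delta u|_2^2), a combination of the
    Poincare inequality on small cubes and of Caccioppoli's energy estimate.
    The second one bounds the resolvent (1 + s Delta)^(-1) by 1 / (1 - C s) in
    an L1 norm weighted by a sum of cutoffs.  Iterating resolvents over
    s = G 4^(-k) gives sum_(mu_j <= 2^q) <u, phi_j>^2 <= C 2^(qd) |u|_1^2, where
    indicators of superlevel sets of sum_j phi_j(xi) phi_j are substituted for u.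

    Since k + (2d-1)/4 remains in the hull of the r^l when it is moved along the
    axes, the terms of the series defining the sharp constant decay
    exponentially in each ln mu_(j_i), so that its sum is bounded by the Weyl
    bound. The inequality is then the Cauchy-Schwarz inequality with the
    weights sum_l h_l mu^(4 r^l), where h_l = lambda_l / |Delta^(r^l) x|^2,
    and its equality case, combined with the weighted AM-GM inequality, gives
    the extremal sequences. *)

Require Import Defs.
From mathcomp Require Import all_boot all_order all_algebra.
From mathcomp Require Import all_classical all_reals all_analysis.
From mathcomp Require Import ring lra measurable_realfun.

Import Order.TTheory GRing.Theory Num.Theory.
Import numFieldNormedType.Exports.

Local Open Scope classical_set_scope.
Local Open Scope ring_scope.

Set Implicit Arguments.
Unset Strict Implicit.
Unset Printing Implicit Defensive.

(** * Bounded measurable functions and product measures *)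

(** The eigenfunctions are known only through their equation in charts and their completeness in L2,
    so the Weyl bound is drawn from inequalities between L1 and L2 norms alone. A Nash inequality
    controls the L2 norm by the L1 norm except for a term in [Delta u]. Resolvents are there to make
    that term small; the difficulty is what they do to the L1 norm. In a chart the equation is
    tested against [psi' (u)] times a cutoff. Since [psi' (u) grad u] is the gradient of [psi (u)],
    the derivatives in the error term can all be moved to the cutoff, and the error is of the size
    of the L1 norm. The local inequalities concern the same function, so they add up over a finite
    cover; the sum of the cutoffs, which only has to be at least 1, becomes the weight. The price is
    a factor [1 / (1 - C s)] in place of 1, harmless along a geometric sequence of [s], where the
    product of these factors converges. The same choice keeps the product of the [1 + s mu_j^2]
    bounded for [mu_j <= 2^q]: low frequencies survive all the resolvents, while each resolvent
    outweighs the growth by [2^d] of the Nash constant from one scale to the next. *)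

Section bounded_measurable.
Context {d} {T : measurableType d} {R : realType}.
Implicit Types (D : set T) (f g : T -> R).

(** Unlike integrability, this is stable under products, and it gives integrability on sets of
    finite measure, which is all that the integrals in charts require. *)
Definition bmeas D f :=
  measurable_fun D f /\ exists M, forall x, D x -> `|f x| <= M.

Lemma bmeas_cst D c : bmeas D (fun=> c).
Proof. by split=> //; exists `|c|. Qed.

Lemma bmeasD D f g : bmeas D f -> bmeas D g -> bmeas D (fun x => f x + g x).
Proof.
move=> [mf [A Af]] [mg [B Bg]]; split; first exact: measurable_funD.
by exists (A + B) => x Dx; rewrite (le_trans (ler_normD _ _))// lerD ?Af ?Bg.
Qed.

Lemma bmeasM D f g : bmeas D f -> bmeas D g -> bmeas D (fun x => f x * g x).
Proof.
move=> [mf [A Af]] [mg [B Bg]]; split; first exact: measurable_funM.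
by exists (A * B) => x Dx; rewrite normrM ler_pM ?Af ?Bg.
Qed.

Lemma bmeasN D f : bmeas D f -> bmeas D (fun x => - f x).
Proof.
move=> bf; have := bmeasM (bmeas_cst D (-1)) bf.
by under eq_fun do rewrite mulN1r.
Qed.

Lemma bmeasB D f g : bmeas D f -> bmeas D g -> bmeas D (fun x => f x - g x).
Proof. by move=> bf bg; apply: bmeasD => //; exact: bmeasN. Qed.

Lemma bmeas_norm D f : bmeas D f -> bmeas D (fun x => `|f x|).
Proof.
move=> [mf [A Af]]; split; last by exists A => x /Af; rewrite normr_id.
exact: measurableT_comp.
Qed.

Lemma bmeasX D f n : bmeas D f -> bmeas D (fun x => f x ^+ n).
Proof.
move=> bf; elim: n => [|n IH]; first exact: bmeas_cst.
by under eq_fun do rewrite exprS; exact: bmeasM.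
Qed.

Lemma bmeas_sum D (I : Type) (s : seq I) (P : pred I) (f : I -> T -> R) :
  (forall i, bmeas D (f i)) -> bmeas D (fun x => \sum_(i <- s | P i) f i x).
Proof.
move=> bf; elim: s => [|i s IH].
  by under eq_fun do rewrite big_nil; exact: bmeas_cst.
by under eq_fun do rewrite big_cons; case: (P i) => //; exact: bmeasD.
Qed.

Lemma bmeasS D E f : measurable D -> E `<=` D -> bmeas D f -> bmeas E f.
Proof.
move=> mD ED [mf [A Af]]; split; last by exists A => x /ED; exact: Af.
exact: measurable_funS mf.
Qed.

Lemma bmeas_integrable (mu : {measure set T -> \bar R}) D f :
  measurable D -> (mu D < +oo)%E -> bmeas D f -> mu.-integrable D (EFin \o f).
Proof.
move=> mD Doo [mf [A Af]]; apply: measurable_bounded_integrable => //.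
exists A; split; [exact: num_real|move=> B AB x Dx].
exact: le_trans (Af x Dx) (ltW AB).
Qed.

End bounded_measurable.
#[global] Hint Resolve bmeas_cst bmeasD bmeasM bmeasN bmeasB bmeas_norm bmeasX bmeas_sum : bm.

Lemma bmeas_comp d1 d2 (S : measurableType d1) (T : measurableType d2)
    (R : realType) (E : set T) (D : set S) (h : S -> T) (f : T -> R) :
  measurable E -> measurable_fun D h -> (forall x, D x -> E (h x)) ->
  bmeas E f -> bmeas D (fun x => f (h x)).
Proof.
move=> mE mh DE [mf [A Af]]; split; last by exists A => x /DE; exact: Af.
apply: (measurable_comp mE) => //.
by move=> _ [x Dx <-]; exact: DE.
Qed.

Section power_measure.
Context {d} {T : measurableType d} {R : realType}.
Variable mu : {sigma_finite_measure set T -> \bar R}.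

Definition pbox n (A : 'I_n -> set T) : set (n.-tuple T) :=
  [set t | forall i, A i (tnth t i)].

Lemma measurable_pbox n (A : 'I_n -> set T) :
  (forall i, measurable (A i)) -> measurable (pbox A).
Proof.
move=> mA; rewrite (_ : pbox A = \bigcap_(i in [set: 'I_n])
    ((fun t : n.-tuple T => tnth t i) @^-1` A i)).
  apply: fin_bigcap_measurable => // i _.
  by rewrite -[X in measurable X]setTI; exact: measurable_tnth.
by apply/seteqP; split=> [t At i _|t At i]; [exact: At|exact: (At i I)].
Qed.

Lemma pbox_fin n (A : 'I_n -> set T) :
  (forall i, measurable (A i)) -> (forall i, mu (A i) < +oo)%E ->
  (measure_power mu n (pbox A) < +oo)%E.
Proof.
move=> mA Aoo; rewrite measure_power_box//.
have -> : (\prod_(i < n) mu (A i) = (\prod_(i < n) fine (mu (A i)))%:E)%E.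
  elim: n A {mA} Aoo => [|n IH] A Aoo; first by rewrite !big_ord0.
  rewrite !big_ord_recl IH//= EFinM fineK//.
  by rewrite ge0_fin_numE// measure_ge0.
exact: ltry.
Qed.

Lemma pbox_cons n (A : 'I_n.+1 -> set T) x t :
  pbox A (tuple_cons (x, t)) <-> A ord0 x /\ pbox (fun i => A (lift ord0 i)) t.
Proof.
split=> [At|[Ax At] i].
  split; first exact: (At ord0).
  by move=> i; have := At (lift ord0 i); rewrite /tuple_cons/= tnthS.
by case: (unliftP ord0 i) => [j ->|->]//; rewrite /tuple_cons/= tnthS.
Qed.

Section bounded.
Variables (n : nat) (A : 'I_n.+1 -> set T) (f : n.+1.-tuple T -> R).
Hypotheses (mA : forall i, measurable (A i)) (Aoo : forall i, (mu (A i) < +oo)%E).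
Hypothesis bf : bmeas (pbox A) f.

Let A' (i : 'I_n) := A (lift ord0 i).
(** Fubini's theorem is applied on the whole product space, hence the extension of [f] by 0. *)
Let g := (EFin \o f) \_ (pbox A).
Let mp : measurable (pbox A) := measurable_pbox mA.
Let mp' : measurable (pbox A') := measurable_pbox (fun i => mA _).

Let ig : (measure_power mu n.+1).-integrable setT g.
Proof.
apply: (proj1 (@integrable_mkcond _ _ _ (measure_power mu n.+1) _ (EFin \o f) mp)).
exact: bmeas_integrable mp (pbox_fin mA Aoo) bf.
Qed.

Let mg : measurable_fun setT g. Proof. by case/integrableP: ig. Qed.

Let igc : (mu \x measure_power mu n)%E.-integrable setT (g \o tuple_cons).
Proof.
apply/integrableP; split.
  by apply: measurableT_comp => //; exact: measurable_tuple_cons.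
case/integrableP: ig => _; apply: le_lt_trans.
rewrite [leRHS](_ : _ = \int[pushforward (mu \x measure_power mu n)%E tuple_cons]_t
   `|g t|)%E// ge0_integral_pushforward//=.
- exact: measurable_tuple_cons.
- exact: measurableT_comp.
Qed.

Let gE x t : (g (tuple_cons (x, t)) =
  if (x \in A ord0) && (t \in pbox A') then (f (tuple_cons (x, t)))%:E else 0)%E.
Proof.
rewrite /g patchE; congr (if _ then _ else _); apply/idP/andP.
  by move=> /set_mem/pbox_cons[? ?]; split; exact: mem_set.
by move=> [/set_mem ? /set_mem ?]; apply/mem_set/pbox_cons.
Qed.

Lemma bmeas_slice1 x : A ord0 x -> bmeas (pbox A') (fun t => f (tuple_cons (x, t))).
Proof.
move=> Ax; apply: (bmeas_comp mp _ _ bf) => [|t Bt]; last exact/pbox_cons.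
apply: measurable_funTS.
exact: (measurableT_comp measurable_tuple_cons (pair1_measurable x)).
Qed.

Lemma bmeas_slice2 t : pbox A' t -> bmeas (A ord0) (fun x => f (tuple_cons (x, t))).
Proof.
move=> At; apply: (bmeas_comp mp _ _ bf) => [|x Ax]; last exact/pbox_cons.
apply: measurable_funTS.
exact: (measurableT_comp measurable_tuple_cons (pair2_measurable t)).
Qed.

Let int1 x : A ord0 x -> (\int[measure_power mu n]_t g (tuple_cons (x, t)) =
  (\int[measure_power mu n]_(t in pbox A') f (tuple_cons (x, t)))%:E)%E.
Proof.
move=> Ax; rewrite fineK; last first.
  apply: integrable_fin_num => //; apply: bmeas_integrable => //.
    by apply: pbox_fin => i; rewrite /A'.
  exact: bmeas_slice1.
rewrite [RHS]integral_mkcond; apply: eq_integral => t _ /=.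
by rewrite gE patchE (mem_set Ax).
Qed.

Let int2 t : pbox A' t -> (\int[mu]_x g (tuple_cons (x, t)) =
  (\int[mu]_(x in A ord0) f (tuple_cons (x, t)))%:E)%E.
Proof.
move=> At; rewrite fineK; last first.
  apply: integrable_fin_num => //.
  by apply: bmeas_integrable; [|exact: Aoo|exact: bmeas_slice2].
rewrite [RHS]integral_mkcond; apply: eq_integral => x _ /=.
by rewrite gE patchE (mem_set At) andbT.
Qed.

(** [measure_power] is by construction the image of a product measure under [tuple_cons], so a
    change of variables reduces this to Fubini's theorem; the boundedness of [f] makes every slice
    integrable. *)
Lemma Rintegral_pbox :
  \int[measure_power mu n.+1]_(t in pbox A) f t =
  \int[mu]_(x in A ord0)
     \int[measure_power mu n]_(t in pbox A') f (tuple_cons (x, t)).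
Proof.
rewrite {1 2}/Rintegral; congr fine.
rewrite [LHS]integral_mkcond -/g.
rewrite [LHS](_ : _ = \int[pushforward (mu \x measure_power mu n)%E tuple_cons]_t g t)%E//.
rewrite integral_pushforward//=; last exact: measurable_tuple_cons.
rewrite preimage_setT -(integral12_prod_meas1 igc).
rewrite [RHS]integral_mkcond; apply: eq_integral => x _.
rewrite /fubini_F patchE; case: ifPn => [/set_mem Ax|/negbTE Ax]; first exact: int1.
by apply: integral0_eq => t _ /=; rewrite gE Ax.
Qed.

Lemma Rintegral_pbox_swap :
  \int[measure_power mu n.+1]_(t in pbox A) f t =
  \int[measure_power mu n]_(t in pbox A')
     \int[mu]_(x in A ord0) f (tuple_cons (x, t)).
Proof.
rewrite {1 2}/Rintegral; congr fine.
rewrite [LHS]integral_mkcond -/g.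
rewrite [LHS](_ : _ = \int[pushforward (mu \x measure_power mu n)%E tuple_cons]_t g t)%E//.
rewrite integral_pushforward//=; last exact: measurable_tuple_cons.
rewrite preimage_setT -(integral21_prod_meas1 igc).
rewrite [RHS]integral_mkcond; apply: eq_integral => t _.
rewrite /fubini_G patchE; case: ifPn => [/set_mem At|/negbTE At]; first exact: int2.
by apply: integral0_eq => x _ /=; rewrite gE At andbF.
Qed.

Lemma bmeas_inner1 : bmeas (A ord0)
  (fun x => \int[measure_power mu n]_(t in pbox A') f (tuple_cons (x, t))).
Proof.
have [_ [B fB]] := bf.
split.
  apply: (@eq_measurable_fun _ _ _ _ _ (fine \o fubini_F (measure_power mu n) (g \o tuple_cons))).
    by move=> x /set_mem Ax; rewrite /= /fubini_F/= int1.
  apply: measurable_funTS; apply: measurableT_comp; first exact: fine_measurable.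
  exact: measurable_fubini_F igc.
exists (B * fine (measure_power mu n (pbox A'))) => x Ax.
have oo : (measure_power mu n (pbox A') < +oo)%E.
  by apply: pbox_fin => i; rewrite /A'.
apply: le_trans (le_normr_Rintegral _ _) _ => //.
  by apply: bmeas_integrable => //; exact: bmeas_slice1.
rewrite -Rintegral_cst//; apply: le_Rintegral => //.
- by apply: bmeas_integrable => //; apply: bmeas_norm; exact: bmeas_slice1.
- by apply: bmeas_integrable; auto with bm.
- by move=> t At; apply: fB; exact/pbox_cons.
Qed.

Lemma bmeas_inner2 : bmeas (pbox A')
  (fun t => \int[mu]_(x in A ord0) f (tuple_cons (x, t))).
Proof.
have [_ [B fB]] := bf.
split.
  apply: (@eq_measurable_fun _ _ _ _ _ (fine \o fubini_G mu (g \o tuple_cons))).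
    by move=> t /set_mem At; rewrite /= /fubini_G/= int2.
  apply: measurable_funTS; apply: measurableT_comp; first exact: fine_measurable.
  exact: measurable_fubini_G igc.
exists (B * fine (mu (A ord0))) => t At.
apply: le_trans (le_normr_Rintegral _ _) _ => //.
  by apply: bmeas_integrable; [|exact: Aoo|exact: bmeas_slice2].
rewrite -Rintegral_cst//; apply: le_Rintegral => //.
- by apply: bmeas_integrable; [|exact: Aoo|apply: bmeas_norm; exact: bmeas_slice2].
- by apply: bmeas_integrable; [|exact: Aoo|auto with bm].
- by move=> x Ax; apply: fB; exact/pbox_cons.
Qed.

End bounded.

End power_measure.

Section cauchy_schwarz.
Context {d} {T : measurableType d} {R : realType}.
Variable mu : {measure set T -> \bar R}.

Lemma Rintegral_CS D (f g : T -> R) : measurable D ->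
  mu.-integrable D (EFin \o (fun x => f x ^+ 2)) ->
  mu.-integrable D (EFin \o (fun x => g x ^+ 2)) ->
  mu.-integrable D (EFin \o (fun x => f x * g x)) ->
  (\int[mu]_(x in D) (f x * g x)) ^+ 2 <=
  \int[mu]_(x in D) (f x ^+ 2) * \int[mu]_(x in D) (g x ^+ 2).
Proof.
move=> mD iff igg ifg.
set F := \int[mu]_(x in D) (f x ^+ 2); set G := \int[mu]_(x in D) (g x ^+ 2).
set H := \int[mu]_(x in D) (f x * g x).
have F0 : 0 <= F by apply: Rintegral_ge0 => x _; exact: sqr_ge0.
have G0 : 0 <= G by apply: Rintegral_ge0 => x _; exact: sqr_ge0.
have quad (a b : R) : 0 <= a ^+ 2 * F + b ^+ 2 * G - 2 * a * b * H.
  have ia : mu.-integrable D (EFin \o (fun x => a ^+ 2 * f x ^+ 2)).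
    by have := integrableZl mD (a ^+ 2) iff.
  have ib : mu.-integrable D (EFin \o (fun x => b ^+ 2 * g x ^+ 2)).
    by have := integrableZl mD (b ^+ 2) igg.
  have ic : mu.-integrable D (EFin \o (fun x => 2 * a * b * (f x * g x))).
    by have := integrableZl mD (2 * a * b) ifg.
  rewrite -!RintegralZl// -RintegralD// -RintegralB//; last first.
    by have := integrableD mD ia ib.
  by apply: Rintegral_ge0 => x _; have := sqr_ge0 (a * f x - b * g x); lra.
have [G0'|] := ltP 0 G.
  by have := quad G H; rewrite (_ : _ - _ = G * (F * G - H ^+ 2)) ?pmulr_rge0 ?subr_ge0//; ring.
move=> Gle0; have GE : G = 0 by apply/eqP; rewrite eq_le Gle0.
suff -> : H = 0 by rewrite expr0n mulr_ge0.
have [//|H0] := eqVneq H 0; exfalso.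
(* When [G = 0] the quadratic form at [(H, F + 1)] equals [- H^2 (F + 2)], which is negative unless
   [H = 0]. *)
have := quad H (F + 1); rewrite GE.
have : 0 < H ^+ 2 by rewrite exprn_even_gt0.
nra.
Qed.

Lemma Rintegral_CS_bmeas D (f g : T -> R) : measurable D -> (mu D < +oo)%E ->
  bmeas D f -> bmeas D g ->
  (\int[mu]_(x in D) (f x * g x)) ^+ 2 <=
  \int[mu]_(x in D) (f x ^+ 2) * \int[mu]_(x in D) (g x ^+ 2).
Proof.
move=> mD Doo bf bg; apply: Rintegral_CS => //; apply: bmeas_integrable; auto with bm.
Qed.

End cauchy_schwarz.

(** * Functions of class C1 *)

Section directional_derivatives.
Context {R : realType}.

(** Only the derivative in the direction [v] is assumed, not differentiability, so the chain rule is
    applied in one variable, on the line through [x]. *)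
Lemma is_derive_comp (V : normedModType R) (f : V -> R) (p : R -> R) x v df dp :
  is_derive x v f df -> is_derive (f x) 1 p dp ->
  is_derive x v (p \o f) (dp * df).
Proof.
move=> [dfx <-] [dpx dpE].
pose h := fun s : R => f (s *: v + x).
have h0 : h 0 = f x by rewrite /h scale0r add0r.
have dh : derivable h 0 1 := proj1 (derivable1P f x v) dfx.
rewrite -h0 in dpx dpE *.
have diff_ph : differentiable (p \o h) 0.
  apply: differentiable_comp; first exact: (proj1 (derivable1_diffP _ _) dh).
  exact: (proj1 (derivable1_diffP _ _) dpx).
have dph : derivable (p \o h) 0 1 := proj2 (derivable1_diffP _ _) diff_ph.
have shiftE (k : V -> R) : 'D_v k x = 'D_1 (fun s : R => k (s *: v + x)) 0.
  rewrite /derive /=; congr (lim (_ @ 0^')); apply/funext => s /=.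
  by rewrite addr0 scale0r add0r [_%:A]mulr1.
apply: DeriveDef; first exact: (proj2 (derivable1P (p \o f) x v) dph).
rewrite (shiftE (p \o f)) (shiftE f) -dpE.
have := derive1_comp dh dpx.
by rewrite !derive1E => <-.
Qed.

End directional_derivatives.

Section smooth_functions.
Context {R : realType} {d : nat}.
Implicit Types (O : set 'rV[R]_d) (f g : 'rV[R]_d -> R).

Local Notation e_ i := (delta_mx ord0 i : 'rV[R]_d).

Lemma eq_continuous_open O f g u : open O -> O u ->
  (forall w, O w -> f w = g w) ->
  {for u, continuous f} -> {for u, continuous g}.
Proof.
move=> oO Ou fg cf.
have {}cf : f @ u --> g u by rewrite -fg.
have nfg : {near nbhs u, f =1 g}.
  by apply: filterS (open_nbhs_nbhs (conj oO Ou)) => w /fg.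
exact: cvg_trans (near_eq_cvg nfg) cf.
Qed.

Lemma eq_is_derive_open O f g u v df : open O -> O u ->
  (forall w, O w -> f w = g w) -> is_derive u v f df -> is_derive u v g df.
Proof.
move=> oO Ou fg; apply: near_eq_is_derive.
by apply: filterS (open_nbhs_nbhs (conj oO Ou)) => w /fg.
Qed.

Record C1 O f : Prop := IsC1 {
  C1_cont : forall u, O u -> {for u, continuous f};
  C1_derive : forall i u, O u -> is_derive u (e_ i) f ('D_(e_ i) f u);
  C1_dcont : forall i u, O u -> {for u, continuous ('D_(e_ i) f)} }.

Lemma C1P O f (G : 'I_d -> 'rV[R]_d -> R) : open O ->
  (forall u, O u -> {for u, continuous f}) ->
  (forall i u, O u -> is_derive u (e_ i) f (G i u)) ->
  (forall i u, O u -> {for u, continuous (G i)}) -> C1 O f.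
Proof.
move=> oO cf df cG; split=> // i u Ou.
  by have [fu _] := df i u Ou; exact: derivableP.
apply: (eq_continuous_open oO Ou _ (cG i u Ou)) => w Ow.
by have [_ ->] := df i w Ow.
Qed.

Lemma C1_Cn1 O f : Cn_on 1 O f -> C1 O f.
Proof.
move=> [cf df]; split=> // i u Ou; have [dfu [cdf _]] := df i.
  exact/derivableP/dfu.
exact: cdf.
Qed.

Lemma eq_C1 O f g : open O -> (forall w, O w -> f w = g w) -> C1 O f -> C1 O g.
Proof.
move=> oO fg cf; apply: (@C1P _ _ (fun i => 'D_(e_ i) f)) => // [u Ou|i u Ou|i u Ou].
- exact: (eq_continuous_open oO Ou fg (C1_cont cf Ou)).
- exact: (eq_is_derive_open oO Ou fg (C1_derive cf i Ou)).
- exact: C1_dcont cf i u Ou.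
Qed.

Lemma C1_cst O c : open O -> C1 O (cst c).
Proof.
move=> oO; apply: (@C1P _ _ (fun=> cst 0)) => // [u Ou|i u Ou].
  exact: cst_continuous.
exact: cst_continuous.
Qed.

Lemma C1D O f g : open O -> C1 O f -> C1 O g -> C1 O (fun u => f u + g u).
Proof.
move=> oO cf cg.
apply: (@C1P _ _ (fun i u => 'D_(e_ i) f u + 'D_(e_ i) g u)) => // [u Ou|i u Ou|i u Ou].
- by apply: continuousD; [exact: C1_cont cf _ Ou|exact: C1_cont cg _ Ou].
- by apply: is_deriveD; [exact: C1_derive cf i _ Ou|exact: C1_derive cg i _ Ou].
- by apply: continuousD; [exact: C1_dcont cf i _ Ou|exact: C1_dcont cg i _ Ou].
Qed.

Lemma C1M O f g : open O -> C1 O f -> C1 O g -> C1 O (fun u => f u * g u).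
Proof.
move=> oO cf cg.
apply: (@C1P _ _ (fun i u => f u * 'D_(e_ i) g u + g u * 'D_(e_ i) f u)) => // [u Ou|i u Ou|i u Ou].
- by apply: continuousM; [exact: C1_cont cf _ Ou|exact: C1_cont cg _ Ou].
- by apply: is_deriveM; [exact: C1_derive cf i _ Ou|exact: C1_derive cg i _ Ou].
- apply: continuousD; apply: continuousM.
  + exact: C1_cont cf _ Ou.
  + exact: C1_dcont cg i _ Ou.
  + exact: C1_cont cg _ Ou.
  + exact: C1_dcont cf i _ Ou.
Qed.

Lemma C1_sum O (I : Type) (s : seq I) (P : pred I) (f : I -> 'rV[R]_d -> R) :
  open O -> (forall i, C1 O (f i)) -> C1 O (fun u => \sum_(i <- s | P i) f i u).
Proof.
move=> oO cf; elim: s => [|i s IH].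
  by under eq_fun do rewrite big_nil; exact: C1_cst.
by under eq_fun do rewrite big_cons; case: (P i) => //; exact: C1D.
Qed.

Lemma C1_prod O (I : Type) (s : seq I) (P : pred I) (f : I -> 'rV[R]_d -> R) :
  open O -> (forall i, C1 O (f i)) -> C1 O (fun u => \prod_(i <- s | P i) f i u).
Proof.
move=> oO cf; elim: s => [|i s IH].
  by under eq_fun do rewrite big_nil; exact: C1_cst.
by under eq_fun do rewrite big_cons; case: (P i) => //; exact: C1M.
Qed.

Lemma C1_comp O f (p dp : R -> R) : open O -> C1 O f ->
  (forall u, O u -> is_derive (f u) 1 p (dp (f u))) ->
  (forall u, O u -> {for f u, continuous dp}) -> C1 O (p \o f).
Proof.
move=> oO cf dpf cdp.
apply: (@C1P _ _ (fun i u => dp (f u) * 'D_(e_ i) f u)) => // [u Ou|i u Ou|i u Ou].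
- apply: continuous_comp; first exact: C1_cont cf _ Ou.
  by apply/differentiable_continuous/derivable1_diffP; case: (dpf u Ou).
- exact: is_derive_comp (C1_derive cf i Ou) (dpf u Ou).
- apply: continuousM; last exact: C1_dcont cf i _ Ou.
  by apply: continuous_comp; [exact: C1_cont cf _ Ou|exact: cdp].
Qed.

Lemma C1_inv O f : open O -> C1 O f -> (forall u, O u -> f u != 0) ->
  C1 O (fun u => (f u)^-1).
Proof.
move=> oO cf f0.
apply: (C1_comp (dp := fun x => - (x ^-2))) => [//|//|u Ou|u Ou].
  have := is_deriveV (f0 u Ou) (is_derive_id (f u) (1 : R)).
  by rewrite [_ *: _]mulr1.
apply: continuousN; apply: continuousV; first by rewrite expf_neq0 ?f0.
exact: exprn_continuous.
Qed.

Lemma C1_sqrt O f : open O -> C1 O f -> (forall u, O u -> 0 < f u) ->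
  C1 O (fun u => Num.sqrt (f u)).
Proof.
move=> oO cf f0.
apply: (C1_comp (dp := fun x => (2 * Num.sqrt x)^-1)) => // u Ou.
  exact/is_derive1_sqrt/f0.
apply: continuousV; first by rewrite mulf_neq0 ?pnatr_eq0// gt_eqF ?sqrtr_gt0 ?f0.
by apply: continuousM; [exact: cst_continuous|exact: sqrt_continuous].
Qed.

Lemma C1_det O n (G : 'rV[R]_d -> 'M[R]_n) : open O ->
  (forall i j, C1 O (fun u => G u i j)) -> C1 O (fun u => \det (G u)).
Proof.
move=> oO cG; apply: C1_sum => // s.
by apply: C1M => //; [exact: C1_cst|exact: C1_prod].
Qed.

Lemma C1_invmx O n (G : 'rV[R]_d -> 'M[R]_n) i j : open O ->
  (forall i j, C1 O (fun u => G u i j)) -> (forall u, O u -> \det (G u) != 0) ->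
  C1 O (fun u => invmx (G u) i j).
Proof.
move=> oO cG G0.
apply: (@eq_C1 _ (fun u => (\det (G u))^-1 * ((-1) ^+ (j + i) *
    \det (row' j (col' i (G u)))))) => //.
  by move=> u Ou; rewrite /invmx unitmxE unitfE G0//= !mxE.
apply: C1M => //; first by apply: C1_inv => //; exact: C1_det.
apply: C1M => //; first exact: C1_cst.
apply: C1_det => // a b.
by under eq_fun do rewrite !mxE.
Qed.

End smooth_functions.

(** * Positive definite matrices *)

Section posdef.
Context {R : realType} {n : nat}.
Implicit Types (G : 'M[R]_n) (v : 'rV[R]_n).

(** The determinant of [(1 - t) I + t G] is a polynomial in [t], equal to 1 at 0 and without zeros
    on [0, 1] because each of these matrices is positive definite; a nonpositive value at 1 would
    contradict the intermediate value theorem. *)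
Lemma posdef_det_gt0 G :
  (forall v, v != 0 -> 0 < (v *m G *m v^T) ord0 ord0) -> 0 < \det G.
Proof.
move=> Gpos.
pose p := \det ((1 - 'X)%:M + 'X *: map_mx polyC G).
have pE t : p.[t] = \det ((1 - t)%:M + t *: G).
  rewrite /p -horner_evalE -det_map_mx; congr (\det _).
  apply/matrixP => i j; rewrite !mxE /= /horner_eval !hornerE.
  by case: (i == j); rewrite ?mulr1n ?mulr0n !hornerE.
have p_neq0 t : 0 <= t <= 1 -> p.[t] != 0.
  move=> /andP[t0 t1]; rewrite pE; apply/det0P => -[v v0].
  move=> /(congr1 (fun w => (w *m v^T) ord0 ord0)).
  rewrite mul0mx mulmxDr mulmxDl mul_mx_scalar -scalemxAr -!scalemxAl.
  rewrite mxE [X in X + _]mxE [X in _ + X]mxE [RHS]mxE => /eqP.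
  apply/negP.
  have vv : 0 < (v *m v^T) ord0 ord0.
    have [i vi] := rV0Pn _ v0.
    rewrite mxE (bigD1 i)//= ltr_pwDl//.
      by rewrite mxE -expr2 exprn_even_gt0.
    by apply: sumr_ge0 => j _; rewrite mxE -expr2 sqr_ge0.
  have vG := Gpos v v0.
  have [->|t_neq1] := eqVneq t 1.
    by rewrite subrr mul0r add0r mul1r gt_eqF.
  rewrite gt_eqF// ltr_pwDl//; last by rewrite mulr_ge0// ltW.
  by rewrite mulr_gt0// subr_gt0 lt_neqAle t_neq1.
have p0 : p.[0] = 1 by rewrite pE subr0 scale0r addr0 det1.
have p1 : p.[1] = \det G by rewrite pE subrr scale1r -scalemx1 scale0r add0r.
rewrite -p1 ltNge; apply/negP => p1le0.
have [|x x01 /eqP rx] := @poly_ivt _ (- p) 0 1 ler01.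
  by rewrite !hornerN p0 oppr_le0 ler01 oppr_ge0.
by have := p_neq0 x; rewrite -[p.[x]]opprK -hornerN rx oppr0 eqxx; apply/implyP.
Qed.

(** The Cauchy-Schwarz inequality, for the scalar product of [G], between [v G^-1] and the basis
    vector [e_c], whose product is [v_c]. It will compare a partial derivative with the length of
    the gradient. *)
Lemma posdef_cauchy_schwarz G v c : G^T = G ->
  (forall v, v != 0 -> 0 < (v *m G *m v^T) ord0 ord0) ->
  v ord0 c ^+ 2 <= G c c * (v *m invmx G *m v^T) ord0 ord0.
Proof.
move=> Gsym Gpos.
have Gunit : G \in unitmx by rewrite unitmxE unitfE gt_eqF// posdef_det_gt0.
have Gpos0 (w : 'rV_n) : 0 <= (w *m G *m w^T) ord0 ord0.
  by have [->|w0] := eqVneq w 0; [rewrite !mul0mx mxE|exact/ltW/Gpos].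
pose q := (v *m invmx G *m v^T) ord0 ord0.
have Gcc : 0 < G c c.
  have /Gpos : (delta_mx ord0 c : 'rV[R]_n) != 0.
    by apply/rV0Pn; exists c; rewrite mxE !eqxx oner_neq0.
  by rewrite -rowE trmx_delta -colE !mxE.
pose t := v ord0 c / G c c.
have := Gpos0 (v *m invmx G - t *: delta_mx ord0 c).
have -> : ((v *m invmx G - t *: delta_mx ord0 c) *m G *m
  (v *m invmx G - t *: delta_mx ord0 c)^T) ord0 ord0 =
  q - 2 * t * v ord0 c + t ^+ 2 * G c c.
  rewrite mulmxBl mulmxKV// linearB /= trmx_mul trmx_inv Gsym linearZ /= trmx_delta.
  rewrite -scalemxAl -rowE mulmxBr !mulmxBl -!scalemxAl -!scalemxAr.
  rewrite mulmxA -/q mulmxA [row c G *m invmx G](_ : _ = delta_mx ord0 c); last first.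
    by rewrite rowE mulmxK.
  rewrite -rowE -colE.
  have wE : (row c G *m delta_mx c (ord0 : 'I_1)) ord0 ord0 = G c c.
    rewrite mxE (bigD1 c)//= !mxE !eqxx mulr1 big1 ?addr0// => j /negbTE jc.
    by rewrite !mxE jc mulr0.
  move: (row c G *m delta_mx c ord0) wE => w wE.
  by rewrite /q; move: (v *m invmx G *m v^T) => Q; rewrite !mxE wE; ring.
rewrite -/q => q_ge0.
have -> : G c c * q = v ord0 c ^+ 2 + G c c * (q - 2 * t * v ord0 c + t ^+ 2 * G c c).
  by rewrite /t; field; rewrite gt_eqF.
by rewrite lerDl mulr_ge0// ltW.
Qed.

End posdef.

(** * The Poincare inequality on boxes *)

Section Rintegral_extra.
Context {d} {T : measurableType d} {R : realType}.
Variable mu : {measure set T -> \bar R}.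

Lemma Rintegral_subset (A B : set T) (f : T -> R) :
  measurable A -> measurable B -> (mu B < +oo)%E -> A `<=` B -> bmeas B f ->
  (forall x, B x -> 0 <= f x) ->
  \int[mu]_(x in A) f x <= \int[mu]_(x in B) f x.
Proof.
move=> mA mB Boo AB bf f0.
have Aoo : (mu A < +oo)%E by apply: le_lt_trans Boo; apply: le_measure; rewrite ?inE.
rewrite /Rintegral fine_le//.
- by apply: integrable_fin_num => //; apply: bmeas_integrable => //; exact: bmeasS bf.
- by apply: integrable_fin_num => //; exact: bmeas_integrable.
- apply: ge0_subset_integral => //; first by case: bf => /measurable_EFinP.
Qed.

Lemma Rintegral_sum D (I : Type) (s : seq I) (P : pred I) (f : I -> T -> R) :
  measurable D -> (forall i, mu.-integrable D (EFin \o f i)) ->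
  \int[mu]_(x in D) (\sum_(i <- s | P i) f i x) =
  \sum_(i <- s | P i) \int[mu]_(x in D) f i x.
Proof.
move=> mD fi; elim: s => [|i s IH].
  under eq_Rintegral do rewrite big_nil.
  by rewrite big_nil Rintegral_cst ?mul0r.
under eq_Rintegral do rewrite big_cons.
rewrite big_cons; case: (P i) => //; rewrite -IH RintegralD//.
rewrite [X in mu.-integrable _ X](_ : _ = fun x => (\sum_(i <- s | P i) (f i x)%:E)%E).
  by apply: integrable_sum => // j _; exact: fi.
by apply/funext => x; rewrite /= sumEFin.
Qed.

End Rintegral_extra.

Section tuples_and_vectors.
Context {R : realType}.
Local Notation MR := (measurableTypeR R).
Local Notation lam := (@lebesgue_measure_tuple R).

Definition upd n (t : n.-tuple MR) (c : 'I_n) (s : MR) : n.-tuple MR :=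
  [tuple if i == c then s else tnth t i | i < n].

Lemma tnth_upd n (t : n.-tuple MR) c s i :
  tnth (upd t c s) i = if i == c then s else tnth t i.
Proof. by rewrite tnth_mktuple. Qed.

Lemma upd_id n (t : n.-tuple MR) c : upd t c (tnth t c) = t.
Proof. by apply: eq_from_tnth => i; rewrite tnth_upd; case: eqP => [->|]. Qed.

Lemma upd_cons0 n x (t : n.-tuple MR) s :
  upd (tuple_cons (x, t)) ord0 s = tuple_cons (s, t).
Proof.
apply: eq_from_tnth => i; rewrite tnth_upd.
by case: (unliftP ord0 i) => [j ->|->]//=; rewrite /tuple_cons !tnthS.
Qed.

Lemma upd_consS n x (t : n.-tuple MR) c s :
  upd (tuple_cons (x, t)) (lift ord0 c) s = tuple_cons (x, upd t c s).
Proof.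
apply: eq_from_tnth => i; rewrite tnth_upd.
case: (unliftP ord0 i) => [j ->|->]//=; rewrite /tuple_cons !tnthS.
by rewrite (inj_eq lift_inj) tnth_upd.
Qed.

Lemma rV_upd n (t : n.-tuple MR) c s :
  rV_of_tuple (upd t c s) = rV_of_tuple t + (s - tnth t c) *: delta_mx ord0 c.
Proof.
apply/rowP => i; rewrite !mxE tnth_upd eqxx /=.
by case: eqP => [->|_]; rewrite ?mulr1 ?mulr0 ?addr0// addrC subrK.
Qed.

Lemma is_derive_upd n (t : n.-tuple MR) c (s : R) (f : 'rV[R]_n -> R) df :
  is_derive (rV_of_tuple (upd t c s)) (delta_mx ord0 c) f df ->
  is_derive s 1 (fun s => f (rV_of_tuple (upd t c s))) df.
Proof.
have E : (fun h : R => h^-1 *: (((fun s => f (rV_of_tuple (upd t c s))) \o shift s) (h *: 1) -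
    f (rV_of_tuple (upd t c s)))) = (fun h => h^-1 *: ((f \o shift (rV_of_tuple (upd t c s)))
      (h *: (delta_mx ord0 c)) - f (rV_of_tuple (upd t c s)))).
  apply/funext => h /=; congr (_ *: (f _ - _)).
  rewrite [h *: 1]mulr1 !rV_upd addrCA -scalerDl; congr (_ + _ *: _); ring.
by move=> [dfu dfE]; split; rewrite ?/derivable ?/derive E.
Qed.

Lemma continuous_upd n (t : n.-tuple MR) c (s : R) (f : 'rV[R]_n -> R) :
  {for rV_of_tuple (upd t c s), continuous f} ->
  {for s, continuous (fun s : R => f (rV_of_tuple (upd t c s)))}.
Proof.
move=> cf; apply: (@continuous_comp _ _ _ (fun s : R => rV_of_tuple (upd t c s)) f) => //.
have -> : (fun s : R => rV_of_tuple (upd t c s)) =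
  (fun s : R => rV_of_tuple t + (s - tnth t c) *: delta_mx ord0 c).
  by apply/funext => h; exact: rV_upd.
apply: continuousD; first exact: cst_continuous.
apply: continuousZr_tmp.
by apply: continuousB; [exact: cvg_id|exact: cst_continuous].
Qed.

(** The measurable sets of tuples are generated by the coordinates, so an open set is written as the
    countable union of the cubes with rational centres and radii [1 / (n + 1)] that it contains. *)
Lemma measurable_rV_open n (O : set 'rV[R]_n) : open O ->
  measurable [set t : n.-tuple MR | O (rV_of_tuple t)].
Proof.
move=> oO.
pose cube (x : n.-tuple rat * nat) : set (n.-tuple MR) :=
  pbox (fun i => [set y : MR | `|ratr (tnth x.1 i) - y| < x.2.+1%:R^-1]).
pose F k := match unpickle k with
  | Some x => if `[< cube x `<=` [set t | O (rV_of_tuple t)] >] then cube x else set0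
  | None => set0 end.
have -> : [set t : n.-tuple MR | O (rV_of_tuple t)] = \bigcup_k F k.
  apply/seteqP; split => [t /= Ot|t [k _]]; last first.
    by rewrite /F; case: unpickle => // x; case: asboolP => // xO /xO.
  have [e e0 eO] : exists2 e, 0 < e & forall u : 'rV[R]_n, (forall i, `|tnth t i - u ord0 i| < e) -> O u.
    have := open_nbhs_nbhs (conj oO Ot) => /nbhs_ballP[e /= e0 eO].
    exists e => // u tu; apply: eO; split=> // i j; rewrite ord1 /ball /=.
    by rewrite mxE.
  (* Two points of a cube of radius [1 / (k + 1)] differ in each coordinate by less than twice the
     radius. *)
  have [k ke] : exists k : nat, k.+1%:R^-1 + k.+1%:R^-1 <= e.
    have e20 : 0 < e / 2 by rewrite divr_gt0.
    have [k _ /(_ k (leqnn k)) /= ke] := near_infty_natSinv_lt (PosNum e20).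
    by exists k; rewrite (le_trans (ltW (ltrD ke ke)))// -splitr.
  have k0 : 0 < k.+1%:R^-1 :> R by rewrite invr_gt0.
  have /choice[q qt] (i : 'I_n) : exists q : rat, `|ratr q - tnth t i| < k.+1%:R^-1.
    have [|q /andP[q1 q2]] := @rat_in_itvoo R (tnth t i - k.+1%:R^-1) (tnth t i + k.+1%:R^-1).
      by rewrite ltrD2l gtrN.
    by exists q; rewrite ltr_distl; apply/andP.
  pose x : n.-tuple rat * nat := ([tuple q i | i < n], k).
  exists (pickle x) => //; rewrite /F pickleK.
  have tx : cube x t by move=> i; rewrite /= tnth_mktuple.
  case: asboolP => // -[]; move=> s sx /=; apply: eO => i; rewrite mxE.
  apply: lt_le_trans ke.
  have := tx i; have := sx i; rewrite /= => h1 h2.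
  rewrite (_ : _ - _ = - (ratr (tnth x.1 i) - tnth t i) + (ratr (tnth x.1 i) - tnth s i)); last ring.
  by rewrite (le_lt_trans (ler_normD _ _))// normrN ltrD.
apply: bigcup_measurable => k _; rewrite /F; case: unpickle => // x.
case: asboolP => // _; apply: measurable_pbox => i.
rewrite (_ : [set y | _] = [set` `]ratr (tnth x.1 i) - x.2.+1%:R^-1, ratr (tnth x.1 i) + x.2.+1%:R^-1[%R]); first exact: measurable_itv.
by apply/seteqP; split => y /=; rewrite in_itv/= distrC ltr_distl.
Qed.

Lemma measurable_rV_comp n (O : set 'rV[R]_n) (f : 'rV[R]_n -> R) (B : set (n.-tuple MR)) :
  open O -> (forall u, O u -> {for u, continuous f}) -> measurable B ->
  (forall t, B t -> O (rV_of_tuple t)) -> measurable_fun B (f \o @rV_of_tuple R n).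
Proof.
move=> oO cf mB BO.
apply: (measurability _ (RGenOInfty.measurableE R)) => // _ [_ [a ->] <-].
rewrite (_ : _ `&` _ = B `&` [set t | (O `&` [set u | a < f u]) (rV_of_tuple t)]).
  apply: measurableI => //; apply: measurable_rV_open.
  rewrite openE => u [Ou /= fu]; rewrite /interior.
  apply: filterI; first exact: open_nbhs_nbhs.
  have := open_nbhs_nbhs (conj (@open_gt R a) fu).
  exact: (cf u Ou).
apply/seteqP; split => t /=; rewrite in_itv/= andbT.
  by move=> [Bt fa]; do !split => //; exact: BO.
by move=> [Bt []].
Qed.

Definition cbox n (lo hi : 'I_n -> R) := pbox (fun i => [set` `[lo i, hi i]] : set MR).

Lemma bmeas_rV n (O : set 'rV[R]_n) (f : 'rV[R]_n -> R) (lo hi : 'I_n -> R) :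
  open O -> (forall u, O u -> {for u, continuous f}) ->
  (forall t, cbox lo hi t -> O (rV_of_tuple t)) -> bmeas (cbox lo hi) (f \o @rV_of_tuple R n).
Proof.
move=> oO cf KO; split.
  apply: measurable_rV_comp oO cf _ KO; apply: measurable_pbox => i; exact: measurable_itv.
pose K := [set v : 'rV[R]_n | forall i, `[lo i, hi i]%classic (v ord0 i)].
have cK : compact K by apply: (@rV_compact R n (fun i => `[lo i, hi i]%classic)) => i; exact: segment_compact.
have KtO v : K v -> exists2 t, cbox lo hi t & v = rV_of_tuple t.
  move=> Kv; exists [tuple v ord0 i | i < n] => [i|].
    by rewrite tnth_mktuple; exact: Kv.
  by apply/rowP => i; rewrite mxE tnth_mktuple.
have [B [_ fB]] : bounded_set (f @` K).
  apply: compact_bounded; apply: continuous_compact => //.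
  apply: continuous_in_subspaceT => v /set_mem /KtO[t /KO Ot ->]; exact: cf.
exists (B + 1) => t Kt; apply: (fB (B + 1)); first by rewrite ltrDl.
by exists (rV_of_tuple t) => // i; rewrite mxE; exact: Kt.
Qed.


Lemma itv_lt_pinfty (a b : R) : (lebesgue_measure (`[a, b]%classic : set MR) < +oo)%E.
Proof. by rewrite lebesgue_measure_itv /=; case: ifP => _; rewrite ?ltry. Qed.

Lemma FTC_line (f g : R -> R) (a b : R) : a <= b ->
  (forall s, a <= s <= b -> is_derive s 1 f (g s)) ->
  (forall s, a <= s <= b -> {for s, continuous g}) ->
  \int[lebesgue_measure]_(s in `[a, b]) g s = f b - f a.
Proof.
rewrite le_eqVlt => /predU1P[<- _ _|ab fg cg].
  by rewrite set_itv1 Rintegral_set1 subrr.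
have cf s : a <= s <= b -> {for s, continuous f}.
  by move=> /fg[ds _]; exact/differentiable_continuous/derivable1_diffP.
rewrite /Rintegral (@continuous_FTC2 _ g f)//.
- apply: continuous_in_subspaceT => s; rewrite inE /= in_itv/=; exact: cg.
- split.
  + by move=> s; rewrite in_itv/= => /andP[/ltW ? /ltW ?]; have [] := fg s _; [apply/andP|].
  + by apply: cvg_at_right_filter; apply: cf; rewrite lexx ltW.
  + by apply: cvg_at_left_filter; apply: cf; rewrite lexx ltW.
- move=> s; rewrite in_itv/= => /andP[/ltW ? /ltW ?].
  by rewrite derive1E; have [|_ ->] := fg s _; first exact/andP.
Qed.

Lemma continuous_bmeas_itv (f : R -> R) (a b : R) :
  (forall s, a <= s <= b -> {for s, continuous f}) ->
  bmeas (`[a, b]%classic : set MR) f.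
Proof.
move=> cf.
have wf : {within `[a, b], continuous f}.
  by apply: continuous_in_subspaceT => s; rewrite inE /= in_itv/=; exact: cf.
split; first exact: subspace_continuous_measurable_fun.
have [B [_ fB]] : bounded_set (f @` `[a, b]).
  apply: compact_bounded; apply: continuous_compact => //; exact: segment_compact.
exists (B + 1) => t Kt; apply: (fB (B + 1)); first by rewrite ltrDl.
by exists t.
Qed.

(** By the fundamental theorem of calculus, [f x] and [f y] differ by at most the integral of [|g|],
    whatever [y]; the bound is the mean over [y]. *)
Lemma line_bound (f g : R -> R) (a r : R) x : 0 < r ->
  (forall s, a <= s <= a + r -> is_derive s 1 f (g s)) ->
  (forall s, a <= s <= a + r -> {for s, continuous g}) ->
  a <= x <= a + r ->
  `|f x| <= r^-1 * \int[lebesgue_measure]_(s in `[a, (a + r)%R]) `|f s| +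
    \int[lebesgue_measure]_(s in `[a, (a + r)%R]) `|g s|.
Proof.
move=> r0 fg cg /andP[ax xb].
have cf s : a <= s <= a + r -> {for s, continuous f}.
  by move=> /fg[ds _]; exact/differentiable_continuous/derivable1_diffP.
have bf := continuous_bmeas_itv cf; have bg := continuous_bmeas_itv cg.
set I := `[a, (a + r)%R]%classic; set G := \int[_]_(_ in _) `|g _|.
have mI : measurable (I : set MR) by exact: measurable_itv.
have ming y z : a <= y -> y <= z -> z <= a + r -> `|f z - f y| <= G.
  move=> ay yz zb.
  have <- : \int[lebesgue_measure]_(s in `[y, z]) g s = f z - f y.
    apply: FTC_line => // s /andP[ys sz].
      by apply: fg; rewrite (le_trans ay) ?(le_trans sz).
    by apply: cg; rewrite (le_trans ay) ?(le_trans sz).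
  have yzI : `[y, z] `<=` I by apply: subset_itvScc; rewrite bnd_simp.
  apply: le_trans (le_normr_Rintegral _ _) _ => //.
    apply: bmeas_integrable => //; first exact: itv_lt_pinfty.
    exact: bmeasS yzI bg.
  apply: Rintegral_subset => //; [exact: itv_lt_pinfty|exact: bmeas_norm].
have key y : a <= y <= a + r -> `|f x| <= `|f y| + G.
  move=> /andP[ay yb].
  rewrite (_ : f x = f y + (f x - f y)); last by rewrite addrC subrK.
  rewrite (le_trans (ler_normD _ _))// lerD2l.
  have [xy|/ltW yx] := leP x y; last exact: ming.
  by rewrite distrC; exact: ming.
have muI : fine (lebesgue_measure (I : set MR)) = r.
  by rewrite /I lebesgue_measure_itv /= lte_fin ltrDl r0 -EFinD/= addrC addKr.
have Ioo : (lebesgue_measure (I : set MR) < +oo)%E by exact: itv_lt_pinfty.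
have : \int[lebesgue_measure]_(y in I) `|f x| <= \int[lebesgue_measure]_(y in I) (`|f y| + G).
  apply: le_Rintegral => //.
  - by apply: bmeas_integrable; auto 20 with bm.
  - by apply: bmeas_integrable; auto 20 with bm.
rewrite RintegralD//; last 2 first.
- by apply: bmeas_integrable; auto 20 with bm.
- by apply: bmeas_integrable; auto 20 with bm.
rewrite !Rintegral_cst// muI -ler_pdivlMr// mulrDl mulfK ?gt_eqF//.
by rewrite [_ / r]mulrC.
Qed.

(** Meant for derivatives in the direction [c] of functions that vanish on the two faces orthogonal
    to it. The induction peels off coordinates until [c] is the first one, which is then integrated
    first. *)
Lemma Rintegral_pbox0 (n : nat) (A : 'I_n -> set MR) (c : 'I_n) (G : n.-tuple MR -> R) :
  (forall i, measurable (A i)) -> (forall i, (lebesgue_measure (A i) < +oo)%E) ->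
  bmeas (pbox A) G ->
  (forall t, pbox A t -> \int[lebesgue_measure]_(s in A c) G (upd t c s) = 0) ->
  \int[lam n]_(t in pbox A) G t = 0.
Proof.
elim: n A c G => [|n IH] A c G mA Aoo bG G0; first by case: c {G0}.
case: (unliftP ord0 c) G0 => [c' ->|->] G0.
  rewrite Rintegral_pbox//.
  apply: etrans (eq_Rintegral (g := cst 0) _ _) _; last by rewrite Rintegral_cst ?mul0r.
  move=> x /set_mem Ax; apply: (IH (fun i => A (lift ord0 i)) c') => //.
    exact: bmeas_slice1.
  move=> t At; rewrite -[RHS](G0 (tuple_cons (x, t))); last exact/pbox_cons.
  by apply: eq_Rintegral => s _; rewrite upd_consS.
rewrite Rintegral_pbox_swap//.
apply: etrans (eq_Rintegral (g := cst 0) _ _) _; last first.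
  by rewrite Rintegral_cst ?mul0r//; exact: measurable_pbox.
move=> t /set_mem At.
(* The hypothesis [G0] speaks of full tuples, so the first coordinate has to be given some value;
   which one is immaterial, as [upd] replaces it. *)
have [[x Ax]|A0] := pselect (exists x, A ord0 x); last first.
  rewrite [X in \int[_]_(_ in X) _](_ : _ = set0) ?Rintegral_set0//.
  by apply/seteqP; split => // x Ax; apply: A0; exists x.
rewrite -[RHS](G0 (tuple_cons (x, t))); last exact/pbox_cons.
by apply: eq_Rintegral => s _; rewrite upd_cons0.
Qed.

(* [g c] stands for the derivative in the direction [c], which is only needed
   through the one-dimensional bound along lines; the induction integrates out
   one variable at a time. *)
Lemma poincare_nash (n : nat) (A : 'I_n -> set MR) (r : R) (f : n.-tuple MR -> R)
    (g : 'I_n -> n.-tuple MR -> R) : 0 < r ->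
  (forall i, measurable (A i)) -> (forall i, lebesgue_measure (A i) = r%:E) ->
  bmeas (pbox A) f -> (forall c, bmeas (pbox A) (g c)) ->
  (forall t c, pbox A t -> `|f t| <=
     r^-1 * \int[lebesgue_measure]_(s in A c) `|f (upd t c s)| +
     \int[lebesgue_measure]_(s in A c) `|g c (upd t c s)|) ->
  \int[lam n]_(t in pbox A) (f t ^+ 2) <=
  2 ^+ n * (r ^- n * (\int[lam n]_(t in pbox A) `|f t|) ^+ 2 +
    r ^+ 2 * \sum_c \int[lam n]_(t in pbox A) (g c t ^+ 2)).
Proof.
move=> r0; elim: n A f g => [|n IH] A f g mA Ar bf bg line.
  have Dt (h : 0.-tuple MR -> R) : bmeas (pbox A) h ->
      \int[lam 0]_(t in pbox A) h t = h [tuple].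
    have -> : pbox A = setT by apply/seteqP; split => // t _ [].
    move=> [/measurable_EFinP mh _]; rewrite /Rintegral /= integral_dirac//=.
    by rewrite indicE mem_set// mul1r.
  rewrite !Dt; [|exact: bmeas_norm|exact: bmeasX].
  by rewrite expr0 invr1 !mul1r big_ord0 mulr0 addr0 -normrX ger0_norm ?sqr_ge0.
have Aoo i : (lebesgue_measure (A i) < +oo)%E by rewrite Ar ltry.
pose A' (i : 'I_n) := A (lift ord0 i).
pose L := \int[lam n.+1]_(t in pbox A) `|f t|.
pose D := \int[lam n.+1]_(t in pbox A) `|g ord0 t|.
have mA' i : measurable (A' i) by exact: mA.
have mpA' := measurable_pbox mA'.
have A'oo : (lam n (pbox A') < +oo)%E by apply: pbox_fin => i //; exact: Aoo.
have bfn := bmeas_norm bf; have bgn := bmeas_norm (bg ord0).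
(* The bound [line] in the first direction, integrated over the other variables, controls the L1
   norm of every slice by [r^-1 * L + D]; this enters the induction hypothesis, which is applied to
   slices. *)
have v_le x : A ord0 x ->
    \int[lam n]_(t in pbox A') `|f (tuple_cons (x, t))| <= r^-1 * L + D.
  move=> Ax; rewrite /L /D (Rintegral_pbox_swap mA Aoo bfn) (Rintegral_pbox_swap mA Aoo bgn).
  have b1 := bmeas_inner2 mA Aoo bfn; have b2 := bmeas_inner2 mA Aoo bgn.
  rewrite -RintegralZl//; last exact: bmeas_integrable.
  rewrite -RintegralD//; last 2 first.
  - by apply: bmeas_integrable => //; auto 20 with bm.
  - exact: bmeas_integrable.
  apply: le_Rintegral => //.
  - by apply: bmeas_integrable => //; exact: (bmeas_slice1 mA bfn).
  - by apply: bmeas_integrable => //; auto 20 with bm.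
  - move=> t At; have := line (tuple_cons (x, t)) ord0.
    under eq_Rintegral do rewrite upd_cons0.
    under [X in _ + X]eq_Rintegral do rewrite upd_cons0.
    by apply; exact/pbox_cons.
have L0 : 0 <= L by exact: Rintegral_ge0.
have D0 : 0 <= D by exact: Rintegral_ge0.
have D2 : D ^+ 2 <= r ^+ n.+1 * \int[lam n.+1]_(t in pbox A) (g ord0 t ^+ 2).
  have mp := measurable_pbox mA; have poo := pbox_fin mA Aoo.
  have := Rintegral_CS_bmeas mp poo (bmeas_cst _ 1) bgn.
  under eq_Rintegral do rewrite mul1r.
  under [X in _ <= X * _ -> _]eq_Rintegral do rewrite expr1n.
  under [X in _ <= _ * X -> _]eq_Rintegral do rewrite -normrX ger0_norm ?sqr_ge0//.
  rewrite Rintegral_cst// mul1r (_ : fine _ = r ^+ n.+1)//.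
  rewrite [X in fine X](measure_power_box _ mA) (eq_bigr (fun=> r%:E)) => [|i _]; last exact: Ar.
  by rewrite -(big_morph EFin (@EFinM R) erefl)/= prodr_const card_ord.
pose h x := \int[lam n]_(t in pbox A') (f (tuple_cons (x, t)) ^+ 2).
pose e c x := \int[lam n]_(t in pbox A') (g (lift ord0 c) (tuple_cons (x, t)) ^+ 2).
have h_le x : A ord0 x -> h x <= 2 ^+ n * (r ^- n * (r^-1 * L + D) ^+ 2 +
    r ^+ 2 * \sum_c e c x).
  move=> Ax; apply: le_trans (IH A' (fun t => f (tuple_cons (x, t)))
     (fun c t => g (lift ord0 c) (tuple_cons (x, t))) mA' _ _ _ _) _.
  - by move=> i; exact: Ar.
  - exact: bmeas_slice1.
  - by move=> c; exact: (bmeas_slice1 mA (bg _)).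
  - move=> t c At; have := line (tuple_cons (x, t)) (lift ord0 c).
    under eq_Rintegral do rewrite upd_consS.
    under [X in _ + X]eq_Rintegral do rewrite upd_consS.
    by apply; exact/pbox_cons.
  have v0 : 0 <= \int[lam n]_(t in pbox A') `|f (tuple_cons (x, t))| by exact: Rintegral_ge0.
  have b0 : 0 <= r^-1 * L + D := le_trans v0 (v_le x Ax).
  rewrite ler_wpM2l ?exprn_ge0// lerD2r ler_wpM2l ?invr_ge0 ?exprn_ge0//; first exact: ltW.
  by apply: lerXn2r; rewrite ?nnegrE ?v_le.
have bf2 := bmeasX 2 bf; have bg2 c := bmeasX 2 (bg c).
have ib (k : MR -> R) : bmeas (A ord0) k -> lebesgue_measure.-integrable (A ord0) (EFin \o k).
  by move=> bk; apply: bmeas_integrable; [exact: mA|exact: Aoo|].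
have bh : bmeas (A ord0) h := bmeas_inner1 mA Aoo bf2.
have be c : bmeas (A ord0) (e c) := bmeas_inner1 mA Aoo (bg2 (lift ord0 c)).
rewrite (Rintegral_pbox mA Aoo bf2) -/h.
have : \int[lebesgue_measure]_(x in A ord0) h x <= \int[lebesgue_measure]_(x in A ord0)
   (2 ^+ n * (r ^- n * (r^-1 * L + D) ^+ 2 + r ^+ 2 * \sum_c e c x)).
  apply: le_Rintegral; [exact: mA| | |exact: h_le].
    exact: ib.
  by apply: ib; auto 20 with bm.
move=> /le_trans; apply.
rewrite RintegralZl//; last by apply: ib; auto 20 with bm.
rewrite RintegralD//; last 2 first.
- by apply: ib; auto 20 with bm.
- by apply: ib; auto 20 with bm.
have muA : fine (lebesgue_measure (A ord0)) = r by rewrite Ar.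
rewrite Rintegral_cst// [fine _]muA RintegralZl//; last by apply: ib; auto 20 with bm.
have -> : \int[lebesgue_measure]_(x in A ord0) (\sum_c e c x) =
    \sum_c \int[lam n.+1]_(t in pbox A) (g (lift ord0 c) t ^+ 2).
  rewrite Rintegral_sum//; last by move=> c; exact: ib.
  by apply: eq_bigr => c _; rewrite (Rintegral_pbox mA Aoo (bg2 _)).
rewrite [\sum_(c < n.+1) _]big_ord_recl.
set S := \sum_(i < n) _; set E := \int[_]_(_ in _) (g _ _ ^+ 2) in D2 *.
rewrite [2 ^+ n.+1]exprSr -mulrA ler_wpM2l ?exprn_ge0//=.
have S0 : 0 <= S by apply: sumr_ge0 => c _; apply: Rintegral_ge0 => t _; exact: sqr_ge0.
have -> : r ^- n * (r^-1 * L + D) ^+ 2 * r = r ^- n.+1 * (L + r * D) ^+ 2.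
  by rewrite [r ^+ n.+1]exprS invfM; move: (r ^- n) => q; field; rewrite gt_eqF.
(* This doubling, once per coordinate, is the origin of the factor [2 ^+ n]. *)
have h1 : (L + r * D) ^+ 2 <= 2 * (L ^+ 2 + r ^+ 2 * D ^+ 2).
  by have := sqr_ge0 (L - r * D); nra.
have h2 : r ^- n.+1 * (L + r * D) ^+ 2 <=
    r ^- n.+1 * (2 * (L ^+ 2 + r ^+ 2 * (r ^+ n.+1 * E))).
  have r0' := ltW r0.
  rewrite ler_wpM2l ?invr_ge0 ?exprn_ge0// (le_trans h1)// ler_wpM2l// lerD2l.
  by rewrite ler_wpM2l// exprn_ge0.
have h3 : r ^- n.+1 * (2 * (L ^+ 2 + r ^+ 2 * (r ^+ n.+1 * E))) =
    2 * (r ^- n.+1 * L ^+ 2 + r ^+ 2 * E).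
  have : r ^+ n.+1 != 0 by rewrite gt_eqF// exprn_gt0.
  by move: (r ^+ n.+1) => q q0; field.
rewrite -/L in h2 h3 *.
apply: le_trans (lerD h2 (lexx _)) _; rewrite h3.
have : 0 <= r ^+ 2 * S by rewrite mulr_ge0// sqr_ge0.
lra.
Qed.

End tuples_and_vectors.

(** * Divergence form operators in coordinates *)

Section C2_functions.
Context {R : realType} {d : nat}.
Implicit Types (O : set 'rV[R]_d) (f g : 'rV[R]_d -> R).

Local Notation e_ i := (delta_mx ord0 i : 'rV[R]_d).

Lemma is_derive_line f (x v : 'rV[R]_d) (df : R) :
  is_derive (0 : R) 1 (fun s : R => f (s *: v + x)) df -> is_derive x v f df.
Proof.
have E : (fun h : R => h^-1 *: (((fun s => f (s *: v + x)) \o shift 0) (h *: 1) -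
    f (0 *: v + x))) = (fun h => h^-1 *: ((f \o shift x) (h *: v) - f x)).
  by apply/funext => h /=; rewrite addr0 scale0r add0r [h *: 1]mulr1.
by move=> [dfu dfE]; split; move: dfu dfE; rewrite ?/derivable ?/derive E.
Qed.

Record C2 O f : Prop := IsC2 {
  C2_C1 : C1 O f;
  C2_D : forall b, C1 O ('D_(e_ b) f) }.

Lemma C2_Cn2 O f : Cn_on 2 O f -> C2 O f.
Proof.
move=> [cf df]; split; last by move=> b; apply: C1_Cn1; exact: (df b).2.
by apply: C1_Cn1; split=> // i; have [? [? _]] := df i.
Qed.

Lemma C2_cst O c : open O -> C2 O (cst c).
Proof.
move=> oO; split; first exact: C1_cst.
move=> b; apply: (@eq_C1 _ _ O (cst 0)) => //; last exact: C1_cst.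
by move=> u _; rewrite derive_cst.
Qed.

Lemma C2D O f g : open O -> C2 O f -> C2 O g -> C2 O (fun u => f u + g u).
Proof.
move=> oO [cf cDf] [cg cDg]; split; first exact: C1D.
move=> b; apply: (@eq_C1 _ _ O (fun u => 'D_(e_ b) f u + 'D_(e_ b) g u)) => //; last exact: C1D.
move=> u Ou; have [_ ->//] : is_derive u (e_ b) (fun u => f u + g u) ('D_(e_ b) f u + 'D_(e_ b) g u).
by apply: is_deriveD; [exact: C1_derive cf b _ Ou|exact: C1_derive cg b _ Ou].
Qed.

Lemma C2M O f g : open O -> C2 O f -> C2 O g -> C2 O (fun u => f u * g u).
Proof.
move=> oO [cf cDf] [cg cDg]; split; first exact: C1M.
move=> b; apply: (@eq_C1 _ _ O (fun u => f u * 'D_(e_ b) g u + g u * 'D_(e_ b) f u)) => //.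
  move=> u Ou; have [_ ->//] : is_derive u (e_ b) (fun u => f u * g u)
     (f u * 'D_(e_ b) g u + g u * 'D_(e_ b) f u).
  by apply: is_deriveM; [exact: C1_derive cf b _ Ou|exact: C1_derive cg b _ Ou].
by apply: C1D => //; exact: C1M.
Qed.

Lemma C2_prod O (I : Type) (s : seq I) (P : pred I) (f : I -> 'rV[R]_d -> R) :
  open O -> (forall i, C2 O (f i)) -> C2 O (fun u => \prod_(i <- s | P i) f i u).
Proof.
move=> oO cf; elim: s => [|i s IH].
  by under eq_fun do rewrite big_nil; exact: C2_cst.
by under eq_fun do rewrite big_cons; case: (P i) => //; exact: C2M.
Qed.

Lemma C2_coord O c : open O -> C2 O (fun u => u ord0 c).
Proof.
move=> oO.
have dc i u : is_derive u (e_ i) (fun u : 'rV[R]_d => u ord0 c) (i == c)%:R.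
  apply: is_derive_line.
  have -> : (fun s : R => (s *: e_ i + u) ord0 c) =
      (i == c)%:R *: (id : R -> R) + cst (u ord0 c).
    by apply/funext => s; rewrite !mxE eqxx eq_sym mulrC.
  have := is_deriveD (is_deriveZ (i == c)%:R (is_derive_id (0 : R) (1 : R)))
    (is_derive_cst (u ord0 c) (0 : R) (1 : R)).
  by rewrite addr0 [_ *: 1]mulr1.
split.
  apply: (@C1P _ _ _ _ (fun i => cst (i == c)%:R)) => // [u Ou|i u Ou].
    exact: coord_continuous.
  exact: cst_continuous.
move=> b; apply: (@eq_C1 _ _ O (cst (b == c)%:R)) => //; last exact: C1_cst.
by move=> u _; have [_ ->] := dc b u.
Qed.

End C2_functions.

Section local_identity.
Context {R : realType} {d : nat}.
Local Notation MR := (measurableTypeR R).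
Local Notation lam := (@lebesgue_measure_tuple R d).
Local Notation e_ i := (delta_mx ord0 i : 'rV[R]_d).
Local Notation rv := (@rV_of_tuple R d).

Variables (O : set 'rV[R]_d) (oO : open O).
Variables (w : 'rV[R]_d -> R) (Gi : 'I_d -> 'I_d -> 'rV[R]_d -> R).
Hypotheses (C1w : C1 O w) (C1Gi : forall a b, C1 O (Gi a b)).
Hypothesis Gi_sym : forall a b u, O u -> Gi a b u = Gi b a u.

(** With [w] the volume density and [Gi] the inverse metric, [flux f] is [w grad f], [divflux f] is
    [- w] times the positive Laplacian of [f], and [dirichlet f] is [w |grad f|^2]. *)
Definition flux (f : 'rV[R]_d -> R) a (x : 'rV[R]_d) :=
  w x * \sum_b Gi a b x * 'D_(e_ b) f x.
Definition divflux (f : 'rV[R]_d -> R) (x : 'rV[R]_d) := \sum_a 'D_(e_ a) (flux f a) x.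
Definition dirichlet (f : 'rV[R]_d -> R) (x : 'rV[R]_d) := \sum_a 'D_(e_ a) f x * flux f a x.

Lemma C1_flux f a : C2 O f -> C1 O (flux f a).
Proof.
move=> [_ cDf]; apply: C1M => //; apply: C1_sum => // b.
by apply: C1M => //; exact: C1Gi.
Qed.

Lemma cont_sum (I : Type) (s : seq I) (f : I -> 'rV[R]_d -> R) u :
  (forall i, {for u, continuous (f i)}) ->
  {for u, continuous (fun x => \sum_(i <- s) f i x)}.
Proof.
move=> cf; elim: s => [|i s IH].
  rewrite (_ : (fun x => \sum_(i <- [::]) f i x) = cst 0); first exact: cst_continuous.
  by apply/funext => x; rewrite big_nil.
rewrite (_ : (fun x => \sum_(i <- i :: s) f i x) = fun x => f i x + \sum_(i <- s) f i x).
  by apply: continuousD => //; exact: cf.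
by apply/funext => x; rewrite big_cons.
Qed.

Lemma cont_divflux f u : C2 O f -> O u -> {for u, continuous (divflux f)}.
Proof.
move=> cf Ou; apply: cont_sum => a; exact: C1_dcont (C1_flux a cf) a _ Ou.
Qed.

Lemma cont_dirichlet f u : C2 O f -> O u -> {for u, continuous (dirichlet f)}.
Proof.
move=> cf Ou; apply: cont_sum => a; apply: continuousM.
  exact: C1_dcont (C2_C1 cf) a _ Ou.
exact: C1_cont (C1_flux a cf) _ Ou.
Qed.

Lemma flux_sym (f h : 'rV[R]_d -> R) x : O x ->
  \sum_a 'D_(e_ a) h x * flux f a x = \sum_a 'D_(e_ a) f x * flux h a x.
Proof.
move=> Ox; rewrite /flux.
under eq_bigr do rewrite mulrCA mulr_sumr.
under [RHS]eq_bigr do rewrite mulrCA mulr_sumr.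
rewrite -!mulr_sumr; congr (_ * _); rewrite exchange_big; apply: eq_bigr => a _.
by apply: eq_bigr => b _; rewrite (Gi_sym b a Ox); ring.
Qed.

Variables (lo hi : 'I_d -> R).
Hypothesis lohi : forall a, lo a <= hi a.
Hypothesis boxO : forall t, cbox lo hi t -> O (rv t).

Let mbox : measurable (cbox lo hi).
Proof. by apply: measurable_pbox => i; exact: measurable_itv. Qed.

Let boxoo : (lam (cbox lo hi) < +oo)%E.
Proof. by apply: pbox_fin => i; [exact: measurable_itv|exact: itv_lt_pinfty]. Qed.

Lemma box_integrable (f : 'rV[R]_d -> R) :
  (forall u, O u -> {for u, continuous f}) ->
  lam.-integrable (cbox lo hi) (EFin \o (fun t => f (rv t))).
Proof.
by move=> cf; apply: bmeas_integrable => //; exact: bmeas_rV oO cf boxO.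
Qed.

Lemma box_ibp (F : 'rV[R]_d -> R) a : C1 O F ->
  (forall t, cbox lo hi t -> tnth t a = lo a \/ tnth t a = hi a -> F (rv t) = 0) ->
  \int[lam]_(t in cbox lo hi) 'D_(e_ a) F (rv t) = 0.
Proof.
move=> cF F0; apply: (@Rintegral_pbox0 _ _ _ a).
- by move=> i; exact: measurable_itv.
- by move=> i; exact: itv_lt_pinfty.
- by apply: (bmeas_rV (f := 'D_(e_ a) F) oO _ boxO) => u Ou; exact: C1_dcont cF a _ Ou.
move=> t Kt.
have Ku s : lo a <= s <= hi a -> cbox lo hi (upd t a s).
  move=> ls i; rewrite tnth_upd; case: eqP => [->|_]; last exact: Kt.
  by rewrite /= in_itv.
apply: etrans (@FTC_line _ (fun s => F (rv (upd t a s))) _ _ _ (lohi a) _ _) _.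
- by move=> s /Ku /boxO Os; apply: is_derive_upd; exact: C1_derive cF a _ Os.
- move=> s /Ku /boxO Os.
  by apply: (@continuous_upd _ _ t a s ('D_(e_ a) F)); exact: C1_dcont cF a _ Os.
rewrite !F0 ?subrr//.
- by apply: Ku; rewrite lexx lohi.
- by rewrite tnth_upd eqxx; left.
- by apply: Ku; rewrite lexx lohi.
- by rewrite tnth_upd eqxx; right.
Qed.

Variables (theta : 'rV[R]_d -> R).
Hypothesis C2theta : C2 O theta.
Hypothesis theta0 : forall t a, cbox lo hi t -> tnth t a = lo a \/ tnth t a = hi a ->
  theta (rv t) = 0.
(** Squaring makes the gradient of the cutoff vanish on the boundary of the box too, where [psi (f)]
    need not vanish. *)
Let eta u := theta u * theta u.

Lemma C2eta : C2 O eta. Proof. exact: C2M. Qed.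

(* The vector field eta psi'(f) grad f - psi(f) grad eta vanishes on the
   boundary of the box, and its divergence has no term in <grad f, grad eta>. *)
Lemma local_identity (f : 'rV[R]_d -> R) (psi psi1 psi2 : R -> R) : C2 O f ->
  (forall s : R, is_derive s 1 psi (psi1 s)) ->
  (forall s : R, is_derive s 1 psi1 (psi2 s)) -> continuous psi2 ->
  \int[lam]_(t in cbox lo hi) (eta (rv t) * psi1 (f (rv t)) * divflux f (rv t)) =
  \int[lam]_(t in cbox lo hi) (psi (f (rv t)) * divflux eta (rv t)) -
  \int[lam]_(t in cbox lo hi) (eta (rv t) * psi2 (f (rv t)) * dirichlet f (rv t)).
Proof.
move=> cf dpsi dpsi1 cpsi2.
have cpsi1 : continuous psi1.
  by move=> s; apply/differentiable_continuous/derivable1_diffP; case: (dpsi1 s).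
have cpsi : continuous psi.
  by move=> s; apply/differentiable_continuous/derivable1_diffP; case: (dpsi s).
have cf1 := C2_C1 cf; have ceta := C2eta; have ceta1 := C2_C1 ceta.
have c1psi : C1 O (psi \o f) by apply: (C1_comp (dp := psi1)) => // u _; exact: cpsi1.
have c1psi1 : C1 O (psi1 \o f) by apply: (C1_comp (dp := psi2)) => // u _; exact: cpsi2.
pose F a u := eta u * (psi1 \o f) u * flux f a u - (psi \o f) u * flux eta a u.
have cF a : C1 O (F a).
  have cN : C1 O (fun u => (psi \o f) u * flux eta a u * -1).
    apply: (C1M oO); last exact: C1_cst.
    by apply: (C1M oO) => //; exact: C1_flux.
  have cP : C1 O (fun u => eta u * (psi1 \o f) u * flux f a u).
    by apply: C1M => //; [exact: C1M|exact: C1_flux].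
  by apply: eq_C1 (C1D oO cP cN) => // u _; rewrite mulrN1.
have F0 a t : cbox lo hi t -> tnth t a = lo a \/ tnth t a = hi a -> F a (rv t) = 0.
  move=> Kt ta; have th0 := theta0 Kt ta; have Ot := boxO Kt.
  have De b : 'D_(e_ b) eta (rv t) = 0.
    have [_ ->] : is_derive (rv t) (e_ b) eta
       (theta (rv t) * 'D_(e_ b) theta (rv t) + theta (rv t) * 'D_(e_ b) theta (rv t)).
      by apply: is_deriveM; exact: C1_derive (C2_C1 C2theta) b _ Ot.
    by rewrite th0 !mul0r addr0.
  rewrite /F /eta th0 !mul0r /flux -/eta big1 ?mulr0 ?subr0// => b _.
  by rewrite De mulr0.
have dF a u : O u -> 'D_(e_ a) (F a) u = eta u * psi1 (f u) * 'D_(e_ a) (flux f a) u +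
   flux f a u * (eta u * (psi2 (f u) * 'D_(e_ a) f u) + psi1 (f u) * 'D_(e_ a) eta u) -
   (psi (f u) * 'D_(e_ a) (flux eta a) u + flux eta a u * (psi1 (f u) * 'D_(e_ a) f u)).
  move=> Ou.
  have df := C1_derive cf1 a Ou; have deta := C1_derive ceta1 a Ou.
  have dff := C1_derive (C1_flux a cf) a Ou.
  have dfe := C1_derive (C1_flux a ceta) a Ou.
  have d1 := is_derive_comp df (dpsi (f u)).
  have d2 := is_derive_comp df (dpsi1 (f u)).
  by have [_ ->] := is_deriveB (is_deriveM (is_deriveM deta d2) dff) (is_deriveM d1 dfe).
have sum0 : \sum_a \int[lam]_(t in cbox lo hi) 'D_(e_ a) (F a) (rv t) = 0.
  by rewrite big1// => a _; apply: box_ibp => //; exact: F0.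
have i1 : lam.-integrable (cbox lo hi) (EFin \o
    (fun t => eta (rv t) * psi1 (f (rv t)) * divflux f (rv t))).
  apply: (@box_integrable (fun u => eta u * psi1 (f u) * divflux f u)) => u Ou.
  apply: continuousM; last exact: cont_divflux.
  apply: continuousM; first exact: C1_cont ceta1 _ Ou.
  exact: C1_cont c1psi1 _ Ou.
have i2 : lam.-integrable (cbox lo hi) (EFin \o
    (fun t => psi (f (rv t)) * divflux eta (rv t))).
  apply: (@box_integrable (fun u => psi (f u) * divflux eta u)) => u Ou.
  apply: continuousM; last exact: cont_divflux.
  exact: C1_cont c1psi _ Ou.
have i3 : lam.-integrable (cbox lo hi) (EFin \o
    (fun t => eta (rv t) * psi2 (f (rv t)) * dirichlet f (rv t))).
  apply: (@box_integrable (fun u => eta u * psi2 (f u) * dirichlet f u)) => u Ou.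
  apply: continuousM; last exact: cont_dirichlet.
  apply: continuousM; first exact: C1_cont ceta1 _ Ou.
  apply: continuous_comp; first exact: C1_cont cf1 _ Ou.
  exact: cpsi2.
have i4 : lam.-integrable (cbox lo hi) (EFin \o (fun t => psi (f (rv t)) * divflux eta (rv t) -
    eta (rv t) * psi2 (f (rv t)) * dirichlet f (rv t))) := integrableB mbox i2 i3.
rewrite -(RintegralB mbox i2 i3); apply/eqP; rewrite -subr_eq0.
rewrite -(RintegralB mbox i1 i4).
rewrite -sum0 -Rintegral_sum//; last first.
  move=> a; apply: (@box_integrable ('D_(e_ a) (F a))) => u Ou; exact: C1_dcont (cF a) a _ Ou.
apply/eqP; apply: eq_Rintegral => t /set_mem Kt; have Ot := boxO Kt.
rewrite (eq_bigr _ (fun a _ => dF a _ Ot)).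
(* The two mixed terms in [f] and [eta] cancel only after summation over [a], by the symmetry of
   [Gi]. *)
have := flux_sym f eta Ot.
rewrite /divflux /dirichlet !mulr_sumr => E.
rewrite opprB -[RHS]addr0.
rewrite [X in _ = _ + X](_ : _ = \sum_a psi1 (f (rv t)) *
    ('D_(e_ a) f (rv t) * flux eta a (rv t) - 'D_(e_ a) eta (rv t) * flux f a (rv t))); last first.
  by rewrite -mulr_sumr sumrB E subrr mulr0.
pose A a := eta (rv t) * psi1 (f (rv t)) * 'D_(e_ a) (flux f a) (rv t).
pose B a := eta (rv t) * psi2 (f (rv t)) * ('D_(e_ a) f (rv t) * flux f a (rv t)).
pose C a := psi (f (rv t)) * 'D_(e_ a) (flux eta a) (rv t).
transitivity (\sum_a (A a + (B a - C a))); first by rewrite big_split/= sumrB.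
have alg (e p1 p2 p Df De Dff Dfe Ff Fe : R) : e * p1 * Dff + (e * p2 * (Df * Ff) - p * Dfe) =
    (e * p1 * Dff + Ff * (e * (p2 * Df) + p1 * De) - (p * Dfe + Fe * (p1 * Df))) +
    p1 * (Df * Fe - De * Ff) by ring.
by rewrite -big_split/=; apply: eq_bigr => a _; exact: alg.
Qed.

End local_identity.

(** * Change of variables for a measure with a density *)

Section density_pushforward.
Context {d1 d2} {X : measurableType d1} {Y : measurableType d2} {R : realType}.
Variables (mu : {measure set X -> \bar R}) (nu : {measure set Y -> \bar R}).
Variables (K : set X) (V : set Y) (h : X -> Y) (w : X -> R).
Hypotheses (mK : measurable K) (mV : measurable V).
Hypotheses (mh : measurable_fun K h) (mw : measurable_fun K w).
Hypotheses (hKV : forall x, K x -> V (h x)) (w0 : forall x, K x -> 0 <= w x).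
Hypothesis nuE : forall B, measurable B -> B `<=` V ->
  nu B = (\int[mu]_(x in K `&` h @^-1` B) (w x)%:E)%E.

Import HBNNSimple.

(** [nuE] is the formula for indicator functions; it extends to simple functions by linearity and to
    nonnegative functions by monotone convergence. *)
Lemma ge0_integral_density_pushforward (f : Y -> \bar R) :
  measurable_fun V f -> (forall y, V y -> 0 <= f y)%E ->
  (\int[nu]_(y in V) f y = \int[mu]_(x in K) (f (h x) * (w x)%:E))%E.
Proof.
move=> mf f0; pose f_ := nnsfun_approx mV mf.
have f_cvg y : V y -> ((f_ n y)%:E @[n --> \oo] --> f y)%E.
  by move=> Vy; apply: cvg_nnsfun_approx => // *; exact: f0.
have mhB B : measurable B -> measurable (K `&` h @^-1` B) by exact: mh.
have mfh n : measurable_fun K (fun x => (f_ n (h x))).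
  apply: (measurable_comp measurableT) => //.
have step n : (\int[nu]_(y in V) (f_ n y)%:E = \int[mu]_(x in K) ((f_ n (h x))%:E * (w x)%:E))%E.
  transitivity (\sum_(k \in range (f_ n)) (k%:E * nu (f_ n @^-1` [set k] `&` V)))%E.
    under eq_integral do rewrite fimfunE -fsumEFin//.
    rewrite ge0_integral_fsum//; last 2 first.
    - by move=> y; exact/measurable_EFinP/measurable_funM.
    - by move=> y x _; rewrite nnfun_muleindic_ge0.
    by apply: eq_fsbigr => k _; rewrite integralZl_indic_nnsfun// integral_indic.
  transitivity (\int[mu]_(x in K) (\sum_(k \in range (f_ n))
      ((k * \1_(f_ n @^-1` [set k]) (h x)) * w x)%:E))%E; last first.
    apply: eq_integral => x _; rewrite -EFinM [in RHS]fimfunE fsumEFin//; congr EFin.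
    by rewrite !fsbig_finite//= mulr_suml.
  have mind k : measurable_fun K (fun x => \1_(f_ n @^-1` [set k]) (h x) : R).
    by apply: (measurable_comp measurableT) => //; exact: measurable_indic.
  have range_ge0 k : range (f_ n) k -> 0 <= k by move=> [y _ <-].
  rewrite fsbig_finite//.
  (* The exchange of sum and integral wants summands that are nonnegative for every [k], not only
     for the values of [f_ n], hence the absolute value. *)
  rewrite [RHS](_ : _ = \int[mu]_(x in K) (\sum_(k <- finmap.enum_fset (fset_set (range (f_ n))))
      (`|k| * \1_(f_ n @^-1` [set k]) (h x) * w x)%:E))%E; last first.
    apply: eq_integral => x _; rewrite fsbig_finite//; apply: eq_big_seq => k.
    by rewrite in_fset_set// inE => /range_ge0 k0; rewrite ger0_norm.
  rewrite ge0_integral_sum//; last 2 first.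
  - by move=> k; apply/measurable_EFinP; apply: measurable_funM => //; exact: measurable_funM.
  - by move=> k x Kx; rewrite lee_fin !mulr_ge0// w0.
  apply: eq_big_seq => k; rewrite in_fset_set// inE => /range_ge0 k0.
  rewrite ger0_norm//.
  under eq_integral do rewrite -mulrA EFinM.
  rewrite ge0_integralZl_EFin//; last 2 first.
  - by move=> x Kx; rewrite lee_fin mulr_ge0// w0.
  - by apply/measurable_EFinP; exact: measurable_funM.
  congr (_ * _)%E; rewrite nuE; last 2 first.
  - by apply: measurableI => //; exact: measurable_funPTI.
  - by move=> y [].
  rewrite [LHS]integral_mkcond [RHS]integral_mkcond; apply: eq_integral => x _.
  rewrite !patchE; have [Kx|Kx] := boolP (x \in K); last first.
    by rewrite memNset// => -[Kx' _]; rewrite mem_set in Kx.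
  rewrite indicE; have [fk|fk] := boolP (h x \in _).
    rewrite mul1r mem_set//; split; first exact: set_mem.
    by split; [exact: set_mem|exact/hKV/set_mem].
  rewrite mul0r memNset// => -[_ [fk' _]]; move/negP: fk; apply; exact/mem_set.
transitivity (limn (fun n => \int[nu]_(y in V) (f_ n y)%:E))%E.
  rewrite -monotone_convergence//.
  - by apply: eq_integral => y /set_mem Vy; apply/esym/cvg_lim => //; exact: f_cvg.
  - by move=> n; exact/measurable_EFinP/measurable_funTS.
  - by move=> n y _; rewrite lee_fin.
  - by move=> y _ m n mn; rewrite lee_fin; exact/lefP/nd_nnsfun_approx.
under eq_fun do rewrite step.
rewrite -monotone_convergence//.
- apply: eq_integral => x /set_mem Kx; apply/cvg_lim => //.
  under eq_fun do rewrite muleC.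
  rewrite muleC; apply: cvgeZl => //; exact/f_cvg/hKV.
- by move=> n; apply: emeasurable_funM; exact/measurable_EFinP.
- by move=> n x Kx; rewrite mule_ge0// lee_fin// w0.
- move=> x Kx m n mn; rewrite lee_wpmul2r// ?lee_fin ?w0//.
  exact/lefP/nd_nnsfun_approx.
Qed.

Lemma Rintegral_density_pushforward (f : Y -> R) : (mu K < +oo)%E -> (nu V < +oo)%E ->
  bmeas K w -> bmeas V f ->
  \int[nu]_(y in V) f y = \int[mu]_(x in K) (f (h x) * w x).
Proof.
move=> Koo Voo bw bf.
have bfh : bmeas K (fun x => f (h x)) by exact: bmeas_comp mV mh hKV bf.
have [_ [B fB]] := bf.
have E (g : Y -> R) : bmeas V g -> (forall y, V y -> 0 <= g y) ->
    \int[nu]_(y in V) g y = \int[mu]_(x in K) (g (h x) * w x).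
  move=> [mg _] g0; rewrite /Rintegral (@ge0_integral_density_pushforward (EFin \o g))//.
  exact/measurable_EFinP.
have iw (g : X -> R) : bmeas K g -> mu.-integrable K (EFin \o (fun x => g x * w x)).
  by move=> bg; apply: bmeas_integrable => //; exact: bmeasM.
have inu (g : Y -> R) : bmeas V g -> nu.-integrable V (EFin \o g).
  by move=> bg; exact: bmeas_integrable.
have [[y Vy]|V0] := pselect (exists y, V y); last first.
  have -> : V = set0 by apply/seteqP; split => // y Vy; apply: V0; exists y.
  have -> : K = set0 by apply/seteqP; split => // x /hKV Vx; apply: V0; exists (h x).
  by rewrite !Rintegral_set0.
have B0 : 0 <= B by rewrite (le_trans _ (fB y Vy)).
have EB := E _ (bmeas_cst V B) (fun _ _ => B0).
(* [f + B] is nonnegative, and the contribution of [B] is subtracted at the end. *)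
have := E (fun y => f y + B) (bmeasD bf (bmeas_cst _ _)).
rewrite (RintegralD mV (inu _ bf) (inu _ (bmeas_cst _ _))) EB.
have -> : \int[mu]_(x in K) ((f (h x) + B) * w x) =
    \int[mu]_(x in K) (f (h x) * w x) + \int[mu]_(x in K) (B * w x).
  rewrite -(RintegralD mK (iw _ bfh) (iw _ (bmeas_cst _ _))).
  by apply: eq_Rintegral => x _; exact: mulrDl.
move=> Ef.
apply: (addIr (\int[mu]_(x in K) (B * w x))); apply: Ef => z Vz.
by have := fB z Vz; rewrite ler_norml; lra.
Qed.

End density_pushforward.

(** * Integration in charts *)

Lemma continuous_measurable_borel (R : realType) (M : ptopologicalType) (U : set M)
    (f : borel M -> R) : open U -> (forall p, U p -> {for p, continuous (f : M -> R)}) ->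
  measurable_fun (U : set (borel M)) f.
Proof.
move=> oU cf; apply: (measurability _ (RGenOInfty.measurableE R)) => // _ [_ [a ->] <-].
apply: sub_sigma_algebra; rewrite openE => p [Up /=]; rewrite in_itv/= andbT => fp.
apply: filterI; first exact: open_nbhs_nbhs.
have := open_nbhs_nbhs (conj (@open_gt R a) fp) => /(cf p Up).
by apply: filterS => y /=; rewrite in_itv/= andbT.
Qed.

Section box_nash.
Context {R : realType} {d : nat}.
Local Notation MR := (measurableTypeR R).
Local Notation lam := (@lebesgue_measure_tuple R d).
Local Notation rv := (@rV_of_tuple R d).
Local Notation e_ i := (delta_mx ord0 i : 'rV[R]_d).

(** Half-open, so that a box is the disjoint union of equal subcubes; continuity and bounds are
    taken on the closed box of [hbox_cbox]. *)
Definition hbox (lo : 'I_d -> R) (l : R) : set (d.-tuple MR) :=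
  pbox (fun j => [set` `[lo j, (lo j + l)[] : set MR).

Lemma measurable_hbox lo l : measurable (hbox lo l).
Proof. by apply: measurable_pbox => j; exact: measurable_itv. Qed.

Lemma hbox_cbox lo l : hbox lo l `<=` cbox lo (fun j => lo j + l).
Proof.
by move=> t tl j; have := tl j; rewrite /= !in_itv/= => /andP[-> /ltW].
Qed.

Lemma cbox_fin lo hi : (lam (cbox lo hi) < +oo)%E.
Proof. by apply: pbox_fin => j; [exact: measurable_itv|exact: itv_lt_pinfty]. Qed.

Lemma measurable_cbox (lo hi : 'I_d -> R) : measurable (cbox lo hi).
Proof. by apply: measurable_pbox => j; exact: measurable_itv. Qed.

Lemma hbox_fin lo l : (lam (hbox lo l) < +oo)%E.
Proof.
apply: le_lt_trans (cbox_fin lo (fun j => lo j + l)); apply: le_measure.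
- by rewrite inE; exact: measurable_hbox.
- by rewrite inE; exact: measurable_cbox.
- exact: hbox_cbox.
Qed.

Lemma itvco_integrable (f : R -> R) (a b : R) :
  (forall s, a <= s <= b -> {for s, continuous f}) ->
  lebesgue_measure.-integrable (`[a, b[%classic : set MR) (EFin \o (fun s => `|f s|)).
Proof.
move=> cf; have bf := bmeas_norm (continuous_bmeas_itv cf).
have mc : measurable (`[a, b]%classic : set MR) by exact: measurable_itv.
apply: (integrableS mc); [exact: measurable_itv|exact: subset_itv_co_cc|].
exact: bmeas_integrable mc (itv_lt_pinfty _ _) bf.
Qed.

Variables (O : set 'rV[R]_d) (oO : open O).

Lemma cube_nash (F : 'rV[R]_d -> R) (lo : 'I_d -> R) (r : R) : 0 < r ->
  C1 O F -> (forall t, cbox lo (fun j => lo j + r) t -> O (rv t)) ->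
  \int[lam]_(t in hbox lo r) (F (rv t) ^+ 2) <=
  2 ^+ d * (r ^- d * (\int[lam]_(t in hbox lo r) `|F (rv t)|) ^+ 2 +
    r ^+ 2 * \sum_c \int[lam]_(t in hbox lo r) ('D_(e_ c) F (rv t) ^+ 2)).
Proof.
move=> r0 cF KO.
have bF : bmeas (hbox lo r) (F \o rv).
  apply: bmeasS (bmeas_rV oO _ KO); [exact: measurable_cbox|exact: hbox_cbox|].
  by move=> u; exact: C1_cont.
have bD c : bmeas (hbox lo r) ('D_(e_ c) F \o rv).
  apply: bmeasS (bmeas_rV oO _ KO); [exact: measurable_cbox|exact: hbox_cbox|].
  by move=> u; exact: C1_dcont.
apply: (poincare_nash (f := F \o rv) (g := fun c => 'D_(e_ c) F \o rv)) => //.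
- by move=> j; rewrite lebesgue_measure_itv/= lte_fin ltrDl r0 -EFinD addrC addKr.
move=> t c Kt.
have Ku s : lo c <= s <= lo c + r -> O (rv (upd t c s)).
  move=> ls; apply: KO => j; rewrite tnth_upd; case: eqP => [->|_]; first by rewrite /= in_itv.
  exact: (hbox_cbox Kt).
have tc : lo c <= tnth t c <= lo c + r.
  by have := hbox_cbox Kt c; rewrite /= in_itv.
have cs s : lo c <= s <= lo c + r -> {for s, continuous (fun s => F (rv (upd t c s)))}.
  by move=> /Ku Os; apply: continuous_upd; exact: C1_cont cF _ Os.
have cDs s : lo c <= s <= lo c + r -> {for s, continuous (fun s => 'D_(e_ c) F (rv (upd t c s)))}.
  by move=> /Ku Os; apply: (continuous_upd (f := 'D_(e_ c) F)); exact: C1_dcont cF c _ Os.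
have := @line_bound R (fun s => F (rv (upd t c s))) (fun s => 'D_(e_ c) F (rv (upd t c s)))
  (lo c) r (tnth t c) r0 _ cDs tc.
rewrite upd_id !Rintegral_itv_bndo_bndc//.
- apply; move=> s /Ku Os; apply: is_derive_upd; exact: C1_derive cF c _ Os.
- exact: (itvco_integrable (f := fun s => 'D_(e_ c) F (rv (upd t c s)))).
- exact: (itvco_integrable (f := fun s => F (rv (upd t c s)))).
Qed.

(** The Poincare inequality on each of the [N.+1 ^ d] subcubes of side [r], summed. A small [r]
    favours the gradient term at the cost of a factor [r ^- d] on the L1 term: this trade-off is the
    Nash inequality. *)
Lemma box_nash (F : 'rV[R]_d -> R) (lo : 'I_d -> R) (l r : R) (N : nat) : 0 < l -> r = l / N.+1%:R ->
  C1 O F -> (forall t, cbox lo (fun j => lo j + l) t -> O (rv t)) ->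
  \int[lam]_(t in hbox lo l) (F (rv t) ^+ 2) <=
  2 ^+ d * (r ^- d * (\int[lam]_(t in hbox lo l) `|F (rv t)|) ^+ 2 +
    r ^+ 2 * \sum_c \int[lam]_(t in hbox lo l) ('D_(e_ c) F (rv t) ^+ 2)).
Proof.
move=> l0 rE cF KO.
have N0 : 0 < N.+1%:R :> R by [].
have r0 : 0 < r by rewrite rE divr_gt0.
pose lok (k : {ffun 'I_d -> 'I_N.+1}) j := lo j + (k j)%:R * r.
pose Q k := hbox (lok k) r.
have rN : N.+1%:R * r = l by rewrite rE mulrC divfK ?gt_eqF.
have lok_ge k j : lo j <= lok k j by rewrite lerDl mulr_ge0// ltW.
have lok_le k j : lok k j + r <= lo j + l.
  rewrite -addrA lerD2l -rN -[X in _ + X]mul1r -mulrDl ler_pM2r// natr1 ler_nat.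
  exact: ltn_ord.
have bint (G : 'rV[R]_d -> R) E : measurable E -> E `<=` cbox lo (fun j => lo j + l) ->
    (forall u, O u -> {for u, continuous G}) ->
    lam.-integrable E (EFin \o (fun t => G (rv t))).
  move=> mE EK cG; apply: bmeas_integrable => //.
    by apply: le_lt_trans (cbox_fin lo (fun j => lo j + l)); apply: le_measure; rewrite ?inE//; exact: measurable_cbox.
  exact: bmeasS (measurable_cbox _ _) EK (bmeas_rV oO cG KO).
have Kh : hbox lo l `<=` cbox lo (fun j => lo j + l) by exact: hbox_cbox.
have hboxE : hbox lo l = \big[setU/set0]_(k <- index_enum {ffun 'I_d -> 'I_N.+1}) Q k.
  rewrite -bigcup_seq; apply/seteqP; split => [t Kt|t [k _ Qt] j]; last first.
    have := Qt j; rewrite /= !in_itv/= => /andP[h1 h2].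
    by rewrite (le_trans _ h1)//= (lt_le_trans h2).
  have kP j : exists k : 'I_N.+1, lo j + k%:R * r <= tnth t j < lo j + k%:R * r + r.
    have := Kt j; rewrite /= in_itv/= => /andP[h1 h2].
    pose x := (tnth t j - lo j) / r.
    have x0 : 0 <= x by rewrite divr_ge0 ?subr_ge0// ltW.
    have xE : tnth t j = lo j + x * r by rewrite /x divfK ?gt_eqF// addrC subrK.
    have /andP[t1 t2] := truncn_itv x0.
    have tN : (Num.truncn x < N.+1)%N.
      rewrite -(ltr_nat R) (le_lt_trans t1)// -(ltr_pM2r r0) rN -(ltrD2l (lo j)) -xE//.
    exists (Ordinal tN); rewrite xE /= lerD2l ler_pM2r// t1/= -addrA ltrD2l.
    by rewrite -[X in _ < _ + X]mul1r -mulrDl ltr_pM2r// natr1.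
  have /choice[k kt] := kP.
  exists (finfun k); first by rewrite /= mem_index_enum.
  by move=> j; rewrite /= in_itv/= /lok ffunE; exact: kt.
have tQ : trivIset [set` index_enum {ffun 'I_d -> 'I_N.+1}] Q.
  apply/trivIsetP => k k' _ _ kk'; apply/seteqP; split => // t [Qt Qt'].
  case/eqP: kk'; apply/ffunP => j; apply/val_inj => /=.
  have := Qt j; have := Qt' j; rewrite /= !in_itv/= /lok => /andP[a1 a2] /andP[b1 b2].
  have lt1 (x y : nat) : lo j + x%:R * r <= tnth t j -> tnth t j < lo j + y%:R * r + r -> (x <= y)%N.
    move=> h1 h2; have := le_lt_trans h1 h2.
    rewrite -addrA ltrD2l -[X in _ < _ + X]mul1r -mulrDl ltr_pM2r// natr1 ltr_nat ltnS//.
  by apply/eqP; rewrite eqn_leq !lt1.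
have split_int (G : 'rV[R]_d -> R) : (forall u, O u -> {for u, continuous G}) ->
    \int[lam]_(t in hbox lo l) G (rv t) = \sum_k \int[lam]_(t in Q k) G (rv t).
  move=> cG; rewrite /Rintegral [in LHS]hboxE integral_bigsetU_EFin//.
  - rewrite -sum_fine// => k _; apply: integrable_fin_num; first exact: measurable_hbox.
    apply: (bint G) => //; first exact: measurable_hbox.
    move=> t Qt; apply: Kh; rewrite hboxE -bigcup_seq; exists k => //.
    by rewrite /= mem_index_enum.
  - by move=> k; exact: measurable_hbox.
  - exact: index_enum_uniq.
  - rewrite -hboxE.
    by have /integrableP[] := bint G _ (measurable_hbox _ _) Kh cG.
have cFc u : O u -> {for u, continuous F} by exact: C1_cont.
have cDc c u : O u -> {for u, continuous ('D_(e_ c) F)} by exact: C1_dcont.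
have cX2 (G : 'rV[R]_d -> R) : (forall u, O u -> {for u, continuous G}) ->
    forall u, O u -> {for u, continuous (fun u => G u ^+ 2)}.
  by move=> cG u Ou; apply: continuousM; exact: cG.
have cN (G : 'rV[R]_d -> R) : (forall u, O u -> {for u, continuous G}) ->
    forall u, O u -> {for u, continuous (fun u => `|G u|)}.
  by move=> cG u Ou; apply: continuous_comp; [exact: cG|exact: norm_continuous].
rewrite (split_int _ (cX2 _ cFc)) (split_int _ (cN _ cFc)).
rewrite (eq_bigr _ (fun c _ => split_int _ (cX2 _ (cDc c)))).
apply: le_trans (_ : \sum_k 2 ^+ d * (r ^- d * (\int[lam]_(t in Q k) `|F (rv t)|) ^+ 2 +
    r ^+ 2 * \sum_c \int[lam]_(t in Q k) ('D_(e_ c) F (rv t) ^+ 2)) <= _).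
  apply: ler_sum => k _; apply: cube_nash => // t Qt; apply: KO => j.
  have := Qt j; rewrite /= !in_itv/= => /andP[h1 h2].
  by rewrite (le_trans _ h1)//= (le_trans h2).
rewrite -mulr_sumr ler_wpM2l ?exprn_ge0// big_split/= -!mulr_sumr exchange_big/= lerD2r.
rewrite ler_wpM2l ?invr_ge0 ?exprn_ge0 ?(ltW r0)//.
pose I k := \int[lam]_(t in Q k) `|F (rv t)|.
have I0 k : 0 <= I k by exact: Rintegral_ge0.
(* The sum of the squares of the L1 norms over the subcubes is at most the square of their sum. *)
rewrite [X in _ <= X]expr2 mulr_suml; apply: ler_sum => k _.
rewrite expr2 ler_wpM2l ?I0// (bigD1 k)//= lerDl sumr_ge0// => k' _; exact: I0.
Qed.

End box_nash.

Section chart_integral.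
Context {R : realType} {d : nat} {M : ptopologicalType}.
Context {A : smooth_atlas R d M} (g : riemannian_metric A).
Variable vol : {finite_measure set (borel M) -> \bar R}.
Hypothesis vol_riemannian : is_riemannian_volume g vol.
Variable i : chart_index A.
Local Notation MR := (measurableTypeR R).
Local Notation lam := (@lebesgue_measure_tuple R d).
Local Notation rv := (@rV_of_tuple R d).
Local Notation e_ i := (delta_mx ord0 i : 'rV[R]_d).

Definition chart_cod : set 'rV[R]_d := chart i @` chart_dom i.
Local Notation O := chart_cod.
Definition ginv (a b : 'I_d) (u : 'rV[R]_d) := invmx (gram g i u) a b.
Local Notation w := (vol_density g i).

Lemma open_cod : open O. Proof. exact: chart_cod_open. Qed.
Local Notation oO := open_cod.

Lemma chart_paramK u : O u -> chart_dom i (param i u) /\ chart i (param i u) = u.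
Proof. by move=> [p dp <-]; rewrite chartK. Qed.

Lemma cod_chart p : chart_dom i p -> O (chart i p).
Proof. by exists p. Qed.

Lemma C1_gram a b : C1 O (fun u => gram g i u a b).
Proof. exact: C1_Cn1 (gram_smooth g i a b 1). Qed.

Lemma det_gram_gt0 u : O u -> 0 < \det (gram g i u).
Proof. by move=> Ou; apply: posdef_det_gt0 => v v0; exact: gram_posdef. Qed.

Lemma C1_density : C1 O w.
Proof.
apply: C1_sqrt; [exact: oO| |exact: det_gram_gt0].
by apply: C1_det; [exact: oO|exact: C1_gram].
Qed.

Lemma density_gt0 u : O u -> 0 < w u.
Proof. by move=> Ou; rewrite sqrtr_gt0 det_gram_gt0. Qed.

Lemma C1_ginv a b : C1 O (ginv a b).
Proof.
apply: C1_invmx; [exact: oO|exact: C1_gram|].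
by move=> u Ou; rewrite gt_eqF// det_gram_gt0.
Qed.

Lemma ginv_sym a b u : O u -> ginv a b u = ginv b a u.
Proof. by move=> Ou; rewrite /ginv -[in RHS](gram_sym g Ou) -trmx_inv mxE. Qed.

Lemma laplacianE (f : M -> R) u : O u ->
  divflux w ginv (f \o param i) u = - (w u * laplacian g i f u).
Proof.
move=> Ou; rewrite /laplacian mulNr mulrN mulrA divff ?gt_eqF ?density_gt0//.
by rewrite mul1r opprK.
Qed.

(** This is [posdef_cauchy_schwarz] for the vector of the partial derivatives, multiplied by the
    density. *)
Lemma dirichlet_ge (F : 'rV[R]_d -> R) c u : O u ->
  w u * 'D_(e_ c) F u ^+ 2 <= gram g i u c c * dirichlet w ginv F u.
Proof.
move=> Ou; pose v : 'rV[R]_d := \row_a 'D_(e_ a) F u.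
have := posdef_cauchy_schwarz v c (gram_sym g Ou) (fun v v0 => gram_posdef g Ou v0).
rewrite mxE => h; apply: le_trans (ler_wpM2l (ltW (density_gt0 Ou)) h) _.
rewrite mulrCA le_eqVlt; apply/orP; left; apply/eqP; congr (_ * _).
rewrite mxE mulr_sumr /dirichlet /flux.
under [RHS]eq_bigr do rewrite mulrCA mulr_sumr.
rewrite -[RHS]mulr_sumr -mulr_sumr; congr (_ * _).
rewrite exchange_big/=; apply: eq_bigr => b _; rewrite !mxE mulr_suml.
apply: eq_bigr => a _; by rewrite !mxE /ginv mulrA [_ * invmx _ _ _]mulrC [invmx _ _ _ * _]mulrC.
Qed.

Definition tuple_of_rV (u : 'rV[R]_d) : d.-tuple MR := [tuple u ord0 j | j < d].

Lemma tuple_of_rVK : cancel tuple_of_rV rv.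
Proof. by move=> u; apply/rowP => j; rewrite mxE tnth_mktuple. Qed.

Lemma rV_of_tupleK : cancel rv tuple_of_rV.
Proof. by move=> t; apply: eq_from_tnth => j; rewrite tnth_mktuple mxE. Qed.

Definition chart_set (K : set (d.-tuple MR)) : set (borel M) :=
  [set p | chart_dom i p /\ K (tuple_of_rV (chart i p))].

Lemma measurable_chart_dom : measurable (chart_dom i : set (borel M)).
Proof. by apply: sub_sigma_algebra; exact: chart_dom_open. Qed.

Lemma measurable_chart_set K : measurable K -> measurable (chart_set K).
Proof.
move=> mK.
(* The coordinates are continuous only on the chart domain, so they are extended by 0 to functions
   measurable on all of [M]. *)
pose h (p : borel M) : d.-tuple MR :=
  [tuple ((fun q : borel M => chart i q ord0 j) \_ (chart_dom i)) p | j < d].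
have mh : measurable_fun setT h.
  apply/measurable_fun_tnthP => j.
  rewrite (_ : _ \o h = (fun q : borel M => chart i q ord0 j) \_ (chart_dom i)); last first.
    by apply/funext => p; rewrite /= tnth_mktuple.
  apply/(measurable_restrictT _ measurable_chart_dom).
  apply: continuous_measurable_borel => [|p dp]; first exact: chart_dom_open.
  apply: (@continuous_comp _ _ _ (chart i) (fun u : 'rV[R]_d => u ord0 j)).
    exact: chart_continuous.
  exact: coord_continuous.
have -> : chart_set K = chart_dom i `&` (setT `&` h @^-1` K).
  rewrite setTI; apply/seteqP; split => p [dp Kp]; split => //=; move: Kp => /=.
    suff -> : h p = tuple_of_rV (chart i p) by [].
    by apply: eq_from_tnth => j; rewrite !tnth_mktuple patchE mem_set.
  suff -> : h p = tuple_of_rV (chart i p) by [].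
  by apply: eq_from_tnth => j; rewrite !tnth_mktuple patchE mem_set.
by apply: measurableI; [exact: measurable_chart_dom|exact: mh].
Qed.

(** The closed box inside the codomain of the chart makes the density bounded on [K], and the
    measure of [K] finite. *)
Lemma chart_Rintegral (lo hi : 'I_d -> R) (K : set (d.-tuple MR)) (f : borel M -> R) :
  (forall t, cbox lo hi t -> O (rv t)) -> measurable K -> K `<=` cbox lo hi ->
  bmeas (chart_set K) f ->
  \int[vol]_(p in chart_set K) f p = \int[lam]_(t in K) (f (param i (rv t)) * w (rv t)).
Proof.
move=> boxO mK Kbox bf.
have KO t : K t -> O (rv t) by move=> /Kbox /boxO.
have Koo : (lam K < +oo)%E.
  apply: le_lt_trans (cbox_fin lo hi); apply: le_measure; rewrite ?inE//.
  exact: measurable_cbox.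
have bw : bmeas K (fun t => w (rv t)).
  apply: bmeasS Kbox (bmeas_rV open_cod _ boxO); first exact: measurable_cbox.
  by move=> u Ou; exact: C1_cont C1_density u Ou.
have mV := measurable_chart_set mK.
pose h (t : d.-tuple MR) : borel M := param i (rv t).
apply: (Rintegral_density_pushforward (h := h) (w := fun t => w (rv t))) => //.
- apply: (@measurability _ _ _ (borel M) K h (@open M)) => //.
  move=> _ [W oW <-].
  have -> : K `&` h @^-1` W =
      K `&` [set t | (O `&` [set u | W (param i u)]) (rv t)].
    by apply/seteqP; split => t /=; [move=> [Kt Wt]; do !split => //; exact: KO|move=> [Kt []]].
  apply: measurableI => //; apply: measurable_rV_open.
  rewrite openE => u [Ou /= Wu]; apply: filterI.
    exact: open_nbhs_nbhs (conj open_cod Ou).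
  exact: (param_continuous Ou) (open_nbhs_nbhs (conj oW Wu)).
- by case: bw.
- move=> t Kt; have [dp cp] := chart_paramK (KO t Kt).
  by split=> //; rewrite cp rV_of_tupleK.
- by move=> t /KO Ot; exact/ltW/density_gt0.
- move=> B mB BV; apply: etrans (vol_riemannian mB (_ : B `<=` chart_dom i)) _.
    by move=> p /BV[].
  congr (\int[_]_(_ in _) _)%E; apply/seteqP; split => t /=.
    move=> [p Bp cp]; have [dp Kp] := BV p Bp.
    split; last by rewrite /h -cp chartK.
    by rewrite -[t]rV_of_tupleK -cp.
  move=> [Kt Bt]; exists (param i (rv t)) => //.
  by case: (chart_paramK (KO t Kt)).
- by rewrite ltey_eq fin_num_measure.
Qed.

Lemma C2_smooth (f : M -> R) : smooth A f -> C2 O (f \o param i).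
Proof. by move=> sf; exact: C2_Cn2 (sf i 2). Qed.

End chart_integral.

(** * Estimates for the Laplacian near a point *)

Section local_estimates.
Context {R : realType} {d : nat} {M : ptopologicalType}.
Context {A : smooth_atlas R d M} (g : riemannian_metric A).
Variable vol : {finite_measure set (borel M) -> \bar R}.
Hypothesis vol_riemannian : is_riemannian_volume g vol.
Local Notation MR := (measurableTypeR R).
Local Notation lam := (@lebesgue_measure_tuple R d).
Local Notation rv := (@rV_of_tuple R d).
Local Notation e_ i := (delta_mx ord0 i : 'rV[R]_d).

(* [L] is the Laplacian of [f] as a function on the manifold. *)
Record laplacian_pair (f L : borel M -> R) : Prop := LaplacianPair {
  lp_C2 : forall i : chart_index A, C2 (chart_cod i) (f \o param i);
  lp_bmeas : bmeas setT f;
  lp_bmeasL : bmeas setT L;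
  lp_lap : forall (i : chart_index A) p, chart_dom i p -> laplacian g i f (chart i p) = L p }.

Lemma vol_fin (B : set (borel M)) : measurable B -> (vol B < +oo)%E.
Proof. by move=> mB; rewrite ltey_eq fin_num_measure. Qed.

Lemma bm_int (B : set (borel M)) f : measurable B -> bmeas B f -> vol.-integrable B (EFin \o f).
Proof. by move=> mB bf; apply: bmeas_integrable => //; exact: vol_fin. Qed.

Section chart_box.
Variables (i : chart_index A) (c : 'rV[R]_d) (rho : R).
Hypothesis rho0 : 0 < rho.
Let lo j := c ord0 j - 2 * rho.
Let hi j := c ord0 j + 2 * rho.
Hypothesis boxO : forall t, cbox lo hi t -> chart_cod i (rv t).
Local Notation O := (chart_cod i).
Local Notation w := (vol_density g i).
Local Notation K := (cbox lo hi).
Let oO : open O. Proof. exact: open_cod. Qed.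

(** A polynomial cutoff: each factor is [(4 - (u_j - c_j)^2 / rho^2) / 3], which is 0 on the two
    faces at distance [2 rho] from the centre and at least 1 within distance [rho]. The integrations
    by parts take place on the box and only use the zeros on its boundary. *)
Let theta (u : 'rV[R]_d) : R := \prod_j ((4 + (u ord0 j - c ord0 j) * (u ord0 j - c ord0 j) * - rho ^- 2) * 3^-1).
Let eta u := theta u * theta u.

Let C2theta : C2 O theta.
Proof.
apply: C2_prod => // j; have c1 k : C2 O (cst k) by exact: C2_cst.
have c2 : C2 O (fun u => u ord0 j - c ord0 j) by apply: (C2D oO); [exact: C2_coord|exact: c1].
apply: (C2M oO); last exact: c1.
apply: (C2D oO); first exact: c1.
by apply: (C2M oO); [exact: (C2M oO)|exact: c1].
Qed.

Let rho_neq0 : rho != 0. Proof. by rewrite gt_eqF. Qed.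

Let theta0 t a : K t -> tnth t a = lo a \/ tnth t a = hi a -> theta (rv t) = 0.
Proof.
move=> _ ta; apply/eqP; rewrite prodf_seq_eq0; apply/hasP; exists a; first exact: mem_index_enum.
rewrite /= mxE; apply/eqP.
have -> : (tnth t a - c ord0 a) * (tnth t a - c ord0 a) = 4 * rho ^+ 2.
  by case: ta => ->; rewrite /lo /hi; ring.
by rewrite mulrN mulfK ?expf_neq0// subrr mul0r.
Qed.

Let eta_ge1 t : (forall j, `|tnth t j - c ord0 j| <= rho) -> 1 <= eta (rv t).
Proof.
move=> tc; suff th1 : 1 <= theta (rv t) by rewrite /eta; nra.
rewrite /theta; elim/big_ind : _ => //= [x y x1 y1|j _]; first nra.
have h : (tnth t j - c ord0 j) ^+ 2 <= rho ^+ 2.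
  by rewrite -[X in X <= _]real_normK ?num_real// lerXn2r// nnegrE ltW.
rewrite mxE ler_pdivlMr// mul1r mulrN -expr2.
have : (tnth t j - c ord0 j) ^+ 2 * rho ^- 2 <= 1.
  by rewrite ler_pdivrMr ?exprn_gt0// mul1r.
lra.
Qed.

Let C2e : C2 O eta. Proof. exact: C2M. Qed.

Let mK : measurable K. Proof. exact: measurable_cbox. Qed.
Let Koo : (lam K < +oo)%E. Proof. exact: cbox_fin. Qed.
Let V := chart_set i K.
Let mV : measurable V. Proof. exact: measurable_chart_set. Qed.

Let bK (h : 'rV[R]_d -> R) : (forall u, O u -> {for u, continuous h}) -> bmeas K (fun t => h (rv t)).
Proof. by move=> ch; exact: bmeas_rV oO ch boxO. Qed.

Let KI (h : d.-tuple MR -> R) : bmeas K h -> lam.-integrable K (EFin \o h).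
Proof. by move=> bh; exact: bmeas_integrable. Qed.

Let C1w : C1 O w. Proof. exact: C1_density. Qed.
Let w_gt0 u : O u -> 0 < w u. Proof. exact: density_gt0. Qed.
Let cw u : O u -> {for u, continuous w}. Proof. by move=> Ou; exact: C1_cont C1w u Ou. Qed.

Let winv_bound : exists2 W, 0 < W & forall t, K t -> 1 <= W * w (rv t).
Proof.
have [_ [B wB]] : bmeas K (fun t => (w (rv t))^-1).
  apply: (bK (h := fun u => (w u)^-1)) => u Ou; apply: continuousV; last exact: cw.
  by rewrite gt_eqF// w_gt0.
exists (`|B| + 1); first by rewrite ltr_wpDl.
move=> t Kt; have wt := w_gt0 (boxO Kt); rewrite -ler_pdivrMr// mul1r.
have := wB t Kt; rewrite gtr0_norm ?invr_gt0// => h.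
by rewrite (le_trans h)// (le_trans (ler_norm _))// lerDl.
Qed.

(** Error terms are estimated by multiples of the density [w], which turns Lebesgue integrals over
    the box into integrals for [vol]. *)
Let le_w (h : 'rV[R]_d -> R) : (forall u, O u -> {for u, continuous h}) ->
  exists2 C, 0 <= C & forall t, K t -> `|h (rv t)| <= C * w (rv t).
Proof.
move=> ch; have [_ [B hB]] := bK ch; have [W W0 Ww] := winv_bound.
exists (`|B| * W); first by rewrite mulr_ge0// ltW.
move=> t Kt; have Wt := Ww t Kt.
rewrite (le_trans (hB t Kt))// (le_trans (ler_norm B))// -mulrA -[X in X <= _]mulr1.
by rewrite ler_wpM2l.
Qed.

Let cutoff : borel M -> R := (fun p => eta (chart i p)) \_ V.

Let eta_chart : bmeas V (fun p => eta (chart i p)).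
Proof.
split.
  apply: (@measurable_funS _ _ _ _ (chart_dom i : set (borel M))).
  - exact: measurable_chart_dom.
  - by move=> p [].
  - apply: continuous_measurable_borel => [|p dp]; first exact: chart_dom_open.
    apply: (@continuous_comp _ _ _ (chart i) eta); first exact: chart_continuous.
    by apply: C1_cont (C2_C1 C2e) _ _; exact: cod_chart.
have [_ [B hB]] := bK (fun u (Ou : O u) => C1_cont (C2_C1 C2e) Ou).
by exists B => p [dp Kp]; have := hB _ Kp; rewrite tuple_of_rVK.
Qed.

Let cutoff_bmeas : bmeas setT cutoff.
Proof.
have [me [B eB]] := eta_chart.
split; first exact/(measurable_restrictT _ mV).
exists `|B| => p _; rewrite /cutoff patchE; case: ifPn => [/set_mem Vp|_]; last by rewrite normr0.
by rewrite (le_trans (eB p Vp))// ler_norm.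
Qed.

Let cutoff_int (h : borel M -> R) : bmeas setT h ->
  \int[vol]_p (cutoff p * h p) =
  \int[lam]_(t in K) (eta (rv t) * h (param i (rv t)) * w (rv t)).
Proof.
move=> bh.
have -> : \int[vol]_p (cutoff p * h p) = \int[vol]_(p in V) (eta (chart i p) * h p).
  rewrite [RHS]Rintegral_mkcond; apply: eq_Rintegral => p _.
  by rewrite /cutoff !patchE; case: ifP => // _; rewrite mul0r.
rewrite (chart_Rintegral vol_riemannian boxO mK)//; last first.
  by apply: bmeasM => //; exact: bmeasS bh.
apply: eq_Rintegral => t /set_mem Kt; congr (eta _ * _ * _).
by case: (chart_paramK (boxO Kt)).
Qed.

Let flux_pair f L : laplacian_pair f L -> forall u, O u ->
  L (param i u) * w u = - divflux w (ginv g i) (f \o param i) u.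
Proof.
move=> [_ _ _ lapf] u Ou; have [du cu] := chart_paramK Ou.
by rewrite laplacianE// opprK -(lapf i _ du) cu mulrC.
Qed.

Let dir_ge0 (F : 'rV[R]_d -> R) u : O u -> 0 <= dirichlet w (ginv g i) F u.
Proof.
(* In dimension 0 the sum is empty; otherwise any coordinate [a] shows that the energy density is
   nonnegative. *)
move=> Ou; case: (pickP (pred_of_simpl (@predT 'I_d))) => [a _|d0]; last first.
  by rewrite /dirichlet big1// => a _; have := d0 a.
have := dirichlet_ge g F a Ou.
have gaa : 0 < gram g i u a a.
  have /(gram_posdef g Ou) : (delta_mx ord0 a : 'rV[R]_d) != 0.
    by apply/rV0Pn; exists a; rewrite mxE !eqxx oner_neq0.
  by rewrite -rowE trmx_delta -colE !mxE.
rewrite -(pmulr_rge0 _ gaa); apply: le_trans.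
by rewrite mulr_ge0 ?sqr_ge0// ltW// w_gt0.
Qed.

(** This is [local_identity] transported to [M]; the signs are opposite since the positive Laplacian
    is minus the divergence. *)
Let identity (f L : borel M -> R) (psi psi1 psi2 : R -> R) : laplacian_pair f L ->
  (forall s : R, is_derive s 1 psi (psi1 s)) ->
  (forall s : R, is_derive s 1 psi1 (psi2 s)) -> continuous psi2 ->
  \int[vol]_p (cutoff p * (psi1 (f p) * L p)) =
  \int[lam]_(t in K) (eta (rv t) * psi2 (f (param i (rv t))) *
      dirichlet w (ginv g i) (f \o param i) (rv t)) -
  \int[lam]_(t in K) (psi (f (param i (rv t))) * divflux w (ginv g i) eta (rv t)).
Proof.
move=> fL dpsi dpsi1 cpsi2; have [C2f bf bL _] := fL.
have lohi a : lo a <= hi a by rewrite /lo /hi; have := rho0; lra.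
have ginvS a b u : O u -> ginv g i a b u = ginv g i b a u by exact: ginv_sym.
have C1g a b : C1 O (ginv g i a b) by exact: C1_ginv.
have := local_identity oO C1w C1g ginvS lohi boxO C2theta theta0 (C2f i) dpsi dpsi1 cpsi2.
move=> /(congr1 -%R); rewrite opprB => <-.
have cpsi1 : continuous psi1.
  by move=> s; apply/differentiable_continuous/derivable1_diffP; case: (dpsi1 s).
rewrite cutoff_int; last first.
  apply: bmeasM => //; have [mf [B fB]] := bf; split.
    by apply: measurableT_comp => //; exact: continuous_measurable_fun.
  have [_ [B' hB']] := continuous_bmeas_itv (a := - B) (b := B) (fun s _ => cpsi1 s).
  by exists B' => p _; apply: hB'; rewrite /= in_itv/= -ler_norml fB.
rewrite -[RHS]mulN1r -RintegralZl//; last first.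
  apply: KI; apply: (bK (h := fun u => eta u * psi1 ((f \o param i) u) * divflux w (ginv g i) (f \o param i) u)) => u Ou.
  apply: continuousM; last exact: (cont_divflux oO C1w C1g (C2f i) Ou).
  apply: continuousM; first exact: C1_cont (C2_C1 C2e) _ Ou.
  by apply: continuous_comp; [exact: C1_cont (C2_C1 (C2f i)) _ Ou|exact: cpsi1].
apply: eq_Rintegral => t /set_mem Kt.
by rewrite mulN1r -mulrA -mulrA (flux_pair fL (boxO Kt)) !mulrN mulrA.
Qed.

Let Kchart (h : borel M -> R) : bmeas setT h ->
  \int[vol]_(p in V) h p = \int[lam]_(t in K) (h (param i (rv t)) * w (rv t)).
Proof.
by move=> bh; rewrite (chart_Rintegral vol_riemannian boxO mK)//; exact: bmeasS bh.
Qed.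

(* [psi] being convex, the term of [local_identity] with its second derivative
   has a sign. *)
Lemma contraction_box : exists (e : borel M -> R) (C : R),
  [/\ bmeas setT e, 0 <= C, forall p, 0 <= e p,
     forall p, chart_dom i p -> (forall j, `|chart i p ord0 j - c ord0 j| <= rho) -> 1 <= e p &
  forall f L (psi psi1 psi2 : R -> R), laplacian_pair f L ->
  (forall s : R, is_derive s 1 psi (psi1 s)) ->
  (forall s : R, is_derive s 1 psi1 (psi2 s)) -> continuous psi2 ->
  (forall s, 0 <= psi s) -> (forall s, 0 <= psi2 s) ->
  - (C * \int[vol]_p psi (f p)) <= \int[vol]_p (e p * (psi1 (f p) * L p))].
Proof.
have C1g a b : C1 O (ginv g i a b) by exact: C1_ginv.
have cdiv u : O u -> {for u, continuous (divflux w (ginv g i) eta)}.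
  by move=> Ou; exact: (cont_divflux oO C1w C1g C2e Ou).
have [C C0 divC] := le_w cdiv.
exists cutoff, C; split => //.
- by move=> p; rewrite /cutoff patchE; case: ifP => // _; rewrite /eta -expr2 sqr_ge0.
- move=> p dp pc; have Kp : K (tuple_of_rV (chart i p)).
    move=> j; rewrite tnth_mktuple /= in_itv/= -ler_distl.
    by rewrite (le_trans (pc j))// ler_pMl// ler1n.
  rewrite /cutoff patchE mem_set//.
  rewrite -[chart i p]tuple_of_rVK; apply: eta_ge1 => j; rewrite tnth_mktuple//.
move=> f L psi psi1 psi2 fL dpsi dpsi1 cpsi2 psi_ge0 psi2_ge0.
have [C2f bf bL _] := fL.
have cpsi : continuous psi.
  by move=> s; apply/differentiable_continuous/derivable1_diffP; case: (dpsi s).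
have bpsi : bmeas setT (fun p => psi (f p)).
  have [mf [B fB]] := bf; split.
    by apply: measurableT_comp => //; exact: continuous_measurable_fun.
  have [_ [B' hB']] := continuous_bmeas_itv (a := - B) (b := B) (fun s _ => cpsi s).
  by exists B' => p _; apply: hB'; rewrite /= in_itv/= -ler_norml fB.
have cpF u : O u -> {for u, continuous (fun u => psi ((f \o param i) u))}.
  by move=> Ou; apply: continuous_comp; [exact: C1_cont (C2_C1 (C2f i)) _ Ou|exact: cpsi].
rewrite (identity fL dpsi dpsi1 cpsi2) -[X in X <= _]add0r; apply: lerB.
  apply: Rintegral_ge0 => t Kt; apply: mulr_ge0; last exact: dir_ge0 (boxO Kt).
  apply: mulr_ge0; last exact: psi2_ge0.
  by rewrite /eta -expr2 sqr_ge0.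
apply: (@le_trans _ _ (\int[lam]_(t in K) (C * (psi (f (param i (rv t))) * w (rv t))))).
  apply: le_Rintegral => //.
  - apply: KI; apply: (bK (h := fun u => psi ((f \o param i) u) * divflux w (ginv g i) eta u)) => u Ou.
    by apply: continuousM; [exact: cpF|exact: cdiv].
  - apply: KI; apply: bmeasM; first exact: bmeas_cst.
    by apply: bmeasM; [exact: (bK cpF)|exact: (bK cw)].
  - move=> t Kt; rewrite mulrCA ler_wpM2l//.
    by rewrite (le_trans (ler_norm _))// divC.
rewrite RintegralZl//; last by apply: KI; apply: bmeasM; [exact: (bK cpF)|exact: (bK cw)].
rewrite ler_wpM2l// -(Kchart bpsi).
by apply: Rintegral_subset => //; exact: vol_fin.
Qed.

Let N2 (f : borel M -> R) := \int[vol]_p (f p ^+ 2).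

Let absCS f L : bmeas setT f -> bmeas setT L ->
  \int[vol]_p (`|f p| * `|L p|) <= Num.sqrt (N2 f * N2 L).
Proof.
move=> bf bL.
have := Rintegral_CS_bmeas (mu := vol) measurableT (vol_fin measurableT) (bmeas_norm bf) (bmeas_norm bL).
under [X in _ <= X * _ -> _]eq_Rintegral do rewrite -normrX ger0_norm ?sqr_ge0//.
under [X in _ <= _ * X -> _]eq_Rintegral do rewrite -normrX ger0_norm ?sqr_ge0//.
move=> h; rewrite -[leLHS]ger0_norm; last by apply: Rintegral_ge0 => p _; rewrite mulr_ge0.
by rewrite -sqrtr_sqr ler_wsqrtr.
Qed.

(* This is [local_identity] for [psi s = s ^+ 2]. *)
Lemma energy_box : exists2 C, 0 <= C & forall f L a, laplacian_pair f L ->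
  \int[lam]_(t in hbox (fun j => c ord0 j - rho) (2 * rho))
     ('D_(e_ a) (f \o param i) (rv t) ^+ 2) <= C * (Num.sqrt (N2 f * N2 L) + N2 f).
Proof.
have C1g a b : C1 O (ginv g i a b) by exact: C1_ginv.
have cdiv u : O u -> {for u, continuous (divflux w (ginv g i) eta)}.
  by move=> Ou; exact: (cont_divflux oO C1w C1g C2e Ou).
have [C C0 divC] := le_w cdiv.
have [_ [B etaB]] := cutoff_bmeas.
have [W W0 Ww] := winv_bound.
have /choice[G GP] (a : 'I_d) : exists G, forall t, K t -> `|gram g i (rv t) a a| <= G.
  have [_ [G GB]] := bK (h := fun u => gram g i u a a) (fun u (Ou : O u) => C1_cont (C1_gram g i a a) Ou).
  by exists G.
pose GG := \sum_a `|G a|.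
have GG0 : 0 <= GG by apply: sumr_ge0.
have GGa a t : K t -> gram g i (rv t) a a <= GG.
  move=> Kt; rewrite (le_trans (ler_norm _))// (le_trans (GP a t Kt))//.
  rewrite (le_trans (ler_norm _))// /GG (bigD1 a)//= lerDl; exact: sumr_ge0.
(* [W * GG] compares a squared partial derivative with the energy density, through [dirichlet_ge];
   [B] bounds the cutoff and [C] its Laplacian. *)
exists (W * GG * (`|B| + C)); first by rewrite !mulr_ge0 ?addr_ge0// ltW.
move=> f L a fL; have [C2f bf bL _] := fL.
have cF u : O u -> {for u, continuous (f \o param i)}.
  by move=> Ou; exact: C1_cont (C2_C1 (C2f i)) _ Ou.
have cD u : O u -> {for u, continuous ('D_(e_ a) (f \o param i))}.
  by move=> Ou; exact: C1_dcont (C2_C1 (C2f i)) a _ Ou.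
have cdir u : O u -> {for u, continuous (dirichlet w (ginv g i) (f \o param i))}.
  by move=> Ou; exact: (cont_dirichlet oO C1w C1g (C2f i) Ou).
have ceta u : O u -> {for u, continuous eta}.
  by move=> Ou; exact: C1_cont (C2_C1 C2e) _ Ou.
have d1 (s : R) : is_derive s 1 (fun s => s ^+ 2) (2 * s).
  by apply: is_derive_eq; rewrite [s *: _]mulr1 mulrDl mul1r.
have d2 (s : R) : is_derive s 1 (fun s => 2 * s) (2 : R).
  by apply: is_derive_eq; rewrite ?[_ *: 1]mulr1 ?scaler0 ?scale0r ?addr0 ?add0r ?[_ *: 1]mulr1.
have c3 : continuous (fun _ : R => 2 : R) by move=> s; exact: cst_continuous.
have := identity fL d1 d2 c3.
set D := \int[lam]_(t in K) (eta _ * 2 * _); set E := \int[lam]_(t in K) (_ * divflux _ _ _ _).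
move=> idE.
have D_le : D <= 2 * (`|B| * Num.sqrt (N2 f * N2 L)) + C * N2 f.
  have -> : D = \int[vol]_p (cutoff p * (2 * f p * L p)) + E by rewrite idE subrK.
  apply: lerD.
    apply: (@le_trans _ _ (\int[vol]_p (2 * `|B| * (`|f p| * `|L p|)))).
      apply: le_Rintegral => //.
      - by apply: bm_int => //; auto 20 with bm.
      - by apply: bm_int => //; auto 20 with bm.
      - move=> p _; rewrite (le_trans (ler_norm _))// !normrM (@ger0_norm _ 2)//.
        have := etaB p I; have := ler_norm B; have := normr_ge0 (cutoff p).
        have : 0 <= `|f p| * `|L p| by rewrite mulr_ge0.
        rewrite -[2 * _ * _]mulrA.
        move: (`|f p| * `|L p|) => x x0 h0 h1 h2.
        rewrite [2 * `|B| * x]mulrAC -[X in _ <= X]mulrC ler_wpM2r ?mulr_ge0//.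
        exact: le_trans h2 h1.
    rewrite RintegralZl//; last by apply: bm_int => //; auto 20 with bm.
    by rewrite -mulrA !ler_wpM2l// absCS.
  apply: (@le_trans _ _ (\int[lam]_(t in K) (C * (f (param i (rv t)) ^+ 2 * w (rv t))))).
    have cF2 u : O u -> {for u, continuous (fun u => (f \o param i) u ^+ 2)}.
      by move=> Ou; apply: continuousM; exact: cF.
    apply: le_Rintegral => //.
    - apply: KI; apply: (bK (h := fun u => (f \o param i) u ^+ 2 * divflux w (ginv g i) eta u)) => u Ou.
      by apply: continuousM; [exact: cF2|exact: cdiv].
    - apply: KI; apply: bmeasM; first exact: bmeas_cst.
      by apply: bmeasM; [exact: (bK cF2)|exact: (bK cw)].
    - move=> t Kt; rewrite mulrCA ler_wpM2l ?sqr_ge0//.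
      by rewrite (le_trans (ler_norm _))// divC.
  have bf2 := bmeasX 2 bf.
  rewrite RintegralZl//; last first.
    apply: KI; apply: bmeasM; last exact: (bK cw).
    apply: (bK (h := fun u => (f \o param i) u ^+ 2)) => u Ou.
    by apply: continuousM; exact: cF.
  rewrite ler_wpM2l// -(Kchart bf2).
  apply: Rintegral_subset => //; first exact: vol_fin.
  by move=> p _; exact: sqr_ge0.
have hK : hbox (fun j => c ord0 j - rho) (2 * rho) `<=` K.
  move=> t ht j; have := ht j; rewrite /= !in_itv/= /lo /hi => /andP[h1 h2].
  by apply/andP; split; move: h1 h2 rho0; lra.
have cI u : O u -> {for u, continuous (fun u => eta u * 'D_(e_ a) (f \o param i) u ^+ 2)}.
  by move=> Ou; apply: continuousM; [exact: ceta|apply: continuousM; exact: cD].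
apply: (@le_trans _ _ (\int[lam]_(t in K) (eta (rv t) * 'D_(e_ a) (f \o param i) (rv t) ^+ 2))).
  apply: (@le_trans _ _ (\int[lam]_(t in hbox (fun j => c ord0 j - rho) (2 * rho))
     (eta (rv t) * 'D_(e_ a) (f \o param i) (rv t) ^+ 2))).
    have mh := measurable_hbox (fun j => c ord0 j - rho) (2 * rho).
    have hoo := hbox_fin (fun j => c ord0 j - rho) (2 * rho).
    apply: le_Rintegral => //.
    - apply: bmeas_integrable => //; apply: bmeasS hK _ => //.
      by apply: (bK (h := fun u => 'D_(e_ a) (f \o param i) u ^+ 2)) => u Ou; apply: continuousM; exact: cD.
    - by apply: bmeas_integrable => //; apply: bmeasS hK (bK cI).
    - move=> t ht; rewrite -[X in X <= _]mul1r ler_wpM2r ?sqr_ge0// eta_ge1// => j.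
      have := ht j; rewrite /= in_itv/= ler_distl => /andP[h1 h2].
      by apply/andP; split; move: h1 h2; lra.
  apply: Rintegral_subset => //; [exact: measurable_hbox|exact: (bK cI)|].
  by move=> t Kt; rewrite mulr_ge0 ?sqr_ge0// /eta -expr2 sqr_ge0.
have cI2 u : O u -> {for u, continuous (fun u => eta u * 2 * dirichlet w (ginv g i) (f \o param i) u)}.
  move=> Ou; apply: continuousM; last exact: cdir.
  by apply: continuousM; [exact: ceta|exact: cst_continuous].
apply: (@le_trans _ _ (\int[lam]_(t in K) (W * GG * 2^-1 *
   (eta (rv t) * 2 * dirichlet w (ginv g i) (f \o param i) (rv t))))).
  apply: le_Rintegral => //.
  - by apply: KI; exact: (bK cI).
  - by apply: KI; apply: bmeasM; [exact: bmeas_cst|exact: (bK cI2)].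
  - move=> t Kt; have Ot := boxO Kt.
    rewrite (_ : W * GG * 2^-1 * _ = eta (rv t) * (W * (GG * dirichlet w (ginv g i) (f \o param i) (rv t)))); last by field.
    rewrite ler_wpM2l//; first by rewrite /eta -expr2 sqr_ge0.
    have h := dirichlet_ge g (f \o param i) a Ot.
    have h2 := le_trans h (ler_wpM2r (dir_ge0 (f \o param i) Ot) (GGa a t Kt)).
    apply: le_trans (ler_wpM2l (ltW W0) h2).
    by rewrite mulrA -[X in X <= _]mul1r ler_wpM2r ?sqr_ge0// Ww.
rewrite RintegralZl//; last by apply: KI; exact: (bK cI2).
rewrite -/D.
have N0 : 0 <= N2 f by apply: Rintegral_ge0 => p _; exact: sqr_ge0.
have S0 := sqrtr_ge0 (N2 f * N2 L).
have WG0 : 0 <= W * GG by rewrite mulr_ge0// ltW.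
rewrite -[leLHS]mulrA -[leRHS]mulrA ler_wpM2l//.
move: D_le S0 N0 C0 (normr_ge0 B); set S := Num.sqrt _; set n := N2 f; set b := `|B|.
nra.
Qed.

(** This is [box_nash] with [2 ^+ q] subcubes along each axis, the gradient term being bounded by
    [energy_box]; Lebesgue norms are compared with those of [vol] by bounds on the density from both
    sides. *)
Lemma nash_box : exists2 C, 0 <= C & forall f L q, laplacian_pair f L ->
  \int[vol]_(p in [set p | chart_dom i p /\ forall j, `|chart i p ord0 j - c ord0 j| < rho])
     (f p ^+ 2) <=
  C * ((2 ^+ q) ^+ d * (\int[vol]_p `|f p|) ^+ 2 +
       (2 ^+ q) ^- 2 * (Num.sqrt (N2 f * N2 L) + N2 f)).
Proof.
have [E E0 EP] := energy_box.
have [W W0 Ww] := winv_bound.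
have [_ [W1 W1w]] := bK cw.
pose l : R := 2 * rho; have l0 : 0 < l by rewrite mulr_gt0.
exists (`|W1| * 2 ^+ d * (l ^- d * W ^+ 2 + l ^+ 2 * (d%:R * E))).
  by rewrite !mulr_ge0 ?addr_ge0 ?mulr_ge0 ?invr_ge0 ?exprn_ge0// ltW.
move=> f L q fL; have [C2f bf bL _] := fL.
set U := [set p | _]; pose H := hbox (fun j => c ord0 j - rho) l.
have hK : H `<=` K.
  move=> t ht j; have := ht j; rewrite /l /= !in_itv/= /lo /hi => /andP[h1 h2].
  by apply/andP; split; move: h1 h2 rho0; lra.
have mH : measurable H by exact: measurable_hbox.
have Hoo : (lam H < +oo)%E by exact: hbox_fin.
have UH : U `<=` chart_set i H.
  move=> p [dp pc]; split => // j; rewrite tnth_mktuple /l /= in_itv/=.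
  by have := pc j; rewrite ltr_distl => /andP[h1 h2]; apply/andP; split; lra.
have oU : measurable (U : set (borel M)).
  rewrite (_ : U = chart_set i (pbox (fun j => `]c ord0 j - rho, c ord0 j + rho[%classic))).
    by apply: measurable_chart_set; apply: measurable_pbox => j; exact: measurable_itv.
  apply/seteqP; split=> p [dp pc]; split=> // j.
    by rewrite tnth_mktuple /= in_itv/= -ltr_distl.
  by have := pc j; rewrite tnth_mktuple /= in_itv/= -ltr_distl.
have mVH : measurable (chart_set i H) by exact: measurable_chart_set.
have cF u : O u -> {for u, continuous (f \o param i)}.
  by move=> Ou; exact: C1_cont (C2_C1 (C2f i)) _ Ou.
have cF2 u : O u -> {for u, continuous (fun u => (f \o param i) u ^+ 2)}.
  by move=> Ou; apply: continuousM; exact: cF.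
have bF2 : bmeas H (fun t => f (param i (rv t)) ^+ 2) by apply: bmeasS hK (bK cF2).
have bF1 : bmeas H (fun t => `|f (param i (rv t))|).
  by apply: bmeas_norm; apply: bmeasS hK (bK cF).
have bw : bmeas H (fun t => w (rv t)) by apply: bmeasS hK (bK cw).
have HI (h : d.-tuple MR -> R) : bmeas H h -> lam.-integrable H (EFin \o h).
  by move=> bh; exact: bmeas_integrable.
have le1 : \int[vol]_(p in U) (f p ^+ 2) <= `|W1| * \int[lam]_(t in H) (f (param i (rv t)) ^+ 2).
  apply: (@le_trans _ _ (\int[vol]_(p in chart_set i H) (f p ^+ 2))).
    apply: Rintegral_subset => //; [exact: vol_fin| |by move=> p _; exact: sqr_ge0].
    by apply: bmeasS (bmeasX 2 bf).
  rewrite (chart_Rintegral vol_riemannian boxO mH hK); last by apply: bmeasS (bmeasX 2 bf).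
  rewrite -RintegralZl//; last exact: HI.
  apply: le_Rintegral => //.
  - by apply: HI; exact: bmeasM.
  - by apply: HI; apply: bmeasM; [exact: bmeas_cst|].
  - move=> t /hK Kt; rewrite mulrC ler_wpM2r ?sqr_ge0//.
    by rewrite (le_trans (ler_norm _))// (le_trans (W1w t Kt))// ler_norm.
have le2 : \int[lam]_(t in H) `|f (param i (rv t))| <= W * \int[vol]_p `|f p|.
  apply: (@le_trans _ _ (\int[lam]_(t in H) (W * (`|f (param i (rv t))| * w (rv t))))).
    apply: le_Rintegral => //.
    - exact: HI.
    - by apply: HI; apply: bmeasM; [exact: bmeas_cst|exact: bmeasM].
    - by move=> t /hK Kt; rewrite mulrCA -[X in X <= _]mulr1 ler_wpM2l// Ww.
  rewrite RintegralZl//; last by apply: HI; exact: bmeasM.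
  rewrite ler_wpM2l ?(ltW W0)//.
  rewrite -(chart_Rintegral vol_riemannian boxO mH hK (f := fun p => `|f p|)); last first.
    by apply: bmeasS (bmeas_norm bf).
  by apply: Rintegral_subset => //; [exact: vol_fin|exact: bmeas_norm].
have q0 : (0 < 2 ^ q)%N by rewrite expn_gt0.
(* [box_nash] counts the subdivisions as [N.+1], hence [N = 2 ^ q - 1]. *)
have qE : (2 ^ q)%N = (2 ^ q).-1.+1 by rewrite prednK.
have := @box_nash R d O oO (f \o param i) (fun j => c ord0 j - rho) l (l / 2 ^+ q) (2 ^ q).-1 l0.
rewrite -qE natrX => /(_ erefl (C2_C1 (C2f i))) nash.
have {nash} : \int[lam]_(t in H) ((f \o param i) (rv t) ^+ 2) <=
  2 ^+ d * ((l / 2 ^+ q) ^- d * (\int[lam]_(t in H) `|(f \o param i) (rv t)|) ^+ 2 +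
  (l / 2 ^+ q) ^+ 2 * \sum_a \int[lam]_(t in H) ('D_(e_ a) (f \o param i) (rv t) ^+ 2)).
  apply: nash => t tK; apply: boxO => j; have := tK j.
  rewrite /l /lo /hi /= !in_itv/= => /andP[h1 h2].
  by apply/andP; split; move: h1 h2 rho0; lra.
move: le1; set I2 := \int[lam]_(t in H) _; move=> le1 nash.
apply: le_trans le1 _; rewrite -[leRHS]mulrA -[leRHS]mulrA ler_wpM2l//.
apply: le_trans nash _; rewrite ler_wpM2l ?exprn_ge0//.
set S := Num.sqrt _ + _.
have S0 : 0 <= S by rewrite addr_ge0 ?sqrtr_ge0//; apply: Rintegral_ge0 => p _; exact: sqr_ge0.
have sumE : \sum_a \int[lam]_(t in H) ('D_(e_ a) (f \o param i) (rv t) ^+ 2) <= d%:R * E * S.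
  apply: (@le_trans _ _ (\sum_(a < d) E * S)); first by apply: ler_sum => a _; exact: EP.
  by rewrite sumr_const card_ord -[leRHS]mulrA mulr_natl.
set N1 := \int[vol]_p _ in le2 *.
have N10 : 0 <= N1 by apply: Rintegral_ge0 => p _.
have lq : 0 < l / 2 ^+ q by rewrite divr_gt0.
have ld : 0 <= l ^- d by rewrite invr_ge0 exprn_ge0// ltW.
(* The single constant is the sum of the two that occur, so the product contains both wanted terms
   and two nonnegative cross terms, which are dropped. *)
have -> : (l ^- d * W ^+ 2 + l ^+ 2 * (d%:R * E)) * ((2 ^+ q) ^+ d * N1 ^+ 2 + (2 ^+ q) ^- 2 * S) =
  ((l ^- d * (2 ^+ q) ^+ d) * (W * N1) ^+ 2 + (l ^+ 2 * (2 ^+ q) ^- 2) * (d%:R * E * S)) +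
  (l ^- d * W ^+ 2 * ((2 ^+ q) ^- 2 * S) + l ^+ 2 * (d%:R * E) * ((2 ^+ q) ^+ d * N1 ^+ 2)).
  by rewrite exprMn; ring.
rewrite -[leLHS]addr0; apply: lerD; last first.
  by rewrite addr_ge0// !mulr_ge0 ?invr_ge0 ?sqr_ge0 ?exprn_ge0// ltW.
apply: lerD.
  rewrite expr_div_n invf_div [_ / l ^+ d]mulrC ler_wpM2l//.
    by rewrite mulr_ge0// exprn_ge0.
  by rewrite lerXn2r// nnegrE// ?mulr_ge0 ?(ltW W0)// Rintegral_ge0.
by rewrite expr_div_n ler_wpM2l// mulr_ge0 ?invr_ge0 ?sqr_ge0.
Qed.

Lemma vol_box_gt0 : (0 < vol V)%E.
Proof.
have lamK : (0 < lam K)%E.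
  have -> : lam K = (\prod_(j < d) lebesgue_measure (`[lo j, hi j]%classic : set MR))%E.
    by apply: measure_power_box => j; exact: measurable_itv.
  elim/big_ind : _ => //= [x y|j _]; first exact: mule_gt0.
  rewrite lebesgue_measure_itv/= lte_fin.
  have h : lo j < hi j by rewrite /lo /hi; have := rho0; lra.
  by rewrite h -EFinD lte_fin subr_gt0.
have [W W0 Ww] := winv_bound.
have volV : vol V \is a fin_num by exact: fin_num_measure.
rewrite -(fineK volV) lte_fin.
have -> : fine (vol V) = \int[vol]_(p in V) 1.
  by rewrite Rintegral_cst ?mul1r//; exact: vol_fin.
rewrite (Kchart (bmeas_cst setT 1)).
apply: (@lt_le_trans _ _ (\int[lam]_(t in K) W^-1)).
  rewrite Rintegral_cst// mulr_gt0 ?invr_gt0// fine_gt0// lamK/=.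
  exact: Koo.
apply: le_Rintegral => //.
- by apply: KI; exact: bmeas_cst.
- by apply: KI; apply: bmeasM; [exact: bmeas_cst|exact: (bK cw)].
- by move=> t Kt; rewrite mul1r -[W^-1]mulr1 ler_pdivrMl// Ww.
Qed.

End chart_box.

(** [B] will be all of [M] in the local estimates, and an arbitrary open set in the proof that open
    sets have positive volume. *)
Lemma chart_box_exists (B : set M) p0 : open B -> B p0 -> exists (i : chart_index A) (c : 'rV[R]_d) rho, [/\ 0 < rho,
  forall t, cbox (fun j => c ord0 j - 2 * rho) (fun j => c ord0 j + 2 * rho) t ->
     chart_cod i (rv t) /\ B (param i (rv t)),
  chart_dom i p0 & c = chart i p0].
Proof.
move=> oB Bp; have [i dp] := chart_dom_cover A p0; have Oc := cod_chart dp.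
have oO : open (chart_cod i) by exact: open_cod.
have nB : nbhs (chart i p0) (param i @^-1` B).
  by apply: (param_continuous Oc); rewrite chartK//; exact: open_nbhs_nbhs.
have [e /= e0 eO] := (nbhs_ballP _ _).1 (filterI (open_nbhs_nbhs (conj oO Oc)) nB).
(* The box has half-side [2 rho = 2 e / 3], less than the radius [e] of the ball. *)
exists i, (chart i p0), (e / 3); split => //; first by rewrite divr_gt0.
move=> t tb; apply: eO; split=> // r' j; rewrite ord1 mxE.
have := tb j; rewrite /= in_itv/= -ler_distl distrC => h.
by rewrite /ball/= (le_lt_trans h)//; lra.
Qed.

Lemma open_chart_box (i : chart_index A) (c : 'rV[R]_d) rho :
  open [set p : M | chart_dom i p /\ forall j, `|chart i p ord0 j - c ord0 j| < rho].
Proof.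
rewrite openE => p [dp pc]; apply: filterI.
  by apply: open_nbhs_nbhs; split => //; exact: chart_dom_open.
apply: filter_forall => j.
have cj : {for p, continuous (fun q => chart i q ord0 j)}.
  apply: (@continuous_comp _ _ _ (chart i) (fun u : 'rV[R]_d => u ord0 j)).
    exact: chart_continuous.
  exact: coord_continuous.
have cn : {for p, continuous (fun q => `|chart i q ord0 j - c ord0 j|)}.
  apply: continuous_comp; last exact: norm_continuous.
  by apply: continuousB => //; exact: cst_continuous.
exact: (cn _ (open_nbhs_nbhs (conj (@open_lt R rho) (pc j)))).
Qed.

Lemma local_nash p0 : exists U : set M, [/\ open U, U p0 &
  exists2 C, 0 <= C & forall f L q, laplacian_pair f L ->
  \int[vol]_(p in U) (f p ^+ 2) <=
  C * ((2 ^+ q) ^+ d * (\int[vol]_p `|f p|) ^+ 2 +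
       (2 ^+ q) ^- 2 * (Num.sqrt ((\int[vol]_p (f p ^+ 2)) * (\int[vol]_p (L p ^+ 2))) +
          \int[vol]_p (f p ^+ 2)))].
Proof.
have [i [c [rho [rho0 boxOB dp cE]]]] := chart_box_exists openT (I : setT p0).
have boxO t tb := (boxOB t tb).1.
exists [set p | chart_dom i p /\ forall j, `|chart i p ord0 j - c ord0 j| < rho]; split.
- exact: open_chart_box.
- by split => // j; rewrite cE subrr normr0.
- exact: nash_box.
Qed.

Lemma local_contraction p0 : exists (U : set M) (e : borel M -> R) (C : R), [/\ open U, U p0,
    bmeas setT e, 0 <= C &
  [/\ forall p, 0 <= e p, forall p, U p -> 1 <= e p &
  forall f L (psi psi1 psi2 : R -> R), laplacian_pair f L ->
  (forall s : R, is_derive s 1 psi (psi1 s)) ->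
  (forall s : R, is_derive s 1 psi1 (psi2 s)) -> continuous psi2 ->
  (forall s, 0 <= psi s) -> (forall s, 0 <= psi2 s) ->
  - (C * \int[vol]_p psi (f p)) <= \int[vol]_p (e p * (psi1 (f p) * L p))]].
Proof.
have [i [c [rho [rho0 boxOB dp cE]]]] := chart_box_exists openT (I : setT p0).
have boxO t tb := (boxOB t tb).1.
have [e [C [be C0 e0 e1 H]]] := contraction_box rho0 boxO.
exists [set p | chart_dom i p /\ forall j, `|chart i p ord0 j - c ord0 j| < rho], e, C; split => //.
- exact: open_chart_box.
- by split => // j; rewrite cE subrr normr0.
- by split => // p [dp' pc]; apply: e1 => // j; rewrite ltW.
Qed.

(** Serves twice: to divide by the volume of a superlevel set in the Weyl bound, and to show that
    continuous functions equal almost everywhere are equal. *)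
Lemma vol_open_gt0 (B : set M) p0 : open B -> B p0 -> (0 < vol B)%E.
Proof.
move=> oB Bp; have [i [c [rho [rho0 boxOB dp cE]]]] := chart_box_exists oB Bp.
apply: lt_le_trans (vol_box_gt0 rho0 (fun t tb => (boxOB t tb).1)) _.
apply: le_measure; rewrite ?inE.
- by apply: measurable_chart_set; exact: measurable_cbox.
- exact: sub_sigma_algebra.
- by move=> p [dp' Kp]; have [_] := boxOB _ Kp; rewrite tuple_of_rVK chartK.
Qed.

End local_estimates.

(** * Square integrable functions *)

Section L2_space.
Context {disp} {T : measurableType disp} {R : realType}.
Variable nu : {measure set T -> \bar R}.
Implicit Types f g h : T -> R.

Let intsq f : (\int[nu]_x (`|(f x)%:E| `^ 2))%E = (\int[nu]_x (f x ^+ 2)%:E)%E.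
Proof.
apply: eq_integral => x _; rewrite abse_EFin poweR_EFin powR_mulrn//.
by rewrite real_normK ?num_real.
Qed.

Lemma L2P f : L2 nu f <->
  measurable_fun setT f /\ (\int[nu]_x (f x ^+ 2)%:E < +oo)%E.
Proof.
have E : ('N[nu]_2%:E [EFin \o f] < +oo)%E = (\int[nu]_x (f x ^+ 2)%:E < +oo)%E.
  rewrite -intsq -poweR_Lnorm//; apply/idP/idP => [h|]; first exact: poweR_lty.
  by case: ('N[nu]_2[_])%E => [r _||]; rewrite ?ltry//= pnatr_eq0.
split=> [/andP[/set_mem mf /set_mem]|[mf foo]].
  by rewrite /= /finite_norm E.
by apply/andP; split; apply/mem_set => //=; rewrite /finite_norm E.
Qed.

Lemma L2_measurable f : L2 nu f -> measurable_fun setT f.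
Proof. by move=> /L2P[]. Qed.
Hint Resolve L2_measurable : core.

Lemma sqr_integrableP f : measurable_fun setT f ->
  (\int[nu]_x (f x ^+ 2)%:E < +oo)%E ->
  nu.-integrable setT (EFin \o (fun x => f x ^+ 2)).
Proof.
move=> mf foo; apply/integrableP; split.
  by apply/measurable_EFinP; exact: measurable_funX.
by under eq_integral do rewrite /= ger0_norm ?sqr_ge0//.
Qed.

Lemma L2_sqr_integrable f : L2 nu f -> nu.-integrable setT (EFin \o (fun x => f x ^+ 2)).
Proof. by move=> /L2P[mf]; exact: sqr_integrableP. Qed.

Lemma L2_integrable_sqr f : measurable_fun setT f ->
  nu.-integrable setT (EFin \o (fun x => f x ^+ 2)) -> L2 nu f.
Proof.
move=> mf /integrableP[_ h]; apply/L2P; split => //.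
by move: h; under eq_integral do rewrite /= ger0_norm ?sqr_ge0//.
Qed.

Lemma L2M_integrable f g : L2 nu f -> L2 nu g ->
  nu.-integrable setT (EFin \o (fun x => f x * g x)).
Proof.
move=> Lf Lg.
have := integrableD measurableT (L2_sqr_integrable Lf) (L2_sqr_integrable Lg).
apply: le_integrable => //.
  by apply/measurable_EFinP; apply: measurable_funM; exact: L2_measurable.
move=> x _ /=; rewrite lee_fin [leRHS]ger0_norm ?addr_ge0 ?sqr_ge0// normrM.
rewrite -[f x ^+ 2]real_normK ?num_real// -[g x ^+ 2]real_normK ?num_real//.
have := normr_ge0 (f x); have := normr_ge0 (g x); have := sqr_ge0 (`|f x| - `|g x|).
nra.
Qed.

Lemma L2D f g : L2 nu f -> L2 nu g -> L2 nu (fun x => f x + g x).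
Proof.
move=> Lf Lg; apply: L2_integrable_sqr.
  by apply: measurable_funD; exact: L2_measurable.
have := integrableD measurableT (integrableD measurableT (L2_sqr_integrable Lf) (L2_sqr_integrable Lg))
  (integrableZl measurableT 2 (L2M_integrable Lf Lg)).
apply: eq_integrable => // x _ /=; rewrite -EFinM -!EFinD; congr EFin.
ring.
Qed.

Lemma L2Z c f : L2 nu f -> L2 nu (fun x => c * f x).
Proof.
move=> Lf; apply: L2_integrable_sqr.
  by apply: measurable_funM => //; exact: L2_measurable.
have := integrableZl measurableT (c ^+ 2) (L2_sqr_integrable Lf).
by apply: eq_integrable => // x _ /=; rewrite exprMn EFinM.
Qed.

Lemma L2N f : L2 nu f -> L2 nu (fun x => - f x).
Proof. by move=> /(L2Z (-1)); under eq_fun do rewrite mulN1r. Qed.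

Lemma L2B f g : L2 nu f -> L2 nu g -> L2 nu (fun x => f x - g x).
Proof. by move=> Lf Lg; apply: L2D => //; exact: L2N. Qed.

Lemma L2_cst0 : L2 nu (fun=> 0).
Proof.
apply/L2P; split => //; under eq_integral do rewrite expr0n.
by rewrite integral0 ltry.
Qed.

Lemma L2_sum (I : Type) (s : seq I) (P : pred I) (f : I -> T -> R) :
  (forall i, P i -> L2 nu (f i)) -> L2 nu (fun x => \sum_(i <- s | P i) f i x).
Proof.
move=> Lf; elim: s => [|i s IH].
  by under eq_fun do rewrite big_nil; exact: L2_cst0.
under eq_fun do rewrite big_cons.
case Pi : (P i) => //; apply: L2D => //; exact: Lf.
Qed.

Lemma L2norm_ge0 f : 0 <= L2norm nu f.
Proof. by apply: fine_ge0; exact: Lnorm_ge0. Qed.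

Lemma L2norm_sqr f : measurable_fun setT f -> L2norm nu f ^+ 2 = \int[nu]_x (f x ^+ 2).
Proof.
move=> mf; rewrite /Rintegral -intsq -poweR_Lnorm// /L2norm.
have := Lnorm_ge0 nu 2%:E (EFin \o f).
case: ('N[nu]_2%:E[EFin \o f])%E => //= [r r0|_].
  by rewrite powR_mulrn.
by rewrite expr0n pnatr_eq0.
Qed.

Lemma L2norm_sqrt f : measurable_fun setT f -> L2norm nu f = Num.sqrt (\int[nu]_x (f x ^+ 2)).
Proof. by move=> mf; rewrite -L2norm_sqr// sqrtr_sqr ger0_norm// L2norm_ge0. Qed.

Lemma L2norm_sqrE f : measurable_fun setT f -> L2norm nu f ^+ 2 = L2dot nu f f.
Proof. by move=> mf; rewrite L2norm_sqr. Qed.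

Lemma L2dotC f g : L2dot nu f g = L2dot nu g f.
Proof. by apply: eq_Rintegral => x _; rewrite mulrC. Qed.

Lemma L2dotDl f g h : L2 nu f -> L2 nu g -> L2 nu h ->
  L2dot nu (fun x => f x + g x) h = L2dot nu f h + L2dot nu g h.
Proof.
move=> Lf Lg Lh; rewrite /L2dot -RintegralD//; [|exact: L2M_integrable..].
by apply: eq_Rintegral => x _; rewrite mulrDl.
Qed.

Lemma L2dotZl c f h : L2 nu f -> L2 nu h ->
  L2dot nu (fun x => c * f x) h = c * L2dot nu f h.
Proof.
move=> Lf Lh; rewrite /L2dot -RintegralZl//; last exact: L2M_integrable.
by apply: eq_Rintegral => x _; rewrite mulrA.
Qed.

Lemma L2dot_suml (I : Type) (s : seq I) (P : pred I) (f : I -> T -> R) h :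
  (forall i, P i -> L2 nu (f i)) -> L2 nu h ->
  L2dot nu (fun x => \sum_(i <- s | P i) f i x) h = \sum_(i <- s | P i) L2dot nu (f i) h.
Proof.
move=> Lf Lh; elim: s => [|i s IH].
  rewrite big_nil /L2dot; under eq_Rintegral do rewrite big_nil mul0r.
  by rewrite /Rintegral integral0.
rewrite big_cons -IH; case: ifPn => [Pi|nPi].
  rewrite -L2dotDl//; [|exact: Lf|exact: L2_sum].
  by apply: eq_Rintegral => x _; rewrite big_cons Pi.
by apply: eq_Rintegral => x _; rewrite big_cons (negbTE nPi).
Qed.

Lemma L2_CS f g : L2 nu f -> L2 nu g -> `|L2dot nu f g| <= L2norm nu f * L2norm nu g.
Proof.
move=> Lf Lg; have := Rintegral_CS measurableT (L2_sqr_integrable Lf)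
  (L2_sqr_integrable Lg) (L2M_integrable Lf Lg).
rewrite -!L2norm_sqr; [|exact: L2_measurable..].
rewrite -exprMn -[X in X <= _]real_normK ?num_real//.
by rewrite ler_pXn2r// nnegrE// mulr_ge0 ?L2norm_ge0.
Qed.

Lemma L2normN f : L2norm nu (fun x => - f x) = L2norm nu f.
Proof.
by rewrite /L2norm -(oppe_Lnorm nu (EFin \o f)); congr (fine _).
Qed.

Lemma L2norm_triangle f g : L2 nu f -> L2 nu g ->
  L2norm nu (fun x => f x + g x) <= L2norm nu f + L2norm nu g.
Proof.
move=> Lf Lg; have Lfg := L2D Lf Lg.
rewrite -(@ler_pXn2r _ 2)// ?nnegrE ?addr_ge0 ?L2norm_ge0//.
rewrite L2norm_sqrE; last exact: L2_measurable.
rewrite L2dotDl// (L2dotC f) (L2dotC g) !L2dotDl//.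
rewrite -!L2norm_sqrE; [|exact: L2_measurable..].
rewrite (L2dotC g).
have := le_trans (ler_norm _) (L2_CS Lf Lg).
by rewrite sqrrD mulr2n; lra.
Qed.

Lemma L2norm_triangleB f g h : L2 nu f -> L2 nu g -> L2 nu h ->
  L2norm nu (fun x => f x - h x) <= L2norm nu (fun x => f x - g x) + L2norm nu (fun x => g x - h x).
Proof.
move=> Lf Lg Lh; have := L2norm_triangle (L2B Lf Lg) (L2B Lg Lh).
by under eq_fun do rewrite addrA subrK.
Qed.

Lemma L2normB f g : L2norm nu (fun x => f x - g x) = L2norm nu (fun x => g x - f x).
Proof. by rewrite -L2normN; under eq_fun do rewrite opprB. Qed.

Lemma L2norm_dist f g : L2 nu f -> L2 nu g ->
  `|L2norm nu f - L2norm nu g| <= L2norm nu (fun x => f x - g x).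
Proof.
move=> Lf Lg; rewrite ler_norml; apply/andP; split.
  have := L2norm_triangle (L2B Lg Lf) Lf; rewrite L2normB.
  under eq_fun do rewrite subrK.
  lra.
have := L2norm_triangle (L2B Lf Lg) Lg; under eq_fun do rewrite subrK.
lra.
Qed.

Lemma L2cvg_norm (F : nat -> T -> R) f : (forall n, L2 nu (F n)) -> L2 nu f ->
  L2cvg nu F f -> (fun n => L2norm nu (F n)) @ \oo --> L2norm nu f.
Proof.
move=> LF Lf Ff; apply/subr_cvg0; apply/norm_cvg0P.
apply: (@squeeze_cvgr _ _ _ _ (fun=> 0) (fun n => L2norm nu (F n \- f))) => //.
- by near=> n; rewrite normr_ge0/=; exact: L2norm_dist.
- exact: cvg_cst.
Unshelve. all: by end_near. Qed.

Lemma L2norm0_ae f : L2 nu f -> L2norm nu f = 0 -> f = (fun=> 0) %[ae nu].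
Proof.
move=> /L2P[mf foo] f0.
have mf2 : measurable_fun setT (EFin \o (fun x => f x ^+ 2)).
  by apply/measurable_EFinP; exact: measurable_funX.
have /integrableP[_ h] := sqr_integrableP mf foo.
have : (\int[nu]_x `|((f x ^+ 2)%R)%:E|)%E = 0%E.
  have := L2norm_sqr mf; rewrite f0 expr0n/= /Rintegral.
  under [in X in _ -> X]eq_integral do rewrite /= ger0_norm ?sqr_ge0//.
  move=> e; rewrite -[LHS]fineK -?e//.
  by rewrite ge0_fin_numE//; apply: integral_ge0 => x _; rewrite lee_fin sqr_ge0.
move/(ae_eq_integral_abs nu measurableT mf2); apply: filterS => x /= /(_ I)[/eqP].
by rewrite sqrf_eq0 => /eqP ->.
Qed.

Lemma L2cvg_ae_unique (F : nat -> T -> R) f g : (forall n, L2 nu (F n)) -> L2 nu f -> L2 nu g ->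
  L2cvg nu F f -> L2cvg nu F g -> f = g %[ae nu].
Proof.
move=> LF Lf Lg Ff Fg.
have : L2norm nu (fun x => f x - g x) = 0.
  apply/eqP; rewrite eq_le L2norm_ge0 andbT.
  have h : (fun n => L2norm nu (F n \- f) + L2norm nu (F n \- g)) @ \oo --> (0 : R).
    by rewrite -[X in _ --> X]addr0; exact: cvgD.
  rewrite -(cvg_lim _ h)//; apply: limr_ge; first by apply/cvg_ex; exists 0.
  near=> n; apply: le_trans (L2norm_triangleB Lf (LF n) Lg) _.
  by rewrite [X in X + _]L2normB.
move/(L2norm0_ae (L2B Lf Lg)); apply: filterS => x h xT.
by apply/eqP; rewrite -subr_eq0 h.
Unshelve. all: by end_near. Qed.

Section finite.
Hypothesis nuoo : (nu setT < +oo)%E.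

Lemma bmeas_L2 f : bmeas setT f -> L2 nu f.
Proof.
move=> bf; apply: L2_integrable_sqr; first by case: bf.
by apply: bmeas_integrable => //; exact: bmeasX.
Qed.

Lemma L2_abs f : L2 nu f -> L2 nu (fun x => `|f x|).
Proof.
move=> Lf; apply: L2_integrable_sqr.
  by apply: measurableT_comp => //; exact: L2_measurable.
apply: eq_integrable (L2_sqr_integrable Lf) => // x _ /=.
by rewrite real_normK ?num_real.
Qed.

Lemma L2_integrable f : L2 nu f -> nu.-integrable setT (EFin \o f).
Proof.
move=> Lf; have := L2M_integrable Lf (bmeas_L2 (bmeas_cst setT 1)).
by under [X in _.-integrable _ (EFin \o X)]eq_fun do rewrite mulr1.
Qed.

Lemma L1_le_L2 f : L2 nu f ->
  \int[nu]_x `|f x| <= L2norm nu f * L2norm nu (fun=> 1).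
Proof.
move=> Lf; have := L2_CS (L2_abs Lf) (bmeas_L2 (bmeas_cst setT 1)).
rewrite /L2dot; under eq_Rintegral do rewrite mulr1.
rewrite ger0_norm; last by apply: Rintegral_ge0 => x _.
suff -> : L2norm nu (fun x => `|f x|) = L2norm nu f by [].
by congr fine; rewrite -[RHS]Lnorm_abse.
Qed.

(** The Riesz-Fischer theorem. A subsequence whose increments have L2 norms at most [2^-k] has, the
    measure being finite, absolutely summable increments almost everywhere; Fatou's lemma turns its
    pointwise limit into an L2 limit of the whole sequence. *)
Lemma L2_complete (F : nat -> T -> R) : (forall n, L2 nu (F n)) ->
  (forall e, 0 < e -> exists N, forall n m, (N <= n)%N -> (N <= m)%N ->
     L2norm nu (fun x => F n x - F m x) <= e) ->
  exists2 f, L2 nu f & L2cvg nu F f.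
Proof.
move=> LF cF; have mF n := L2_measurable (LF n).
have /choice[s sP] (k : nat) : exists N, forall n m, (N <= n)%N -> (N <= m)%N ->
  L2norm nu (fun x => F n x - F m x) <= 2^-1 ^+ k by apply: cF; rewrite exprn_gt0.
(* Summing the thresholds gives an index that is at least [s j] for all [j <= k]. *)
pose t k := \sum_(i < k.+1) s i.
have st j k : (j <= k)%N -> (s j <= t k)%N.
  by move=> jk; rewrite /t (bigD1 (Ordinal (jk : (j < k.+1)%N)))//= leq_addr.
pose u x k := F (t k.+1) x - F (t k) x.
pose G x := (\sum_(0 <= k <oo) `|u x k|%:E)%E.
have mu0 k : measurable_fun setT (fun x => `|u x k|).
  by apply: measurableT_comp => //; exact: measurable_funB.
have mG : measurable_fun setT G.
  apply: ge0_emeasurable_sum => // k _; exact/measurable_EFinP.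
have intG : (\int[nu]_x G x < +oo)%E.
  rewrite integral_nneseries//; last by move=> k; exact/measurable_EFinP.
  pose c := L2norm nu (fun=> 1).
  have c0 : 0 <= c by exact: L2norm_ge0.
  have le1 k : (\int[nu]_x `|u x k|%:E <= (c * 2^-1 ^+ k)%:E)%E.
    have Lu : L2 nu (fun x => u x k) by exact: L2B.
    have := L1_le_L2 Lu.
    have iu := L2_integrable (L2_abs Lu).
    rewrite -lee_fin /Rintegral fineK; last exact: integrable_fin_num iu.
    move=> h; apply: le_trans h _; rewrite lee_fin mulrC ler_wpM2l//.
    apply: sP; last exact: st.
    exact: st (leqnSn k).
  apply: (@le_lt_trans _ _ (c * 2)%:E); last exact: ltry.
  apply: lime_le.
    by apply: is_cvg_nneseries => k _ _; apply: integral_ge0 => x _; rewrite lee_fin.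
  apply: nearW => n; apply: (@le_trans _ _ (\sum_(0 <= k < n) (c * 2^-1 ^+ k)%:E)%E).
    by apply: lee_sum => k _; exact: le1.
  rewrite sumEFin lee_fin -mulr_sumr ler_wpM2l//.
  have := @geometric_le_lim R n 1 2^-1 ler01; rewrite invr_gt0 ltr0n => /(_ isT).
  rewrite ger0_norm ?invr_ge0// invf_lt1 ?ltr1n// => /(_ isT).
  rewrite /series/= (_ : 1 / (1 - 2^-1) = 2); last by field.
  by under eq_bigr do rewrite mul1r.
pose E := [set x | (G x < +oo)%E].
have mE : measurable E.
  by rewrite -[E]setTI; exact: emeasurable_fun_infty_o.
have aeE : \forall x \ae nu, E x.
  have : nu.-integrable setT G.
    apply/integrableP; split => //.
    under eq_integral do rewrite gee0_abs ?nneseries_ge0//.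
    exact: intG.
  move=> /(integrable_ae measurableT); apply: filterS => x /(_ I).
  by rewrite ge0_fin_numE// nneseries_ge0.
have cvgE x : E x -> cvgn (fun k => F (t k) x).
  move=> Ex; have : cvgn (series (u x)).
    apply: normed_cvg; apply: nondecreasing_is_cvgn.
      by apply: nondecreasing_series => k _ _; rewrite /= normr_ge0.
    exists (fine (G x)) => _ [n _ <-]; rewrite -lee_fin fineK; last first.
      by rewrite ge0_fin_numE// nneseries_ge0.
    by rewrite /series/= -sumEFin; exact: nneseries_lim_ge.
  move=> cu; have -> : (fun k => F (t k) x) = (fun k => F (t 0%N) x + series (u x) k).
    apply/funext => k; rewrite /series/= /u.
    by rewrite (telescope_sumr (fun k => F (t k) x) (leq0n k)) subrKC.
  by apply: is_cvgD => //; exact: is_cvg_cst.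
(* Set to 0 off [E], the subsequence converges everywhere, which makes its limit measurable. *)
pose H k := (F (t k)) \_ E.
have cvgH x : cvgn (H^~ x).
  have [Ex|nEx] := pselect (E x).
    rewrite (_ : H^~ x = (fun k => F (t k) x)); first exact: cvgE.
    by apply/funext => k; rewrite /H patchE mem_set.
  rewrite (_ : H^~ x = (fun k => 0)); first exact: is_cvg_cst.
  by apply/funext => k; rewrite /H patchE memNset.
pose f x := limn (H^~ x).
have mf : measurable_fun setT f.
  apply: (@measurable_fun_cvg _ _ _ _ H) => [k|x _]; last exact: cvgH.
  by apply/(measurable_restrictT _ mE); exact: measurable_funTS.
have est j n : (s j <= n)%N ->
  (\int[nu]_x ((F n x - f x) ^+ 2)%:E <= ((2^-1 ^+ j) ^+ 2)%:E)%E.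
  move=> sn; pose g k x := ((F n x - F (t k) x) ^+ 2)%:E.
  have mg k : measurable_fun setT (g k).
    by apply/measurable_EFinP; apply: measurable_funX; exact: measurable_funB.
  have := fatou nu measurableT mg (fun k x _ => _).
  move=> /(_ (fun k x => ltac:(by rewrite lee_fin sqr_ge0))) h.
  apply: (@le_trans _ _ (\int[nu]_x limn_einf (g^~ x))%E).
    apply: ae_ge0_le_integral => //.
    - by move=> x _; rewrite lee_fin sqr_ge0.
    - by apply/measurable_EFinP; apply: measurable_funX; exact: measurable_funB.
    - move=> x _; rewrite limn_einf_lim; apply: lime_ge; first exact: is_cvg_einfs.
      by apply: nearW => k; apply: le_ereal_inf_tmp => _ [i _ <-]; rewrite lee_fin sqr_ge0.
    - rewrite (_ : (fun x => _) = (fun x => - limn_esup (fun k => - g k x))%E); last first.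
        apply/funext => x; rewrite -limn_einfN; congr limn_einf.
        by apply/funext => k; rewrite [RHS]oppeK.
      apply: measurableT_comp => //; apply: measurable_fun_limn_esup => k.
      by apply: measurableT_comp.
    apply: filterS aeE => x Ex _.
    have gx : g^~ x @ \oo --> ((F n x - f x) ^+ 2)%:E.
      apply: cvg_EFin; first by apply: nearW.
      have c : (fun k => F n x - F (t k) x) @ \oo --> F n x - f x.
        apply: cvgB; first exact: cvg_cst.
        rewrite /f (_ : H^~ x = (fun k => F (t k) x)); first exact: cvgE.
        by apply/funext => k; rewrite /H patchE mem_set.
      exact: (cvgM c c).
    by rewrite (cvg_limn_einf_sup gx).1.
  apply: le_trans h _; rewrite limn_einf_lim; apply: lime_le; first exact: is_cvg_einfs.
  near=> k; apply: (@le_trans _ _ (\int[nu]_x g k x)%E).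
    by apply: ereal_inf_lbound; exists k => /=.
  have Lk : L2 nu (fun x => F n x - F (t k) x) by exact: L2B.
  have -> : (\int[nu]_x g k x)%E = (L2norm nu (fun x => F n x - F (t k) x) ^+ 2)%:E.
    rewrite L2norm_sqr ?fineK//; last exact: L2_measurable.
    exact: integrable_fin_num (L2_sqr_integrable Lk).
  rewrite lee_fin lerXn2r ?nnegrE ?L2norm_ge0 ?exprn_ge0// sP//.
  by apply: st; near: k; exact: nbhs_infty_ge.
have LB n : (s 0%N <= n)%N -> L2 nu (fun x => F n x - f x).
  move=> sn; apply/L2P; split; first exact: measurable_funB.
  by apply: le_lt_trans (est _ _ sn) _; rewrite ltry.
have Lf : L2 nu f.
  have := L2B (LF (s 0%N)) (LB _ (leqnn _)).
  by under eq_fun do rewrite opprB subrKC.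
exists f => //; apply/cvgrPdist_le => e e0.
have [j je] : exists j, 2^-1 ^+ j <= e.
  have : (fun j => (2^-1 : R) ^+ j) @ \oo --> (0 : R).
    by apply: cvg_expr; rewrite ger0_norm ?invr_ge0// invf_lt1 ?ltr1n.
  move=> /cvgrPdist_le/(_ e e0)[j _ /(_ j (leqnn _))] /=.
  by rewrite sub0r normrN ger0_norm ?exprn_ge0//; exists j.
near=> n; rewrite sub0r normrN ger0_norm ?L2norm_ge0//; apply: le_trans je.
rewrite -(@ler_pXn2r _ 2)// ?nnegrE ?L2norm_ge0 ?exprn_ge0//.
have Ln : L2 nu (F n \- f) by exact: L2B.
rewrite L2norm_sqr//; last exact: L2_measurable.
rewrite -lee_fin fineK; last exact: integrable_fin_num (L2_sqr_integrable Ln).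
by apply: est; near: n; exact: nbhs_infty_ge.
Unshelve. all: by end_near. Qed.

End finite.

End L2_space.

(** * Global estimates *)

Section continuous_compact.
Context {R : realType} {M : ptopologicalType}.
Hypothesis M_compact : compact [set: M].

Lemma continuous_bmeas_compact (f : M -> R) : continuous f -> bmeas [set: borel M] f.
Proof.
move=> cf; split.
  by apply: (@continuous_measurable_borel R M setT) => [|p _]; [exact: openT|exact: cf].
have := continuous_compact (continuous_subspaceT cf) M_compact.
move=> /compact_bounded[B [_ fB]]; exists (B + 1) => p _.
by apply: fB; [rewrite ltrDl|exists p].
Qed.

Lemma compact_cover_seq (U : M -> set M) : (forall p, open (U p)) -> (forall p, U p p) ->
  exists s : seq M, forall p, exists2 q, q \in s & U q p.
Proof.
move=> oU Up; move: M_compact; rewrite compact_cover => /(_ M setT U).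
case=> [p _|p _|D _ sD]; [exact: oU|by exists p|].
by exists (finmap.enum_fset D) => p; have [q qD Uqp] := sD p I; exists q.
Qed.

End continuous_compact.

Section linear_laplacian.
Context {R : realType} {d : nat} {M : ptopologicalType}.
Context {A : smooth_atlas R d M} (g : riemannian_metric A).
Local Notation e_ i := (delta_mx ord0 i : 'rV[R]_d).
Local Notation lpair := (laplacian_pair g).

Lemma divflux_lin (i : chart_index A) (c : R) (F H : 'rV[R]_d -> R) u :
  C2 (chart_cod i) F -> C2 (chart_cod i) H -> chart_cod i u ->
  divflux (vol_density g i) (ginv g i) (fun v => F v + c * H v) u =
  divflux (vol_density g i) (ginv g i) F u + c * divflux (vol_density g i) (ginv g i) H u.
Proof.
move=> CF CH Ou; have oO : open (chart_cod i) by exact: open_cod.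
have C1w : C1 (chart_cod i) (vol_density g i) by exact: C1_density.
have C1g a b : C1 (chart_cod i) (ginv g i a b) by exact: C1_ginv.
rewrite /divflux mulr_sumr -big_split; apply: eq_bigr => a _ /=.
have dF := C1_derive (C1_flux oO C1w C1g a CF) a Ou.
have dH := C1_derive (C1_flux oO C1w C1g a CH) a Ou.
have fluxE v : chart_cod i v -> flux (vol_density g i) (ginv g i) F a v +
    c * flux (vol_density g i) (ginv g i) H a v =
    flux (vol_density g i) (ginv g i) (fun v => F v + c * H v) a v.
  move=> Ov; rewrite /flux mulrCA -mulrDr [c * _]mulr_sumr -big_split; congr (_ * _).
  apply: eq_bigr => b _ /=.
  have [_ ->] : is_derive v (e_ b) (fun v => F v + c * H v) ('D_(e_ b) F v + c * 'D_(e_ b) H v).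
    apply: is_deriveD; first exact: C1_derive (C2_C1 CF) b _ Ov.
    exact: is_deriveZ (C1_derive (C2_C1 CH) b Ov).
  by rewrite mulrDr mulrCA.
have [_ <-] := eq_is_derive_open oO Ou fluxE (is_deriveD dF (is_deriveZ c dH)).
by [].
Qed.

Lemma laplacian_pair_lin (c : R) f L h K : lpair f L -> lpair h K ->
  lpair (fun p => f p + c * h p) (fun p => L p + c * K p).
Proof.
move=> [Cf bf bL lf] [Ch bh bK lh]; split.
- move=> i; have oO : open (chart_cod i) by exact: open_cod.
  by apply: (C2D oO) => //; apply: (C2M oO) => //; exact: C2_cst.
- by apply: bmeasD => //; apply: bmeasM => //; exact: bmeas_cst.
- by apply: bmeasD => //; apply: bmeasM => //; exact: bmeas_cst.
move=> i p dp; have Oc := cod_chart dp.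
have w0 : vol_density g i (chart i p) != 0 by rewrite gt_eqF// density_gt0.
apply: (mulfI w0); apply: oppr_inj; rewrite -laplacianE//.
rewrite [LHS](divflux_lin c (Cf i) (Ch i) Oc) !laplacianE//.
by rewrite (lf i p dp) (lh i p dp); ring.
Qed.

Lemma laplacian_pair0 : lpair (fun=> 0) (fun=> 0).
Proof.
split=> [i|||i p dp].
- by apply: C2_cst; exact: open_cod.
- exact: bmeas_cst.
- exact: bmeas_cst.
rewrite /laplacian [X in _ * X]big1 ?mulr0// => a _.
rewrite (_ : (fun w => _) = cst 0) ?derive_cst//; apply/funext => w.
by rewrite big1 ?mulr0// => b _; rewrite (_ : _ \o _ = cst 0)// derive_cst mulr0.
Qed.

End linear_laplacian.

Section smooth_abs.
Context {R : realType} (e : R).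
Hypothesis e0 : 0 < e.

(* A smooth convex approximation of the absolute value, to be taken as [psi] in
   the contraction estimate. *)
Definition sabs (s : R) := Num.sqrt (s * s + e ^+ 2).
Definition sabs1 (s : R) := s * (sabs s)^-1.
Definition sabs2 (s : R) := e ^+ 2 * (sabs s)^-1 ^+ 3.

Let ee : 0 < e ^+ 2. Proof. exact: exprn_gt0. Qed.
Let arg0 s : 0 < s * s + e ^+ 2.
Proof. by apply: ltr_wpDl => //; rewrite -expr2 sqr_ge0. Qed.

Lemma sabs_sqr s : sabs s ^+ 2 = s * s + e ^+ 2.
Proof. by rewrite sqr_sqrtr// ltW. Qed.

Lemma sabs_gt0 s : 0 < sabs s. Proof. by rewrite sqrtr_gt0. Qed.

Lemma is_derive_sabs (s : R) : is_derive s 1 sabs (sabs1 s).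
Proof.
have d1 : is_derive s 1 (fun s : R => s * s + e ^+ 2) (s + s).
  by apply: is_derive_eq; rewrite ?addr0 ![_ *: 1]mulr1.
have := is_derive_comp d1 (is_derive1_sqrt (arg0 s)).
rewrite (_ : (2 * Num.sqrt _)^-1 * (s + s) = sabs1 s)//.
rewrite /sabs1 -/(sabs s).
by have := sabs_gt0 s; move: (sabs s) => x x0; field; rewrite gt_eqF.
Qed.

Lemma is_derive_sabs1 (s : R) : is_derive s 1 sabs1 (sabs2 s).
Proof.
have x0 := sabs_gt0 s; have x2 := sabs_sqr s.
have xn0 : sabs s != 0 by rewrite gt_eqF.
have := is_deriveM (is_derive_id s (1 : R)) (is_deriveV xn0 (is_derive_sabs s)).
rewrite (_ : _ + _ = sabs2 s)// /sabs2 /sabs1; move: x0 x2 xn0; move: (sabs s) => x x0 x2 xn0.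
have -> : e ^+ 2 = x ^+ 2 - s * s by rewrite x2 addrC addKr.
rewrite -![_ *: _]/(_ * _).
by field.
Qed.

Lemma continuous_sabs : continuous sabs.
Proof.
by move=> s; apply/differentiable_continuous/derivable1_diffP; case: (is_derive_sabs s).
Qed.

Lemma continuous_sabs1 : continuous sabs1.
Proof.
by move=> s; apply/differentiable_continuous/derivable1_diffP; case: (is_derive_sabs1 s).
Qed.

Lemma continuous_sabs2 : continuous sabs2.
Proof.
move=> s.
have c : {for s, continuous (fun s => (sabs s)^-1)}.
  by apply: continuousV; [rewrite gt_eqF// sabs_gt0|exact: continuous_sabs].
have c3 : {for s, continuous (fun s => (sabs s)^-1 ^+ 3)}.
  by apply: (@continuousM _ _ (fun s => (sabs s)^-1)) => //; apply: continuousM.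
exact: (continuousM (@cst_continuous R R (e ^+ 2) s) c3).
Qed.

Lemma sabs2_ge0 s : 0 <= sabs2 s.
Proof. by rewrite mulr_ge0 ?exprn_ge0 ?invr_ge0 ?ltW// sabs_gt0. Qed.

Lemma sabs_le s : sabs s <= `|s| + e.
Proof.
have h1 := ltW (sabs_gt0 s); have h2 : 0 <= `|s| + e by rewrite addr_ge0 ?(ltW e0).
rewrite -(@ler_pXn2r _ 2)// sabs_sqr sqrrD real_normK ?num_real// -expr2.
have : 0 <= `|s| * e *+ 2 by rewrite mulrn_wge0// mulr_ge0// ltW.
by rewrite lerD2r lerDl.
Qed.

Lemma le_sabs s : `|s| <= sabs s.
Proof.
rewrite -(@ler_pXn2r _ 2)// ?nnegrE ?(ltW (sabs_gt0 s))//.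
by rewrite sabs_sqr real_normK ?num_real// -expr2 lerDl ltW.
Qed.

Lemma sabs1_le1 s : `|sabs1 s| <= 1.
Proof.
by rewrite normrM normfV (gtr0_norm (sabs_gt0 s)) ler_pdivrMr ?sabs_gt0// mul1r le_sabs.
Qed.

(** Follows from [(|s| - e) (|s| + e) <= s^2] and [sabs s <= |s| + e]. Thus [sabs1] may replace the
    sign function up to an error [e]. *)
Lemma sabs1_ge s : `|s| - e <= sabs1 s * s.
Proof.
rewrite /sabs1 mulrAC ler_pdivlMr ?sabs_gt0//.
have := sabs_le s; have := sabs_sqr s; have := sabs_gt0 s; have := le_sabs s.
move: (sabs s) => x.
have -> : s * s = `|s| * `|s| by rewrite -!expr2 real_normK ?num_real.
move: (normr_ge0 s); move: `|s| => a a0 h1 h2 h3 h4.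
have [ae|ea] := lerP a e.
  apply: (@le_trans _ _ 0); last by rewrite mulr_ge0.
  by rewrite mulr_le0_ge0 ?subr_le0// ltW.
apply: (@le_trans _ _ ((a - e) * (a + e))).
  by rewrite ler_wpM2l// subr_ge0 ltW.
by rewrite -subr_sqr lerBlDr -expr2 lerDl ltW.
Qed.

End smooth_abs.

(** * Global Nash inequality, L1 contraction and resolvents *)

Section spectral.
Context {R : realType} {d : nat} {M : ptopologicalType}.
Hypothesis M_compact : compact [set: M].
Context {A : smooth_atlas R d M} (g : riemannian_metric A).
Variable vol : {finite_measure set (borel M) -> \bar R}.
Hypothesis vol_riemannian : is_riemannian_volume g vol.
Local Notation lpair := (laplacian_pair g).
Local Notation N1 f := (\int[vol]_p `|f p|).
Local Notation N2 f := (\int[vol]_p (f p ^+ 2)).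

Let voloo : (vol setT < +oo)%E. Proof. exact: vol_fin. Qed.

Let bi (f : borel M -> R) : bmeas setT f -> vol.-integrable setT (EFin \o f).
Proof. by move=> bf; exact: bm_int. Qed.

Let Rint_sum_cover (s : seq M) (U : M -> set M) (f : borel M -> R) :
  (forall p, open (U p)) -> (forall p, exists2 q, q \in s & U q p) ->
  bmeas setT f -> (forall p, 0 <= f p) ->
  \int[vol]_p f p <= \sum_(q <- s) \int[vol]_(p in U q) f p.
Proof.
move=> oU cov bf f0.
have mU q : measurable (U q : set (borel M)) by exact: sub_sigma_algebra.
have bfU q : bmeas setT (f \_ (U q : set (borel M))).
  have [mf [B fB]] := bf; split.
    by apply/(measurable_restrictT _ (mU q)); exact: measurable_funTS.
  exists `|B| => p _; rewrite patchE; case: ifP => _; last by rewrite normr0.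
  by rewrite (le_trans (fB p I))// ler_norm.
under eq_bigr do rewrite Rintegral_mkcond.
rewrite -Rintegral_sum//; last by move=> q; apply: bi.
apply: le_Rintegral => //; [exact: bi|by apply: bi; exact: bmeas_sum|].
move=> p _; have [q qs Uq] := cov p; rewrite (big_rem q qs)/=.
rewrite {1}patchE mem_set// lerDl; apply: sumr_ge0 => q' _.
by rewrite patchE; case: ifP.
Qed.


(** The right-hand sides of the local inequalities involve global norms only, so they add up over a
    finite cover. *)
Lemma nash : exists2 C, 0 <= C & forall f L q, lpair f L ->
  N2 f <= C * ((2 ^+ q) ^+ d * (N1 f) ^+ 2 + (2 ^+ q) ^- 2 * (Num.sqrt (N2 f * N2 L) + N2 f)).
Proof.
have /choice[UC UCP] (p0 : M) : exists UC : set M * R, [/\ open UC.1, UC.1 p0, 0 <= UC.2 &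
    forall f L q, lpair f L -> \int[vol]_(p in UC.1) (f p ^+ 2) <=
    UC.2 * ((2 ^+ q) ^+ d * (N1 f) ^+ 2 + (2 ^+ q) ^- 2 * (Num.sqrt (N2 f * N2 L) + N2 f))].
  by have [U [oU Up [C C0 CP]]] := local_nash vol_riemannian p0; exists (U, C).
have oU p : open (UC p).1 by case: (UCP p).
have [s sU] := compact_cover_seq M_compact oU (fun p => let: And4 _ h _ _ := UCP p in h).
exists (\sum_(p <- s) (UC p).2); first by apply: sumr_ge0 => p _; case: (UCP p).
move=> f L q fL; have [_ bf _ _] := fL.
apply: le_trans (Rint_sum_cover oU sU (bmeasX 2 bf) (fun p => sqr_ge0 _)) _.
by rewrite mulr_suml; apply: ler_sum => p _; have [_ _ _] := UCP p; exact.
Qed.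

(** The local inequalities are linear in the cutoff and concern the same [f], so they add up; at
    each point one of the finitely many nonnegative cutoffs is at least 1. *)
Lemma contraction : exists (e : borel M -> R) (C : R),
  [/\ bmeas setT e, 0 <= C, forall p, 1 <= e p &
  forall f L (psi psi1 psi2 : R -> R), lpair f L ->
  (forall s : R, is_derive s 1 psi (psi1 s)) ->
  (forall s : R, is_derive s 1 psi1 (psi2 s)) -> continuous psi2 ->
  (forall s, 0 <= psi s) -> (forall s, 0 <= psi2 s) ->
  - (C * \int[vol]_p psi (f p)) <= \int[vol]_p (e p * (psi1 (f p) * L p))].
Proof.
have /choice[D DP] (p0 : M) : exists D : set M * (borel M -> R) * R,
    [/\ open D.1.1, D.1.1 p0, bmeas setT D.1.2, 0 <= D.2 &
  [/\ forall p, 0 <= D.1.2 p, forall p, D.1.1 p -> 1 <= D.1.2 p &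
  forall f L (psi psi1 psi2 : R -> R), lpair f L ->
  (forall s : R, is_derive s 1 psi (psi1 s)) ->
  (forall s : R, is_derive s 1 psi1 (psi2 s)) -> continuous psi2 ->
  (forall s, 0 <= psi s) -> (forall s, 0 <= psi2 s) ->
  - (D.2 * \int[vol]_p psi (f p)) <= \int[vol]_p (D.1.2 p * (psi1 (f p) * L p))]].
  by have [U [e [C H]]] := local_contraction vol_riemannian p0; exists (U, e, C).
have oU p : open (D p).1.1 by case: (DP p).
have [s sU] := compact_cover_seq M_compact oU (fun p => let: And5 _ h _ _ _ := DP p in h).
exists (fun q => \sum_(p <- s) (D p).1.2 q), (\sum_(p <- s) (D p).2); split.
- by apply: bmeas_sum => p; case: (DP p).
- by apply: sumr_ge0 => p _; case: (DP p).
- move=> p; have [q qs Uq] := sU p; rewrite (big_rem q qs)/= -[1]addr0.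
  have [_ _ _ _ [_ h _]] := DP q; apply: lerD; first exact: h.
  by apply: sumr_ge0 => q' _; case: (DP q') => _ _ _ _ [].
move=> f L psi psi1 psi2 fL dpsi dpsi1 cpsi2 psi0 psi20; have [_ bf bL _] := fL.
have cpsi1 : continuous psi1.
  by move=> t; apply/differentiable_continuous/derivable1_diffP; case: (dpsi1 t).
have b1 : bmeas setT (fun p => psi1 (f p) * L p).
  apply: bmeasM => //; have [mf [B fB]] := bf; split.
    by apply: measurableT_comp => //; exact: continuous_measurable_fun.
  have [_ [B' hB']] := continuous_bmeas_itv (a := - B) (b := B) (fun s _ => cpsi1 s).
  by exists B' => p _; apply: hB'; rewrite /= in_itv/= -ler_norml fB.
have -> : \int[vol]_p ((\sum_(p0 <- s) (D p0).1.2 p) * (psi1 (f p) * L p)) =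
   \sum_(p0 <- s) \int[vol]_p ((D p0).1.2 p * (psi1 (f p) * L p)).
  rewrite -Rintegral_sum//; last by move=> q; apply: bi; apply: bmeasM => //; case: (DP q).
  by apply: eq_Rintegral => p _; rewrite mulr_suml.
rewrite mulr_suml -sumrN; apply: ler_sum => p _.
by case: (DP p) => _ _ _ _ [_ _ h]; exact: h fL dpsi dpsi1 cpsi2 psi0 psi20.
Qed.

Lemma bmeas_continuous (f : borel M -> R) (psi : R -> R) : bmeas setT f -> continuous psi ->
  bmeas setT (fun p => psi (f p)).
Proof.
move=> [mf [B fB]] cpsi; split.
  by apply: measurableT_comp => //; exact: continuous_measurable_fun.
have [_ [B' hB']] := continuous_bmeas_itv (a := - B) (b := B) (fun s _ => cpsi s).
by exists B' => p _; apply: hB'; rewrite /= in_itv/= -ler_norml fB.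
Qed.

(** [f + s L] is tested against [e] times a smooth sign of [f]: the part in [f] gives almost the
    weighted norm, and the part in [L] is at least about [- C] times the L1 norm of [f], which is at
    most the weighted norm because [1 <= e]. *)
Lemma weighted_contraction : exists (e : borel M -> R) (C : R),
  [/\ bmeas setT e, 0 <= C, forall p, 1 <= e p &
  forall f L s, lpair f L -> 0 <= s ->
  (1 - C * s) * \int[vol]_p (e p * `|f p|) <= \int[vol]_p (e p * `|f p + s * L p|)].
Proof.
have [e [C [be C0 e1 H]]] := contraction; exists e, C; split => // f L s fL s0.
have [_ bf bL _] := fL.
have e0 p : 0 <= e p by rewrite (le_trans _ (e1 p)).
have baf := bmeas_norm bf.
set Nf := \int[vol]_p (e p * `|f p|).
have le1 : N1 f <= Nf.
  apply: le_Rintegral => //; [exact: bi|by apply: bi; exact: bmeasM|].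
  by move=> p _; rewrite -[X in X <= _]mul1r ler_wpM2r.
pose E := \int[vol]_p e p; have E0 : 0 <= E by apply: Rintegral_ge0.
pose V := fine (vol setT); have V0 : 0 <= V by rewrite fine_ge0.
have bfL : bmeas setT (fun p => f p + s * L p).
  by apply: bmeasD => //; apply: bmeasM => //; exact: bmeas_cst.
(* The inequality for the smooth sign at scale [ep], with errors proportional to [ep], which is sent
   to 0 at the end. *)
have key ep : 0 < ep -> Nf - ep * E - s * (C * (N1 f + ep * V)) <= \int[vol]_p (e p * `|f p + s * L p|).
  move=> ep0.
  have := H f L _ _ _ fL (is_derive_sabs ep0) (is_derive_sabs1 ep0) (continuous_sabs2 ep0)
    (fun t => ltW (sabs_gt0 ep0 t)) (sabs2_ge0 ep0).
  have b0 := bmeas_continuous bf (continuous_sabs ep0).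
  have b1 := bmeas_continuous bf (continuous_sabs1 ep0).
  have -> : ep * V = \int[vol]_p (cst ep p) by rewrite Rintegral_cst.
  rewrite -RintegralD//; [|exact: bi|by apply: bi; exact: bmeas_cst].
  have le2 : \int[vol]_p sabs ep (f p) <= \int[vol]_p (`|f p| + cst ep p).
    apply: le_Rintegral => //; [exact: bi|by apply: bi; apply: bmeasD => //; exact: bmeas_cst|].
    by move=> p _; exact: sabs_le.
  move=> h; have {}h : - (C * \int[vol]_p (`|f p| + cst ep p)) <=
      \int[vol]_p (e p * (sabs1 ep (f p) * L p)).
    by apply: le_trans h; rewrite lerN2 ler_wpM2l.
  have ler1 : Nf - ep * E <= \int[vol]_p (e p * (sabs1 ep (f p) * f p)).
    rewrite /E -RintegralZl//; last exact: bi.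
    rewrite -RintegralB//; [|by apply: bi; exact: bmeasM|by apply: bi; apply: bmeasM => //; exact: bmeas_cst].
    apply: le_Rintegral => //.
    - by apply: bi; apply: bmeasB; apply: bmeasM => //; exact: bmeas_cst.
    - by apply: bi; apply: bmeasM => //; exact: bmeasM.
    - by move=> p _; rewrite [ep * _]mulrC -mulrBr ler_wpM2l// sabs1_ge.
  have : \int[vol]_p (e p * (sabs1 ep (f p) * f p)) + s * \int[vol]_p (e p * (sabs1 ep (f p) * L p)) <=
      \int[vol]_p (e p * `|f p + s * L p|).
    have bsL : bmeas setT (fun p => e p * (sabs1 ep (f p) * L p)).
      by apply: bmeasM => //; exact: bmeasM.
    have bsf : bmeas setT (fun p => e p * (sabs1 ep (f p) * f p)).
      by apply: bmeasM => //; exact: bmeasM.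
    have bssL : bmeas setT (fun p => s * (e p * (sabs1 ep (f p) * L p))).
      by apply: bmeasM => //; exact: bmeas_cst.
    rewrite -RintegralZl//; last exact: bi.
    rewrite -RintegralD//; [|exact: bi|exact: bi].
    apply: le_Rintegral => //.
    - by apply: bi; exact: bmeasD.
    - by apply: bi; apply: bmeasM => //; exact: bmeas_norm.
    - move=> p _; rewrite [s * (_ * _)]mulrCA -mulrDr ler_wpM2l// [s * (_ * _)]mulrCA -mulrDr.
      apply: le_trans (ler_norm _) _; rewrite normrM -[X in _ <= X]mul1r ler_wpM2r//.
      exact: sabs1_le1.
  apply: le_trans; apply: lerD => //.
  by rewrite -mulrN ler_wpM2l.
apply: (@le_trans _ _ (Nf - s * (C * N1 f))).
  rewrite mulrBl mul1r lerB// [C * s]mulrC -mulrA ler_wpM2l// ler_wpM2l//.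
apply/ler_addgt0Pr => dl dl0.
have K0 : 0 < E + s * (C * V) + 1.
  by rewrite ltr_wpDl// addr_ge0// !mulr_ge0.
have := key _ (divr_gt0 dl0 K0); set ep := _ / _.
have : ep * (E + s * (C * V) + 1) = dl by rewrite /ep divfK// gt_eqF.
have ep0 : 0 < ep by rewrite divr_gt0.
move: ep0 (\int[vol]_p (e p * `|f p + s * L p|)) => ep0 Y <-.
have : 0 <= ep * (s * (C * V)).
  by apply: mulr_ge0; [exact: ltW|rewrite !mulr_ge0].
lra.
Qed.


Variables (mu : nat -> R) (phi : nat -> M -> R).
Hypothesis mu_phi : is_eigenbasis g vol mu phi.

Lemma eigenfunction_continuous j : continuous (phi j).
Proof.
move=> p; have [i dp] := chart_dom_cover A p.
have c : {for p, continuous ((phi j \o param i) \o chart i)}.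
  apply: continuous_comp; first exact: chart_continuous.
  exact: C1_cont (C2_C1 (C2_smooth i (eigenfunction_smooth mu_phi j))) _ (cod_chart dp).
move=> V nV; have dn := open_nbhs_nbhs (conj (chart_dom_open i) dp).
have : nbhs p (((phi j \o param i) \o chart i) @^-1` V) by apply: c; rewrite /= chartK.
by apply: filterS2 dn => q dq; rewrite /= chartK.
Qed.

Lemma eigenfunction_bmeas j : bmeas [set: borel M] (phi j).
Proof. by apply: continuous_bmeas_compact => //; exact: eigenfunction_continuous. Qed.

Lemma eigenfunction_L2 j : L2 vol (phi j : borel M -> R).
Proof. by apply: bmeas_L2 => //; exact: eigenfunction_bmeas. Qed.

Definition comb N (b : nat -> R) (p : borel M) := \sum_(j < N) b j * phi j p.

Lemma comb_bmeas N b : bmeas setT (comb N b).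
Proof.
apply: bmeas_sum => j; apply: bmeasM; first exact: bmeas_cst.
exact: eigenfunction_bmeas.
Qed.

Lemma comb_pair N b : lpair (comb N b) (comb N (fun j => b j * mu j ^+ 2)).
Proof.
rewrite /comb; elim: N => [|N IH].
  under eq_fun do rewrite big_ord0; under [X in lpair _ X]eq_fun do rewrite big_ord0.
  exact: laplacian_pair0.
under eq_fun do rewrite big_ord_recr/=.
under [X in lpair _ X]eq_fun do rewrite big_ord_recr/= -mulrA.
apply: laplacian_pair_lin => //; split.
- by move=> i; apply: C2_smooth; exact: (eigenfunction_smooth mu_phi).
- exact: eigenfunction_bmeas.
- by apply: bmeasM; [exact: bmeas_cst|exact: eigenfunction_bmeas].
- by move=> i p dp; exact: (eigenfunction_laplacian mu_phi).
Qed.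

Lemma comb_dot N b h : L2 vol h -> L2dot vol (comb N b) h = \sum_(j < N) b j * L2dot vol (phi j) h.
Proof.
move=> Lh; rewrite L2dot_suml//; last by move=> j _; apply: L2Z; exact: eigenfunction_L2.
by apply: eq_bigr => j _; rewrite L2dotZl//; exact: eigenfunction_L2.
Qed.

Lemma comb_N2 N b : N2 (comb N b) = \sum_(j < N) b j ^+ 2.
Proof.
have Lc : L2 vol (comb N b) by apply: bmeas_L2 => //; exact: comb_bmeas.
have -> : N2 (comb N b) = L2dot vol (comb N b) (comb N b) by [].
rewrite comb_dot//; apply: eq_bigr => j _; rewrite L2dotC comb_dot; last exact: eigenfunction_L2.
rewrite (bigD1 j)//= big1 ?addr0 => [|l lj].
  by rewrite (eigenfunction_orthonormal mu_phi) eqxx mulr1.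
by rewrite (eigenfunction_orthonormal mu_phi) (negbTE (lj : val l != val j)) mulr0.
Qed.

Lemma pow2_large (K : R) : exists q0, forall q, (q0 <= q)%N -> K * (2 ^+ q) ^- 2 <= 1.
Proof.
have [n nK] : exists n : nat, K <= n%:R.
  exists (Num.truncn `|K|).+1; rewrite (le_trans (ler_norm K))// ltW// truncnS_gt//.
exists n => q nq; rewrite ler_pdivrMr ?mul1r ?exprn_gt0//.
apply: le_trans nK _; apply: (@le_trans _ _ (2 ^+ q)).
  rewrite -natrX ler_nat; apply: leq_trans nq (ltnW _); exact: ltn_expl.
by rewrite expr2 ler_peMl ?exprn_ge0// exprn_ege1// ler1n.
Qed.

(** For large [q] the squared L2 norm on the right of [nash] is absorbed in the left-hand side, and
    Young's inequality splits the geometric mean, so that only the L1 norm and the Laplacian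
    remain. *)
Lemma nash_comb : exists2 C, 0 < C & exists q0, forall q N (b : nat -> R), (q0 <= q)%N ->
  \sum_(j < N) b j ^+ 2 <=
  C * ((2 ^+ q) ^+ d * N1 (comb N b) ^+ 2 +
       ((2 ^+ q) ^- 2) ^+ 2 * \sum_(j < N) (b j * mu j ^+ 2) ^+ 2).
Proof.
have [C C0 CP] := nash; have [q0 q0P] := pow2_large (4 * C).
(* With the notations below, the inequality obtained is [x <= 2 C Q + 2 C^2 r^2 y]; the summand 1
   makes the constant positive. *)
have D0 : 0 < 2 * C + 2 * C ^+ 2 + 1 by rewrite ltr_wpDl// addr_ge0// mulr_ge0// exprn_ge0.
exists (2 * C + 2 * C ^+ 2 + 1); first exact: D0.
exists q0 => q N b /q0P r4; have := CP _ _ q (comb_pair N b).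
rewrite !comb_N2; set x := \sum_(j < N) _; set y := \sum_(j < N) _.
have x0 : 0 <= x by apply: sumr_ge0 => j _; exact: sqr_ge0.
have y0 : 0 <= y by apply: sumr_ge0 => j _; exact: sqr_ge0.
set Q := (2 ^+ q) ^+ d * _.
have Q0 : 0 <= Q by apply: mulr_ge0; [rewrite !exprn_ge0|exact: sqr_ge0].
have r0 : 0 <= (2 ^+ q) ^- 2 :> R by rewrite invr_ge0 !exprn_ge0.
move: r4 r0; set r := (2 ^+ q) ^- 2 => r4 r0.
rewrite sqrtrM//.
have := sqr_sqrtr x0; have := sqr_sqrtr y0.
move: (Num.sqrt x) (Num.sqrt y) => al be be2 al2 h.
have sq := sqr_ge0 (al / 2 - C * r * be).
have E : (al / 2 - C * r * be) ^+ 2 = x / 4 - C * r * (al * be) + C ^+ 2 * (r ^+ 2 * y).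
  by rewrite -al2 -be2; field.
rewrite E in sq.
have ry0 : 0 <= r ^+ 2 * y by rewrite mulr_ge0// exprn_ge0.
have CQ : 0 <= C * Q by rewrite mulr_ge0.
have C20 : 0 <= C ^+ 2 by rewrite exprn_ge0.
have CCQ : 0 <= C ^+ 2 * Q by rewrite mulr_ge0.
have Cry : 0 <= C * (r ^+ 2 * y) by rewrite mulr_ge0.
have Crx : C * r * x <= x / 4.
  have : 4 * C * r * x <= 1 * x by rewrite ler_wpM2r.
  lra.
lra.
Qed.

(** One step of the decay of L2 norms. [h1] says that the resolvent takes [G * Y] off the energy,
    [h3] is the Nash inequality, and [G = Cn * (2 * D - 1)] is the value for which eliminating [Y]
    leaves [2 * D * E2] on the left. The division by [2 * D], where [D] stands for [2 ^+ d], makes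
    up for the factor [D * S] in [h2]. *)
Let iter_alg (D X S n E E1 E2 Y Cn G m : R) : 0 < D -> 0 < Cn -> 0 <= E ->
  G = Cn * (2 * D - 1) ->
  E2 + G * Y <= E1 -> E1 <= m * E + G * 4 * (D * S) * n ->
  E2 <= Cn * ((D * S) * (4 * n) + Y) ->
  0 <= m -> 0 <= 2 * D - 1 -> 1 <= D ->
  E2 <= m * 2^-1 * E + G * 4 * S * n.
Proof.
move=> D0 Cn0 E0 GE h1 h2 h3 m0 D1 D2.
have h4 : (2 * D - 1) * E2 <= G * ((D * S) * (4 * n) + Y).
  by rewrite GE [Cn * _]mulrC -[leRHS]mulrA ler_wpM2l.
have h5 : 2 * D * E2 <= m * E + 2 * (G * 4 * (D * S) * n) by lra.
have mE : 0 <= m * E by rewrite mulr_ge0.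
rewrite -(ler_pM2l (x := 2 * D)); last by rewrite mulr_gt0.
apply: le_trans h5 _.
rewrite (_ : 2 * D * _ = D * (m * E) + 2 * (G * 4 * (D * S) * n)); last by field.
by rewrite lerD2r ler_peMl.
Qed.

(* [P] is the product of the factors [1 + G 4^-k (mu j)^2], for k = q + 1, ...,
   q + m, i.e., dividing by [P] applies m resolvents of the Laplacian.  Each of
   them divides the squared L2 norm by [2 ^ d.+1], up to the L1 norm. *)
Lemma resolvent_iteration : exists (e : borel M -> R) (G kap : R) (q0 : nat),
  [/\ bmeas setT e, forall p, 1 <= e p, 0 <= G, 0 <= kap &
  forall m q N (b : nat -> R), (q0 <= q)%N -> let n := \int[vol]_p (e p * `|comb N b p|) in
  exists P : nat -> R,
  [/\ forall j, 1 <= P j, forall j, P j <= expR (G * ((2 ^+ q) ^- 2 * mu j ^+ 2)),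
   \sum_(j < N) (b j / P j) ^+ 2 <=
     (2^-1 ^+ m) * \sum_(j < N) b j ^+ 2 + G ^+ 2 * 4 * (2 ^+ q) ^+ d * n ^+ 2 &
   \int[vol]_p (e p * `|comb N (fun j => b j / P j) p|) <= (1 + kap * (2 ^+ q) ^- 2) * n]].
Proof.
have [e [Cc [be Cc0 e1 wc]]] := weighted_contraction.
have [Cn Cn0 [q1 nc]] := nash_comb.
have D1 : 1 <= 2 ^+ d :> R by rewrite exprn_ege1// ler1n.
have D21 : 0 <= 2 * 2 ^+ d - 1 :> R by lra.
(* Its square is the constant required by [iter_alg]: taking L2 norms in the equation of the
   resolvent brings out [s ^+ 2], with [s = G * x]. *)
pose G := Num.sqrt (Cn * (2 * 2 ^+ d - 1)).
have G2 : G ^+ 2 = Cn * (2 * 2 ^+ d - 1) by rewrite sqr_sqrtr// mulr_ge0// ltW.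
have G0 : 0 <= G by exact: sqrtr_ge0.
pose kap := Cc * G; have kap0 : 0 <= kap by rewrite mulr_ge0.
have [q2 kq] := pow2_large kap.
have e0 p : 0 <= e p by rewrite (le_trans _ (e1 p)).
have bn h : bmeas setT h -> bmeas setT (fun p => e p * `|h p|).
  by move=> bh; apply: bmeasM => //; exact: bmeas_norm.
exists e, G, kap, (maxn q1 q2); split => // m.
elim: m => [|m IH] q N b qq n.
  have n0 : 0 <= n by apply: Rintegral_ge0 => p _; rewrite mulr_ge0.
  exists (fun=> 1); split => //.
  - move=> j; rewrite -expR0 ler_expR; apply: mulr_ge0 => //.
    by apply: mulr_ge0; [rewrite invr_ge0 !exprn_ge0|exact: sqr_ge0].
  - under eq_bigr do rewrite divr1; rewrite expr0 mul1r lerDl.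
    by rewrite !mulr_ge0 ?exprn_ge0.
  - rewrite (_ : (fun j => b j / 1) = b); last by apply/funext => j; rewrite divr1.
    by rewrite -/n ler_peMl// lerDl mulr_ge0 ?invr_ge0 ?exprn_ge0.
(* The factors with [k > q + 1] come from the induction hypothesis at [q + 1]; the one added here is
   that of [k = q + 1], with step [s = G * x]. *)
have [P' [P1 Pe Eb Nb]] := IH q.+1 N b (leqW qq).
rewrite -/n in Eb Nb.
have n0 : 0 <= n by apply: Rintegral_ge0 => p _; rewrite mulr_ge0.
move: Eb Nb Pe; set x := (2 ^+ q.+1) ^- 2 => Eb Nb Pe.
have x0 : 0 <= x by rewrite invr_ge0 !exprn_ge0.
have xE : (2 ^+ q) ^- 2 = 4 * x :> R.
  have y0 : (2 ^+ q) ^+ 2 != 0 :> R by rewrite !expf_neq0.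
  by rewrite /x [2 ^+ q.+1]exprS exprMn; move: ((2 ^+ q) ^+ 2) y0 => y y0; field.
pose s := G * x; have s0 : 0 <= s by rewrite mulr_ge0.
have mu2 j : 0 <= mu j ^+ 2 by exact: sqr_ge0.
have smu j : 1 <= 1 + s * mu j ^+ 2 by rewrite lerDl mulr_ge0.
pose P j := P' j * (1 + s * mu j ^+ 2).
pose b1 j := b j / P' j; pose b2 j := b j / P j.
have b12 j : b1 j = b2 j + s * (b2 j * mu j ^+ 2).
  rewrite /b1 /b2 /P; have := P1 j; have := smu j.
  set y := 1 + _; move=> y1 p1; rewrite invfM.
  have -> : s * (b j * ((P' j)^-1 * y^-1) * mu j ^+ 2) = b j * ((P' j)^-1 * y^-1) * (y - 1).
    by rewrite /y; ring.
  by field; rewrite !gt_eqF// (lt_le_trans ltr01).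
have comb12 p : comb N b1 p = comb N b2 p + s * comb N (fun j => b2 j * mu j ^+ 2) p.
  rewrite /comb mulr_sumr -big_split/=; apply: eq_bigr => j _.
  by rewrite b12; ring.
have := wc _ _ _ (comb_pair N b2) s0.
under [X in _ <= X -> _]eq_Rintegral do rewrite -comb12.
rewrite (_ : Cc * s = kap * x); last by rewrite /kap /s mulrA.
set n2 := \int[vol]_p (e p * `|comb N b2 p|) => wn.
have kx : kap * (4 * x) <= 1 by rewrite -xE kq// (leq_trans (leq_maxr _ _) qq).
(* [1 + y <= (1 - y) (1 + 4 y)] for [y = kap * x <= 1 / 4]: the growth of the L1 norm keeps its form
   from [q + 1] to [q], where [x] is replaced by [4 x]. *)
have n2le : n2 <= (1 + kap * (4 * x)) * n.
  have k0 : 0 < 1 - kap * x by lra.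
  rewrite -(ler_pM2l k0); apply: le_trans (le_trans wn Nb) _.
  rewrite mulrA ler_wpM2r//.
  have : 0 <= (kap * x) * (2 - 4 * (kap * x)) by rewrite mulr_ge0 ?mulr_ge0//; lra.
  lra.
have n20 : 0 <= n2 by apply: Rintegral_ge0 => p _; rewrite mulr_ge0.
have N12 : N1 (comb N b2) <= n2.
  apply: le_Rintegral => //.
  - by apply: bi; apply: bmeas_norm; exact: comb_bmeas.
  - by apply: bi; apply: bn; exact: comb_bmeas.
  - by move=> p _; rewrite -[X in X <= _]mul1r ler_wpM2r.
have n22 : N1 (comb N b2) ^+ 2 <= 4 * n ^+ 2.
  have -> : 4 * n ^+ 2 = (2 * n) ^+ 2 by ring.
  rewrite lerXn2r ?nnegrE ?mulr_ge0//; first by apply: Rintegral_ge0.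
  apply: le_trans N12 (le_trans n2le _); rewrite ler_wpM2r//; lra.
exists P; split.
- by move=> j; rewrite /P; have := P1 j; have := smu j; nra.
- move=> j; rewrite xE /P (_ : G * _ = G * (x * mu j ^+ 2) + 3 * (s * mu j ^+ 2)); last first.
    by rewrite /s; ring.
  rewrite expRD; apply: ler_pM; [exact: le_trans (P1 j)|exact: le_trans (smu j)|exact: Pe|].
  apply: le_trans (expR_ge1Dx _) _; rewrite ler_expR ler_peMl ?ler1n//.
  by rewrite mulr_ge0.
- rewrite exprSr.
  pose Y := x ^+ 2 * \sum_(j < N) (b2 j * mu j ^+ 2) ^+ 2.
  apply: (@iter_alg (2 ^+ d) 0 ((2 ^+ q) ^+ d) (n ^+ 2) _
     (\sum_(j < N) b1 j ^+ 2) (\sum_(j < N) b2 j ^+ 2) Y Cn (G ^+ 2)) => //.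
  + by apply: sumr_ge0 => j _; exact: sqr_ge0.
  (* In the square of [b1 = b2 + s b2 mu^2] the double product is nonnegative. *)
  + rewrite /Y mulr_sumr mulr_sumr -big_split/=; apply: ler_sum => j _.
    rewrite b12 sqrrD addrAC.
    rewrite (_ : G ^+ 2 * (x ^+ 2 * _) = (s * (b2 j * mu j ^+ 2)) ^+ 2); last first.
      by rewrite /s; ring.
    rewrite lerDl; apply: mulrn_wge0; rewrite mulrCA; apply: mulr_ge0 => //.
    by rewrite mulrA -expr2; apply: mulr_ge0 => //; exact: sqr_ge0.
  + by rewrite -exprMn -exprS.
  + rewrite -exprMn -exprS.
    have := nc q.+1 N b2 (leqW (leq_trans (leq_maxl _ _) qq)).
    rewrite -/x -/Y => /le_trans; apply; rewrite ler_wpM2l ?(ltW Cn0)// lerD2r.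
    by rewrite ler_wpM2l ?exprn_ge0.
- by rewrite xE.
Qed.

End spectral.

(** * The local Weyl bound *)

Section weyl.
Context {R : realType} {d : nat} {M : ptopologicalType}.
Hypothesis M_compact : compact [set: M].
Context {A : smooth_atlas R d M} (g : riemannian_metric A).
Variable vol : {finite_measure set (borel M) -> \bar R}.
Hypothesis vol_riemannian : is_riemannian_volume g vol.
Variables (mu : nat -> R) (phi : nat -> M -> R).
Hypothesis mu_phi : is_eigenbasis g vol mu phi.
Local Notation N1 f := (\int[vol]_p `|f p|).

Let voloo : (vol setT < +oo)%E. Proof. exact: vol_fin. Qed.

Let bi (f : borel M -> R) : bmeas setT f -> vol.-integrable setT (EFin \o f).
Proof. by move=> bf; exact: bm_int. Qed.

Lemma mu_le i j : (i <= j)%N -> mu i <= mu j.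
Proof.
move=> ij; rewrite -(subnK ij); elim: (j - i)%N => [|n IH]; first by rewrite add0n.
by rewrite addSn (le_trans IH)// (eigenvalue_ndecr mu_phi).
Qed.

Lemma mu_ge0 j : 0 <= mu j.
Proof. by rewrite -(eigenvalue0 mu_phi) mu_le. Qed.

(** For [mu j <= 2 ^+ q] the factor [P j] is at most [expR G], so the low part of the energy
    survives the resolvents, while the term that contains the whole energy disappears as [m]
    grows. *)
Lemma spectral_comb_bound : exists2 C, 0 <= C & exists q0, forall q N (b : nat -> R), (q0 <= q)%N ->
  \sum_(j < N | mu j <= 2 ^+ q) b j ^+ 2 <= C * (2 ^+ q) ^+ d * N1 (comb phi N b) ^+ 2.
Proof.
have [e [G [kap [q0 [be e1 G0 kap0 H]]]]] := resolvent_iteration M_compact vol_riemannian mu_phi.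
have [_ [B eB]] := be.
exists (expR G ^+ 2 * (G ^+ 2 * 4) * `|B| ^+ 2).
  by rewrite !mulr_ge0 ?exprn_ge0 ?expR_ge0.
exists q0 => q N b q0q.
set n1 := N1 _; set S := \sum_(j < N | _) _.
have bc := comb_bmeas M_compact mu_phi N b.
have n_le : \int[vol]_p (e p * `|comb phi N b p|) <= `|B| * n1.
  rewrite -RintegralZl//; last by apply: bi; exact: bmeas_norm.
  apply: le_Rintegral => //.
  - by apply: bi; apply: bmeasM => //; exact: bmeas_norm.
  - by apply: bi; apply: bmeasM; [exact: bmeas_cst|exact: bmeas_norm].
  - move=> p _; rewrite ler_wpM2r// (le_trans (ler_norm _))// (le_trans (eB p I))//.
    exact: ler_norm.
have e0 p : 0 <= e p by rewrite (le_trans _ (e1 p)).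
move: n_le; set n := \int[vol]_p _ => n_le.
have n0 : 0 <= n by apply: Rintegral_ge0 => p _; rewrite mulr_ge0.
have n10 : 0 <= n1 by apply: Rintegral_ge0 => p _.
pose E := \sum_(j < N) b j ^+ 2.
have E0 : 0 <= E by apply: sumr_ge0 => j _; exact: sqr_ge0.
have key m : S <= expR G ^+ 2 * (2^-1 ^+ m * E + G ^+ 2 * 4 * (2 ^+ q) ^+ d * n ^+ 2).
  have [P [P1 Pe Eb _]] := H m q N b q0q.
  apply: le_trans (ler_wpM2l (exprn_ge0 2 (expR_ge0 G)) Eb).
  rewrite /S big_mkcond mulr_sumr; apply: ler_sum => j _; case: ifPn => [muj|_]; last first.
    by apply: mulr_ge0; [rewrite exprn_ge0 ?expR_ge0|exact: sqr_ge0].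
  have P0 : 0 < P j by rewrite (lt_le_trans _ (P1 j)).
  rewrite expr_div_n mulrCA ler_peMr ?sqr_ge0// ler_pdivlMr ?exprn_gt0// mul1r.
  rewrite lerXn2r ?nnegrE ?expR_ge0 ?(ltW P0)//; apply: le_trans (Pe j) _.
  rewrite ler_expR -[leRHS]mulr1 ler_wpM2l// mulrC ler_pdivrMr ?exprn_gt0// mul1r.
  by rewrite lerXn2r ?nnegrE ?exprn_ge0// mu_ge0.
have : S <= expR G ^+ 2 * (G ^+ 2 * 4 * (2 ^+ q) ^+ d * n ^+ 2).
  apply/ler_addgt0Pr => ep ep0.
  have [q1 /(_ q1 (leqnn _))] := pow2_large (expR G ^+ 2 * E / ep).
  rewrite mulrAC ler_pdivrMr// mul1r => h.
  (* [pow2_large] speaks of [4^-q1], hence the number [2 q1] of resolvents. *)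
  have := key (q1 * 2)%N; rewrite exprM exprVn exprVn mulrDr.
  move=> /le_trans; apply; rewrite addrC lerD2l mulrCA mulrC.
  exact: h.
move=> /le_trans; apply.
have n2 : n ^+ 2 <= `|B| ^+ 2 * n1 ^+ 2.
  by rewrite -exprMn lerXn2r ?nnegrE ?mulr_ge0.
rewrite (_ : _ * `|B| ^+ 2 * _ * _ =
  expR G ^+ 2 * (G ^+ 2 * 4 * (2 ^+ q) ^+ d * (`|B| ^+ 2 * n1 ^+ 2))); last by ring.
rewrite ler_wpM2l ?exprn_ge0 ?expR_ge0// ler_wpM2l// !mulr_ge0 ?exprn_ge0//.
Qed.

(** The expansion of [h] in the eigenbasis converges in L2, hence in L1 as the measure is finite,
    and its partial sums have the same coefficients as [h]; the bound for combinations passes to the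
    limit. *)
Lemma spectral_bound : exists2 C, 0 <= C & exists q0, forall q N (h : borel M -> R), (q0 <= q)%N ->
  bmeas setT h ->
  \sum_(j < N | mu j <= 2 ^+ q) L2dot vol h (phi j) ^+ 2 <= C * (2 ^+ q) ^+ d * N1 h ^+ 2.
Proof.
have [C C0 [q0 H]] := spectral_comb_bound; exists C => //; exists q0 => q N h q0q bh.
have Lh : L2 vol h by exact: bmeas_L2.
pose b j := L2dot vol h (phi j : borel M -> R).
have := eigenfunction_complete mu_phi Lh.
rewrite -[X in L2cvg _ X _]/(fun n => comb phi n b) => hc.
pose c := L2norm vol (fun=> 1).
pose dl n := L2norm vol (comb phi n b \- h).
have lim : (fun n => C * (2 ^+ q) ^+ d * (N1 h + dl n * c) ^+ 2) @ \oo -->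
    C * (2 ^+ q) ^+ d * (N1 h) ^+ 2.
  have h1 : (fun n => N1 h + dl n * c) @ \oo --> N1 h.
    rewrite -[X in _ --> X]addr0; apply: cvgD; first exact: cvg_cst.
    by rewrite -[X in _ --> X](mul0r c); apply: cvgM => //; exact: cvg_cst.
  by apply: cvgM; [exact: cvg_cst|exact: (cvgM h1 h1)].
rewrite -(cvg_lim _ lim)//; apply: limr_ge.
  by apply/cvg_ex; eexists; exact: lim.
near=> n; have Nn : (N <= n)%N by near: n; exact: nbhs_infty_ge.
apply: (@le_trans _ _ (\sum_(j < n | mu j <= 2 ^+ q) b j ^+ 2)).
  rewrite -(big_mkord (fun j => mu j <= 2 ^+ q) (fun j => b j ^+ 2)).
  rewrite -(big_mkord (fun j => mu j <= 2 ^+ q) (fun j => b j ^+ 2)).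
  rewrite [leRHS](@big_cat_nat _ _ _ N)//= lerDl; apply: sumr_ge0 => j _; exact: sqr_ge0.
apply: le_trans (H q n b q0q) _; rewrite ler_wpM2l ?mulr_ge0 ?exprn_ge0//.
have Lc : L2 vol (comb phi n b) by apply: bmeas_L2 => //; exact: (comb_bmeas M_compact mu_phi).
have LB : L2 vol (comb phi n b \- h) by exact: L2B.
have dc := L1_le_L2 voloo LB.
have le : N1 (comb phi n b) <= N1 h + dl n * c.
  apply: (@le_trans _ _ (N1 h + N1 (comb phi n b \- h))); last by rewrite lerD2l.
  have i0 := L2_integrable voloo (L2_abs Lc).
  have i1 := L2_integrable voloo (L2_abs Lh); have i2 := L2_integrable voloo (L2_abs LB).
  rewrite -RintegralD//; apply: le_Rintegral => //.
  - exact: (integrableD measurableT i1 i2).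
  - by move=> p _; rewrite (le_trans _ (ler_normD _ _))//= subrKC.
rewrite lerXn2r ?nnegrE//; first by apply: Rintegral_ge0.
by apply: le_trans le; apply: Rintegral_ge0.
Unshelve. all: by end_near. Qed.

(* The function sum_j phi_j(xi) phi_j takes at xi the value S of the sum to be
   bounded; [spectral_bound] is applied to the indicator of the open set where
   this function is larger than S / 2. *)
Lemma dyadic_weyl : exists2 C, 0 <= C & exists q0, forall q N (xi : M), (q0 <= q)%N ->
  \sum_(j < N | mu j <= 2 ^+ q) phi j xi ^+ 2 <= C * (2 ^+ q) ^+ d.
Proof.
have [C C0 [q0 H]] := spectral_bound; exists (4 * C); first by rewrite mulr_ge0.
exists q0 => q N xi q0q; set S := \sum_(j < N | _) _.
set Q := (2 ^+ q) ^+ d; have Q0 : 0 <= Q by rewrite !exprn_ge0.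
have [S0|S0] := lerP S 0; first by rewrite (le_trans S0)// !mulr_ge0.
pose b j := if mu j <= 2 ^+ q then phi j xi else 0.
pose f := comb phi N b.
have fxi : f xi = S.
  rewrite /f /comb /S [RHS]big_mkcond; apply: eq_bigr => j _.
  by rewrite /b; case: ifP => _; rewrite ?mul0r.
pose B : set M := [set p | S / 2 < f p].
have oB : open B.
  have cf : continuous (f : M -> R).
    move=> p; rewrite /f; elim: N {S S0 f fxi B} => [|n IH].
      rewrite (_ : comb phi 0 b = cst 0); first exact: cst_continuous.
      by apply/funext => x; rewrite /comb big_ord0.
    rewrite (_ : comb phi n.+1 b = (fun x => comb phi n b x + b n * phi n x)).
      by apply: cvgD => //; apply: cvgM; [exact: cvg_cst|exact: (eigenfunction_continuous mu_phi)].
    by apply/funext => x; rewrite /comb big_ord_recr.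
  exact: (open_comp (fun p _ => cf p) (@open_gt R (S / 2))).
have Bxi : B xi by rewrite /B/= fxi ltr_pdivrMr// ltr_pMr// ltr1n.
have mB : measurable (B : set (borel M)) by exact: sub_sigma_algebra.
pose V := fine (vol B).
have V0 : 0 < V.
  by rewrite fine_gt0// (vol_open_gt0 vol_riemannian oB Bxi)/= vol_fin.
pose h : borel M -> R := \1_(B : set (borel M)).
have bh : bmeas setT h.
  split; first exact: measurable_indic.
  by exists 1 => p _; rewrite /h indicE; case: (p \in _); rewrite ?normr1 ?normr0.
have N1h : N1 h = V.
  have -> : N1 h = \int[vol]_p h p.
    by apply: eq_Rintegral => p _; rewrite ger0_norm// /h indicE.
  by rewrite /Rintegral integral_indic// setIT.
have Lh : L2 vol h by exact: bmeas_L2.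
have bf : bmeas setT f by exact: (comb_bmeas M_compact mu_phi).
have low : S / 2 * V <= L2dot vol f h.
  rewrite -N1h -RintegralZl//; last by apply: bi; exact: bmeas_norm.
  apply: le_Rintegral => //.
  - by apply: bi; apply: bmeasM; [exact: bmeas_cst|exact: bmeas_norm].
  - by apply: bi; exact: bmeasM.
  - move=> p _; rewrite /h indicE; have [/set_mem Bp|_] := boolP (p \in _).
      by rewrite normr1 !mulr1 ltW.
    by rewrite normr0 !mulr0.
have := H q N h q0q bh; rewrite N1h -/Q => up.
have : L2dot vol f h <= (S * V / 2 + 2 / V * (C * Q * V ^+ 2)) / 2.
  rewrite (comb_dot M_compact mu_phi)//.
  have -> : \sum_(j < N) b j * L2dot vol (phi j) h =
      \sum_(j < N | mu j <= 2 ^+ q) phi j xi * L2dot vol h (phi j).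
    rewrite [RHS]big_mkcond; apply: eq_bigr => j _; rewrite /b L2dotC.
    by case: ifP => _; rewrite ?mul0r.
  (* [x y <= (x^2 V / 2 + 2 y^2 / V) / 2], balanced so that the first part sums to [S V / 4], half
     of the lower bound [S V / 2]; the volume [V] of the superlevel set then cancels. *)
  apply: (@le_trans _ _ ((S * V / 2 +
     2 / V * \sum_(j < N | mu j <= 2 ^+ q) L2dot vol h (phi j) ^+ 2) / 2)); last first.
    by rewrite ler_wpM2r ?invr_ge0// lerD2l ler_wpM2l// divr_ge0// ltW.
  rewrite /S !mulr_suml mulr_sumr -big_split/= mulr_suml; apply: ler_sum => j _.
  set x := phi j xi; set y := L2dot _ _ _.
  rewrite -(ler_pM2r V0); have := sqr_ge0 (x * V / 2 - y).
  rewrite (_ : (_ + _) / 2 * V = (x ^+ 2 * V ^+ 2 / 2 + 2 * y ^+ 2) / 2); last by field; rewrite gt_eqF.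
  nra.
move=> /(le_trans low).
rewrite (_ : (_ + _) / 2 = S * V / 4 + C * Q * V); last by field; rewrite gt_eqF.
move=> h1; rewrite -(ler_pM2r V0); move: h1; rewrite -/Q.
lra.
Qed.

(** From large powers of 2 to all [T > 0]. The index 0 being left out, the sum is empty for
    [T < mu 1], and the remaining thresholds below [2 ^+ q0] only cost a constant. *)
Lemma weyl_bound : exists2 C, 0 <= C & forall N T xi, 0 < T ->
  \sum_(1 <= j < N | mu j <= T) phi j xi ^+ 2 <= C * T ^+ d.
Proof.
have [C C0 [q0 H]] := dyadic_weyl.
(* [2 ^+ q0] reaches the scales of [dyadic_weyl], the summand 2 rounds [T] up to a power of 2, and
   [(mu 1)^-1] accounts for [T <= 1], where that power is 1. *)
pose K := 2 ^+ q0 * ((mu 1)^-1 + 2); have m1 := eigenvalue1 mu_phi.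
have K0 : 0 <= K by rewrite mulr_ge0 ?exprn_ge0// addr_ge0// invr_ge0 ltW.
exists (C * K ^+ d); first by rewrite mulr_ge0 ?exprn_ge0.
move=> N T xi T0.
have [Tm|mT] := ltrP T (mu 1).
  rewrite big_nat_cond big_pred0 ?mulr_ge0 ?exprn_ge0 ?(ltW T0)// => j.
  apply/negP => /andP[/andP[j1 _]]; apply/negP; rewrite -ltNge.
  by rewrite (lt_le_trans Tm)// mu_le.
have [n [Tn n2]] : exists n, T <= 2 ^+ n /\ 2 ^+ n <= ((mu 1)^-1 + 2) * T.
  have ex : exists n, T <= 2 ^+ n.
    exists (Num.truncn T).+1; apply: (@le_trans _ _ (Num.truncn T).+1%:R).
      by rewrite ltW// truncnS_gt.
    by rewrite -natrX ler_nat ltnW// ltn_expl.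
  exists (ex_minn ex); case: ex_minnP => n Tn nmin; split => //.
  case: n Tn nmin => [_ _|n _ nmin].
    rewrite expr0 [leRHS]mulrDl; apply: (@le_trans _ _ ((mu 1)^-1 * T)).
      by rewrite mulrC ler_pdivlMr// mul1r.
    by rewrite lerDl mulr_ge0// ltW.
  rewrite exprS [leRHS]mulrDl; apply: (@le_trans _ _ (2 * T)).
    by rewrite ler_pM2l// leNgt; apply/negP => /ltW /nmin; rewrite ltnn.
  by rewrite lerDr mulr_ge0 ?invr_ge0 ?ltW.
have := H (q0 + n)%N N xi (leq_addr _ _).
rewrite -(big_mkord (fun j => mu j <= _) (fun j => phi j xi ^+ 2)) => h.
apply: (@le_trans _ _ (\sum_(0 <= j < N | mu j <= 2 ^+ (q0 + n)) phi j xi ^+ 2)).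
  case: N h => [|N] _; first by rewrite !big_geq.
  rewrite [leRHS]big_ltn_cond//.
  apply: (@le_trans _ _ (\sum_(1 <= j < N.+1 | mu j <= 2 ^+ (q0 + n)) phi j xi ^+ 2)).
    rewrite big_mkcond [leRHS]big_mkcond; apply: ler_sum => j _.
    case: ifPn => [jT|_]; last by case: ifP => // _; exact: sqr_ge0.
    rewrite ifT// exprD (le_trans jT)// (le_trans Tn)// ler_peMl ?exprn_ge0//.
    by rewrite exprn_ege1// ler1n.
  by case: ifP => // _; rewrite lerDr sqr_ge0.
apply: le_trans h _; rewrite -mulrA ler_wpM2l// -exprMn lerXn2r ?nnegrE ?exprn_ge0//.
  by rewrite mulr_ge0// ltW.
by rewrite exprD /K -mulrA ler_wpM2l ?exprn_ge0.
Qed.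

End weyl.

(** * Finiteness of the sharp constant *)

Lemma sum_uniq_subset (V : zmodType) (I : eqType) (s t : seq I) (F : I -> V) :
  uniq s -> uniq t -> {subset s <= t} ->
  \sum_(i <- t) F i = \sum_(i <- s) F i + \sum_(i <- [seq j <- t | j \notin s]) F i.
Proof.
move=> us ut st; rewrite -big_cat; apply: perm_big.
apply: uniq_perm => // [|i].
  rewrite cat_uniq us filter_uniq// andbT -all_predC.
  by apply/allP => i; rewrite mem_filter => /andP[].
rewrite mem_cat mem_filter; have [/st ->//|] := boolP (i \in s).
by [].
Qed.

Lemma le_sum_uniq_subset (R : numDomainType) (I : eqType) (s t : seq I) (F : I -> R) :
  uniq s -> uniq t -> {subset s <= t} -> (forall i, i \in t -> 0 <= F i) ->
  \sum_(i <- s) F i <= \sum_(i <- t) F i.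
Proof.
move=> us ut st F0; rewrite (sum_uniq_subset F us ut st) lerDl big_seq.
by apply: sumr_ge0 => i; rewrite mem_filter => /andP[_ /F0].
Qed.

(** * Exhaustion of the positive multi-indices by cubes *)

Section cubes.
Variable a : nat.
Implicit Types J : a.-tuple nat.

(** The index set of [laplacian_pow_sum] as a sequence without repetitions: nested partial sums can
    then be subtracted and compared with arbitrary finite sets of indices. *)
Definition cubeseq (n : nat) : seq (a.-tuple nat) :=
  [seq J <- [seq map_tuple val t | t <- enum {: a.-tuple 'I_n}] | pos_index J].

Lemma uniq_cubeseq n : uniq (cubeseq n).
Proof.
rewrite filter_uniq// map_inj_uniq ?enum_uniq// => J K JK.
apply: eq_from_tnth => i; apply: val_inj; have := congr1 (fun t : a.-tuple nat => tnth t i) JK.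
by rewrite /= !tnth_map.
Qed.

Lemma mem_cubeseq n J : (J \in cubeseq n) = pos_index J && [forall i, tnth J i < n]%N.
Proof.
rewrite mem_filter; congr (_ && _); apply/mapP/forallP => [[K _ ->] i|Jn].
  by rewrite tnth_map ltn_ord.
exists (mktuple (fun i => Ordinal (Jn i))); first by rewrite mem_enum.
by apply: eq_from_tnth => i; rewrite tnth_map tnth_mktuple.
Qed.

Lemma big_cubeseq (V : nmodType) n (F : a.-tuple nat -> V) :
  \sum_(J <- cubeseq n) F J =
  \sum_(J : a.-tuple 'I_n | pos_index (map_tuple val J)) F (map_tuple val J).
Proof. by rewrite big_filter big_map big_enum_cond. Qed.

Lemma cubeseq_pos n J : J \in cubeseq n -> pos_index J.
Proof. by rewrite mem_cubeseq => /andP[]. Qed.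

Lemma cubeseq_sub n p : (n <= p)%N -> {subset cubeseq n <= cubeseq p}.
Proof.
move=> np J; rewrite !mem_cubeseq => /andP[-> /forallP Jn]; apply/forallP => i.
exact: leq_trans (Jn i) np.
Qed.

Lemma cubeseq_cover (s : seq (a.-tuple nat)) : (forall J, J \in s -> pos_index J) ->
  exists n, {subset s <= cubeseq n}.
Proof.
move=> ps; exists (\sum_(J <- s) \sum_i tnth J i).+1 => J Js; rewrite mem_cubeseq ps//=.
apply/forallP => i; rewrite ltnS (big_rem J Js)/= (bigD1 i)//=.
by rewrite -!addnA leq_addr.
Qed.

Lemma esum_le_cubes (R : realType) (f : a.-tuple nat -> R) (B : R) :
  (forall J, pos_index J -> 0 <= f J) -> (forall n, \sum_(J <- cubeseq n) f J <= B) ->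
  (\esum_(J in [set J | pos_index J]) (f J)%:E <= B%:E)%E.
Proof.
move=> f0 fB; apply: ge_ereal_sup => _ [X [finX Xpos] <-].
have [s0 XE] := (finite_seqP X).1 finX; pose s := undup s0.
have XE' : X = [set` s] by rewrite XE; apply/seteqP; split => x /=; rewrite mem_undup.
rewrite XE' -fsbig_seq ?undup_uniq// sumEFin lee_fin.
have [n sn] : exists n, {subset s <= cubeseq n}.
  by apply: cubeseq_cover => J Js; apply: Xpos; rewrite XE'.
apply: le_trans (fB n); apply: le_sum_uniq_subset => //.
- exact: undup_uniq.
- exact: uniq_cubeseq.
- by move=> J /cubeseq_pos /f0.
Qed.

Lemma cube_le_esum (R : realType) (f : a.-tuple nat -> R) n :
  ((\sum_(J <- cubeseq n) f J)%:E <= \esum_(J in [set J | pos_index J]) (f J)%:E)%E.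
Proof.
apply: esum_ge; exists [set` cubeseq n].
  by split; [apply/finite_seqP; exists (cubeseq n)|move=> J /= /cubeseq_pos].
by rewrite -fsbig_seq ?uniq_cubeseq// sumEFin.
Qed.

Lemma sum_cubeseq_prod (R : comNzRingType) n (G : 'I_a -> nat -> R) :
  \sum_(J <- cubeseq n) \prod_i G i (tnth J i) = \prod_i \sum_(1 <= j < n) G i j.
Proof.
rewrite big_cubeseq.
(* Distributivity ranges over all maps to ['I_n], including those with a zero entry, so the index 0
   is kept with the summand 0. *)
have -> : \prod_i \sum_(1 <= j < n) G i j =
    \prod_(i < a) \sum_(j < n) (if (0 < j)%N then G i j else 0).
  apply: eq_bigr => i _; rewrite -(big_mkord xpredT (fun j => if (0 < j)%N then G i j else 0)).
  case: n => [|n]; first by rewrite !big_geq.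
  by rewrite [RHS]big_ltn// add0r; apply: eq_big_nat => j /andP[-> _].
rewrite bigA_distr_bigA (reindex (fun f : {ffun 'I_a -> 'I_n} => [tuple f i | i < a])) /=; last first.
  exists (fun t : a.-tuple 'I_n => [ffun i => tnth t i]) => [f _|t _].
    by apply/ffunP => i; rewrite ffunE tnth_mktuple.
  by apply: eq_from_tnth => i; rewrite tnth_mktuple ffunE.
rewrite big_mkcond; apply: eq_bigr => f _; case: ifPn => [/forallP h|].
  apply: eq_bigr => i _; have := h i; rewrite tnth_map tnth_mktuple => fi.
  by rewrite fi.
rewrite negb_forall => /existsP[i]; rewrite tnth_map tnth_mktuple => /negbTE fi.
by rewrite (bigD1 i)//= fi mul0r.
Qed.

End cubes.

(** * Exponentially weighted sums under a growth bound *)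

Section one_dim.
Context {R : realType} {d : nat} (mu : nat -> R) (C : R).
Hypothesis mu0 : forall j, (0 < j)%N -> 0 < mu j.

(** The property of [f j = phi j xi ^+ 2] given by the Weyl bound; isolating it makes the constants
    below uniform in the point [xi]. *)
Definition weyl_growth (f : nat -> R) := (forall j, 0 <= f j) /\
  forall N T, 0 < T -> \sum_(1 <= j < N | mu j <= T) f j <= C * T ^+ d.

(** The condition confines [mu j] between [T / expR 1] and [T]: on such a block [mu j ^- d] is at
    most [(T / expR 1) ^- d], and the growth bound at [T] cancels [T ^+ d]. *)
Lemma sum_block f N (c b : R) : weyl_growth f ->
  \sum_(1 <= j < N | c <= ln (mu j) + b <= c + 1) f j / mu j ^+ d <= C * expR 1 ^+ d.
Proof.
move=> [f0 weyl]; pose T := expR (c + 1 - b); have T0 : 0 < T by exact: expR_gt0.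
apply: (@le_trans _ _ ((T / expR 1) ^- d * \sum_(1 <= j < N | mu j <= T) f j)).
  rewrite mulr_sumr big_nat_cond [leRHS]big_nat_cond.
  rewrite big_mkcond [leRHS]big_mkcond; apply: ler_sum => j _.
  have [jN|] := boolP (1 <= j < N)%N => //=; have m0 : 0 < mu j by apply: mu0; case/andP: jN.
  case: ifPn => [/andP[h1 h2]|_]; last first.
    by case: ifP => // _; rewrite mulr_ge0 ?invr_ge0 ?exprn_ge0 ?divr_ge0 ?expR_ge0.
  rewrite ifT; last by rewrite /T -[mu j]lnK ?posrE// ler_expR; lra.
  rewrite mulrC ler_wpM2r// lef_pV2 ?posrE ?exprn_gt0 ?divr_gt0 ?expR_gt0//.
  rewrite lerXn2r ?nnegrE ?divr_ge0 ?expR_ge0 ?(ltW m0)//.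
  by rewrite /T -expRB -[leRHS]lnK ?posrE// ler_expR; lra.
have Td : 0 < T ^+ d by rewrite exprn_gt0.
apply: le_trans (ler_wpM2l _ (weyl N T T0)) _.
  by rewrite invr_ge0 exprn_ge0// divr_ge0 ?expR_ge0.
by rewrite expr_div_n invf_div mulrCA divfK// gt_eqF.
Qed.

(** The indices are sorted by the integer part [n] of [|ln (mu j) + b|], which yields two blocks for
    each [n] and then a geometric series. The bound does not depend on [b]; this will make it
    uniform in [h], through which [b] is defined later. *)
Lemma sum_exp_decay (gam : R) : 0 < gam -> 0 <= C -> exists2 K, 0 < K & forall f N b, weyl_growth f ->
  \sum_(1 <= j < N) f j / mu j ^+ d * expR (- (gam * `|ln (mu j) + b|)) <= K.
Proof.
move=> gam0 C0; pose B := C * expR 1 ^+ d.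
have B0 : 0 <= B by rewrite mulr_ge0 ?exprn_ge0 ?expR_ge0.
pose x := expR (- gam).
have x0 : 0 < x by exact: expR_gt0.
have x1 : x < 1 by rewrite /x -expR0 ltr_expR oppr_lt0.
exists (2 * B * (1 / (1 - x)) + 1).
  by rewrite ltr_wpDl// !mulr_ge0 ?invr_ge0 ?subr_ge0 ?(ltW x1).
move=> f N b wf; have [f0 _] := wf; apply: ler_wpDr => //.
pose t j := ln (mu j) + b.
pose F j := f j / mu j ^+ d * expR (- (gam * `|t j|)).
rewrite -[leLHS]/(\sum_(1 <= j < N) F j).
pose tr j := Num.truncn `|t j|.
pose L := (\sum_(1 <= j < N) tr j).+1.
have trL j : (1 <= j < N)%N -> (tr j < L)%N.
  by move=> jN; rewrite /L ltnS (big_rem j) ?leq_addr//= mem_index_iota.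
have g0 j : (1 <= j < N)%N -> 0 <= f j / mu j ^+ d.
  by move=> /andP[j1 _]; rewrite divr_ge0// exprn_ge0// (ltW (mu0 j1)).
apply: (@le_trans _ _ (\sum_(n < L) \sum_(1 <= j < N | tr j == n) F j)).
  rewrite (exchange_big_dep xpredT)//= big_nat_cond [leRHS]big_nat_cond.
  apply: ler_sum => j; rewrite andbT => jN.
  by rewrite (big_pred1 (Ordinal (trL j jN)))// => n; rewrite eq_sym -val_eqE.
apply: (@le_trans _ _ (\sum_(n < L) (2 * B * x ^+ n))); last first.
  rewrite -mulr_sumr ler_wpM2l ?mulr_ge0//.
  have := @geometric_le_lim R L 1 x ler01 x0; rewrite gtr0_norm// => /(_ x1).
  by apply: le_trans; rewrite /series/= big_mkord; apply: ler_sum => i _; rewrite /= mul1r.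
apply: ler_sum => n _.
apply: (@le_trans _ _ (x ^+ n * (\sum_(1 <= j < N | n%:R <= t j <= n%:R + 1) f j / mu j ^+ d +
   \sum_(1 <= j < N | - n%:R - 1 <= t j <= - n%:R - 1 + 1) f j / mu j ^+ d))).
  rewrite mulrDr !mulr_sumr big_nat_cond [X in X + _]big_nat_cond [X in _ + X]big_nat_cond.
  rewrite big_mkcond [X in X + _]big_mkcond [X in _ + X]big_mkcond -big_split/=.
  apply: ler_sum => j _.
  have [jN|] := boolP (1 <= j < N)%N => /=; last by rewrite addr0.
  have xg : 0 <= x ^+ n * (f j / mu j ^+ d) by rewrite mulr_ge0 ?exprn_ge0 ?g0// ltW.
  case: ifPn => [/eqP trn|_]; last by apply: addr_ge0; case: ifP.
  have nt : n%:R <= `|t j| by rewrite -trn truncn_le.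
  have tn : `|t j| < n%:R + 1 by rewrite natr1 -trn truncnS_gt.
  have Fx : F j <= x ^+ n * (f j / mu j ^+ d).
    rewrite /F mulrC ler_wpM2r ?g0// /x -expRM_natl ler_expR mulrN lerN2 mulrC.
    by rewrite ler_wpM2l// ltW.
  have [t0|t0] := lerP 0 (t j).
    rewrite ger0_norm// in nt tn; rewrite nt (ltW tn) /=.
    by rewrite (le_trans Fx)// lerDl; case: ifP.
  rewrite ltr0_norm// in nt tn.
  rewrite [X in _ <= _ + X]ifT; last by apply/andP; split; lra.
  by rewrite (le_trans Fx)// lerDr; case: ifP.
rewrite mulrC ler_wpM2r ?exprn_ge0 ?(ltW x0)//.
rewrite mulr2n mulrDl mul1r; apply: lerD; exact: sum_block.
Qed.

End one_dim.

Section sharp_constant.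
Context {R : realType} {d : nat} {M : ptopologicalType}.
Variables (mu : nat -> R) (phi : nat -> M -> R) (a m : nat).
Hypotheses (d_gt0 : (0 < d)%N) (a_gt0 : (0 < a)%N).
Hypotheses (mu1 : 0 < mu 1) (mu_ge : forall j, (0 < j)%N -> mu 1 <= mu j).
Variable W : R.
Hypotheses (W0 : 0 <= W) (weyl : forall N T xi, 0 < T ->
  \sum_(1 <= j < N | mu j <= T) phi j xi ^+ 2 <= W * T ^+ d).
Variables (k : 'rV[R]_a) (r : 'I_m.+1 -> 'rV[R]_a) (lambda : 'I_m.+1 -> R).
Let kap : 'rV[R]_a := k + ((2 * d%:R - 1) / 4) *: const_mx 1.
Hypothesis k_int : (convex_hull r)° kap.
Hypothesis lambda_gt0 : forall l, 0 < lambda l.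
Hypothesis lambda_sum : \sum_(l < m.+1) lambda l = 1.
Hypothesis k_le : forall i : 'I_a, kap ord0 i <= (\sum_(l < m.+1) lambda l *: r l) ord0 i.

Let mu_pos j : (0 < j)%N -> 0 < mu j.
Proof. by move=> j0; rewrite (lt_le_trans mu1)// mu_ge. Qed.

Lemma mu_powE (s : 'rV[R]_a) J : pos_index J ->
  mu_pow mu s J = expR (\sum_i s ord0 i * ln (mu (tnth J i))).
Proof.
move=> /forallP J0; rewrite expR_sum; apply: eq_bigr => i _.
by rewrite /powR gt_eqF// mu_pos.
Qed.

Lemma mu_pow_gt0 (s : 'rV[R]_a) J : pos_index J -> 0 < mu_pow mu s J.
Proof. by move=> J0; rewrite mu_powE// expR_gt0. Qed.

(** [w i] and [w' i] are the weights of [kap + dl e_i] and [kap - dl e_i] as points of the hull, to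
    which they belong since [kap] is interior. *)
Lemma hull_segments : exists2 dl, 0 < dl & exists w w' : 'I_a -> 'I_m.+1 -> R, forall i,
  [/\ forall l, 0 <= w i l, forall l, 0 <= w' i l, \sum_l w i l = 1, \sum_l w' i l = 1 &
    forall j, \sum_l (w i l - w' i l) * r l ord0 j = 2 * dl * (j == i)%:R].
Proof.
have [e /= e0 eH] := (nbhs_ballP _ _).1 k_int.
have near (s : R) i : `|s| < e -> convex_hull r (kap + s *: delta_mx ord0 i).
  move=> se; apply: eH; split => // x j; rewrite ord1 /ball/= !mxE eqxx/=.
  rewrite opprD addrA subrr add0r normrN.
  by case: (j == i); rewrite ?mulr1// mulr0 normr0.
have e2 : `|e / 2| < e by rewrite ger0_norm ?divr_ge0 ?(ltW e0)// ltr_pdivrMr// ltr_pMr// ltr1n.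
have /choice[w wP] i := near _ i e2.
have /choice[w' wP'] i : convex_hull r (kap + (- (e / 2)) *: delta_mx ord0 i).
  by apply: near; rewrite normrN.
exists (e / 2); first by rewrite divr_gt0.
exists w, w' => i; have [w0 w1 wE] := wP i; have [w0' w1' wE'] := wP' i; split => // j.
have E (u : 'I_m.+1 -> R) (t : R) : kap + t *: delta_mx ord0 i = \sum_l u l *: r l ->
    \sum_l u l * r l ord0 j = kap ord0 j + t * (j == i)%:R.
  move=> uE; transitivity ((\sum_l u l *: r l) ord0 j); last by rewrite -uE !mxE eqxx.
  by rewrite summxE; apply: eq_bigr => l _; rewrite mxE.
under eq_bigr do rewrite mulrBl; rewrite sumrB (E _ _ wE) (E _ _ wE').
by move: (kap ord0 j) => c; case: (j == i); field.
Qed.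

(* With v_i = ln mu_(j_i) and y_l = ln h_l + 4 <r^l, v>, the left-hand side is, up
   to powers of the mu_(j_i), at most exp (sum_l lambda_l y_l - max y).  Writing
   kap + dl e_i and kap - dl e_i as points of the hull bounds max y - min y from
   below by |8 dl v_i + beta_i|, with beta_i depending on h only. *)
Lemma term_bound : exists2 gam, 0 < gam & exists2 K, 0 < K &
  forall h : 'I_m.+1 -> R, (forall l, 0 < h l) -> exists b : 'I_a -> R, forall J, pos_index J ->
  \prod_l h l `^ lambda l * (mu_pow mu (4 *: k) J / \sum_l h l * mu_pow mu (4 *: r l) J) <=
  K * \prod_i (mu (tnth J i) ^- d * expR (- (gam * `|ln (mu (tnth J i)) + b i|))).
Proof.
have [dl dl0 [w [w' wP]]] := hull_segments.
have [lm lm0 lmP] : exists2 lm, 0 < lm & forall l, lm <= lambda l.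
  exists (lambda [arg min_(l < ord0) lambda l]%O) => // l.
  by case: arg_minP => // l0 _; exact.
(* [8 dl] is four times the distance between [kap + dl e_i] and [kap - dl e_i]; the exponent
   [lm (max y - min y)] is shared equally among the [a] coordinates. *)
pose gam := lm * (8 * dl) / a%:R.
have a0 : 0 < a%:R :> R by rewrite ltr0n.
have gam0 : 0 < gam by rewrite divr_gt0// !mulr_gt0.
pose rho i := (\sum_(l < m.+1) lambda l *: r l) ord0 i - kap ord0 i.
have rho0 i : 0 <= rho i by rewrite subr_ge0.
pose c1 := ln (mu 1).
(* The weights leave each [mu_(j_i)] with the exponent [- (4 rho i + 2 d - 1)]. The part [- d] is
   kept for the Weyl bound; the rest, of exponent at most 0 as [1 <= d], is estimated by its value
   at [mu 1]. *)
pose K := expR (\sum_(i < a) - ((4 * rho i + (d%:R - 1)) * c1)).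
exists gam => //; exists K; first exact: expR_gt0.
(* The shift for which [8 dl (v i + b i)] is the difference of the means of [y] with the weights
   [w i] and [w' i]. *)
move=> h h0; pose b i := (\sum_l (w i l - w' i l) * ln (h l)) / (8 * dl).
exists b => J J0; pose v i := ln (mu (tnth J i)).
have Ji i : (0 < tnth J i)%N by exact: (forallP J0).
have vc i : c1 <= v i by rewrite ler_ln ?posrE ?mu_ge ?mu_pos.
pose y l := ln (h l) + \sum_i 4 * r l ord0 i * v i.
have yE l : h l * mu_pow mu (4 *: r l) J = expR (y l).
  rewrite mu_powE// expRD lnK ?posrE//; congr (_ * expR _).
  by apply: eq_bigr => i _; rewrite mxE.
pose p := [arg max_(p > ord0) y p]%O.
have pP l : y l <= y p by rewrite /p; case: arg_maxP => // l0 _; exact.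
pose q := [arg min_(q < ord0) y q]%O.
have qP l : y q <= y l by rewrite /q; case: arg_minP => // l0 _; exact.
have wsum (u : 'I_m.+1 -> R) : (forall l, 0 <= u l) -> \sum_l u l = 1 ->
    y q <= \sum_l u l * y l <= y p.
  move=> u0 u1; apply/andP; split.
    rewrite -[y q]mul1r -u1 mulr_suml; apply: ler_sum => l _; exact: ler_wpM2l.
  rewrite -[y p]mul1r -u1 mulr_suml; apply: ler_sum => l _; exact: ler_wpM2l.
have vb i : 8 * dl * `|v i + b i| <= y p - y q.
  have [w0 w0' w1 w1' wr] := wP i.
  have E : 8 * dl * (v i + b i) = \sum_l w i l * y l - \sum_l w' i l * y l.
    rewrite mulrDr /b [8 * dl * (_ / _)]mulrC divfK; last by rewrite gt_eqF// mulr_gt0.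
    rewrite -sumrB; under [RHS]eq_bigr do rewrite -mulrBl /y mulrDr.
    rewrite big_split/= addrC; congr (_ + _).
    under [RHS]eq_bigr do rewrite mulr_sumr.
    rewrite exchange_big/= (bigD1 i)//= [X in _ = _ + X]big1 ?addr0 => [|j ji].
      transitivity (4 * v i * \sum_l (w i l - w' i l) * r l ord0 i).
        by rewrite wr eqxx mulr1; ring.
      by rewrite mulr_sumr; apply: eq_bigr => l _; ring.
    transitivity (4 * v j * \sum_l (w i l - w' i l) * r l ord0 j).
      by rewrite mulr_sumr; apply: eq_bigr => l _; ring.
    by rewrite wr (negbTE ji) !mulr0.
  have d0 : 0 <= 8 * dl by rewrite mulr_ge0// ltW.
  rewrite -[8 * dl](ger0_norm d0) -normrM E.
  have /andP[h1 h2] := wsum _ w0 w1; have /andP[h3 h4] := wsum _ w0' w1'.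
  by rewrite ler_norml; apply/andP; split; lra.
have prodh : \prod_l h l `^ lambda l = expR (\sum_l lambda l * ln (h l)).
  by rewrite expR_sum; apply: eq_bigr => l _; rewrite /powR gt_eqF.
(* Every summand [lambda l * (y l - y p)] is at most 0; the one at the minimum [q] alone gives the
   bound. *)
have lamy : \sum_l lambda l * y l - y p <= - (lm * (y p - y q)).
  have -> : \sum_l lambda l * y l - y p = \sum_l lambda l * (y l - y p).
    under [RHS]eq_bigr do rewrite mulrBr.
    by rewrite sumrB -mulr_suml lambda_sum mul1r.
  rewrite (bigD1 q)//= -[leRHS]addr0; apply: lerD.
    rewrite -[y q - y p]opprB mulrN lerN2 ler_wpM2r// subr_ge0; exact: pP.
  apply: sumr_le0 => l _; rewrite mulr_ge0_le0 ?subr_le0 ?pP//; exact: ltW.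
have gsum : - (lm * (y p - y q)) <= \sum_i - (gam * `|v i + b i|).
  have -> : - (lm * (y p - y q)) = \sum_(i < a) - (lm / a%:R * (y p - y q)).
    by rewrite sumr_const card_ord -mulr_natl; field; rewrite gt_eqF.
  apply: ler_sum => i _; rewrite lerN2 /gam (mulrAC lm) -[leLHS]mulrA ler_wpM2l//.
  by rewrite divr_ge0 ?(ltW lm0)// ltW.
have kapE i : kap ord0 i = k ord0 i + (2 * d%:R - 1) / 4 by rewrite !mxE mulr1.
have expo : \sum_l lambda l * ln (h l) + \sum_i (4 *: k) ord0 i * v i - y p <=
    \sum_(i < a) - ((4 * rho i + (d%:R - 1)) * c1) + \sum_i (- (d%:R * v i) - gam * `|v i + b i|).
  have E1 : \sum_i (4 *: k) ord0 i * v i =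
      \sum_i (\sum_l lambda l *: r l) ord0 i * (4 * v i) +
      \sum_i - ((4 * rho i + (2 * d%:R - 1)) * v i).
    rewrite -big_split/=; apply: eq_bigr => i _; rewrite mxE /rho kapE.
    have alg (x z c t : R) : 4 * x * t = z * (4 * t) + - ((4 * (z - (x + c / 4)) + c) * t).
      by field.
    exact: alg.
  have E2 : \sum_l lambda l * y l = \sum_l lambda l * ln (h l) +
      \sum_i (\sum_l lambda l *: r l) ord0 i * (4 * v i).
    under eq_bigr do rewrite mulrDr mulr_sumr.
    rewrite big_split/= exchange_big/=; congr (_ + _); apply: eq_bigr => i _.
    by rewrite summxE mulr_suml; apply: eq_bigr => l _; rewrite mxE; ring.
  rewrite E1 addrA -E2 addrAC.
  apply: le_trans (lerD (le_trans lamy gsum) (lexx _)) _.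
  rewrite -!big_split/=; apply: ler_sum => i _.
  have d1 : 1 <= d%:R :> R by rewrite ler1n.
  have : 0 <= (4 * rho i + (d%:R - 1)) * (v i - c1).
    by rewrite mulr_ge0 ?subr_ge0 ?vc// addr_ge0 ?subr_ge0// mulr_ge0.
  lra.
have S0 : expR (y p) <= \sum_l h l * mu_pow mu (4 *: r l) J.
  rewrite (bigD1 p)//= yE lerDl; apply: sumr_ge0 => l _.
  by rewrite yE expR_ge0.
rewrite prodh mu_powE//.
apply: (@le_trans _ _ (expR (\sum_l lambda l * ln (h l)) *
    (expR (\sum_i (4 *: k) ord0 i * v i) / expR (y p)))).
  rewrite ler_wpM2l ?expR_ge0// ler_wpM2l ?expR_ge0// lef_pV2 ?posrE ?expR_gt0//.
  exact: lt_le_trans (expR_gt0 _) S0.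
rewrite -expRN -!expRD addrA; apply: (@le_trans _ _ (expR (
    \sum_(i < a) - ((4 * rho i + (d%:R - 1)) * c1) + \sum_i (- (d%:R * v i) - gam * `|v i + b i|)))).
  by rewrite ler_expR.
rewrite expRD -/K ler_wpM2l ?expR_ge0// expR_sum le_eqVlt; apply/orP; left; apply/eqP.
apply: eq_bigr => i _; rewrite expRD; congr (_ * _).
by rewrite expRN expRM_natl lnK// posrE mu_pos.
Qed.

(** After [term_bound] the sum over a cube factorises into [a] one-dimensional sums, each bounded by
    [sum_exp_decay] whatever [xi] and [h]. *)
Lemma sharp_bound : exists2 B, 0 < B & forall (xi : a.-tuple (borel M)) (h : 'I_m.+1 -> R),
  (forall l, 0 < h l) -> forall n,
  \prod_l h l `^ lambda l * \sum_(J <- cubeseq a n)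
    (mu_pow mu (4 *: k) J * phi_tensor phi J xi ^+ 2 / \sum_l h l * mu_pow mu (4 *: r l) J) <= B.
Proof.
have [gam gam0 [K K0 tb]] := term_bound.
have wg (x : M) : weyl_growth (d := d) mu W (fun j => phi j x ^+ 2).
  by split => [j|N T]; [exact: sqr_ge0|exact: weyl].
have [K1 K10 K1P] := @sum_exp_decay R d mu W mu_pos gam gam0 W0.
exists (K * K1 ^+ a); first by rewrite mulr_gt0// exprn_gt0.
move=> xi h h0 n; have [b bP] := tb h h0.
pose G i j := phi j (tnth xi i) ^+ 2 / mu j ^+ d * expR (- (gam * `|ln (mu j) + b i|)).
apply: (@le_trans _ _ (\sum_(J <- cubeseq a n) K * \prod_i G i (tnth J i))).
  rewrite mulr_sumr big_seq [leRHS]big_seq; apply: ler_sum => J /cubeseq_pos J0.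
  rewrite [_ * phi_tensor _ _ _ ^+ 2]mulrC -[X in _ * X]mulrA mulrCA.
  apply: le_trans (ler_wpM2l (sqr_ge0 _) (bP J J0)) _.
  rewrite mulrCA /phi_tensor -prodrXl -big_split/=.
  by under eq_bigr do rewrite mulrA.
rewrite -mulr_sumr sum_cubeseq_prod ler_wpM2l ?(ltW K0)//.
rewrite -[X in _ <= _ ^+ X]card_ord -prodr_const; apply: ler_prod => i _.
rewrite K1P// andbT big_nat; apply: sumr_ge0 => j /andP[j1 _].
by rewrite mulr_ge0 ?expR_ge0// divr_ge0 ?sqr_ge0// exprn_ge0// ltW// mu_pos.
Qed.

Let term (h : 'I_m.+1 -> R) xi J :=
  mu_pow mu (4 *: k) J * phi_tensor phi J xi ^+ 2 / \sum_l h l * mu_pow mu (4 *: r l) J.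

Let term_ge0 h xi J : (forall l, 0 < h l) -> pos_index J -> 0 <= term h xi J.
Proof.
move=> h0 J0; apply: divr_ge0; first by apply: mulr_ge0; [exact: ltW (mu_pow_gt0 _ J0)|exact: sqr_ge0].
by apply: sumr_ge0 => l _; rewrite mulr_ge0// ltW// mu_pow_gt0.
Qed.

Lemma sharp_const_fin : sharp_const mu phi lambda k r \is a fin_num.
Proof.
have [B B0 BP] := sharp_bound.
have prod0 (h : 'I_m.+1 -> R) : (forall l, 0 < h l) -> 0 < \prod_l h l `^ lambda l.
  by move=> h0; apply: prodr_gt0 => l _; rewrite powR_gt0.
rewrite ge0_fin_numE.
  apply: (@le_lt_trans _ _ B%:E); last exact: ltry.
  apply: ge_ereal_sup => _ [xi [h [h0 ->]]].
  have P0 := prod0 h h0.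
  rewrite muleC -lee_pdivlMr// -EFinM.
  apply: esum_le_cubes => [J|n]; first exact: term_ge0.
  by rewrite ler_pdivlMr// mulrC BP.
apply: le_ereal_sup_tmp; eexists.
  by exists [tuple point | i < a], (fun=> 1); split=> // l; exact: ltr01.
rewrite mule_ge0//; first by rewrite lee_fin ltW// prod0.
by apply: esum_ge0 => J J0; rewrite lee_fin term_ge0.
Qed.

(** Stated for any finite set of indices, since it also serves for differences of cubes. *)
Lemma le_sharp_const (xi : a.-tuple (borel M)) (h : 'I_m.+1 -> R) (s : seq (a.-tuple nat)) :
  (forall l, 0 < h l) -> uniq s -> (forall J, J \in s -> pos_index J) ->
  \prod_l h l `^ lambda l * \sum_(J <- s)
    (mu_pow mu (4 *: k) J * phi_tensor phi J xi ^+ 2 / \sum_l h l * mu_pow mu (4 *: r l) J) <=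
  fine (sharp_const mu phi lambda k r).
Proof.
move=> h0 us sp; rewrite -lee_fin fineK ?sharp_const_fin//.
have P0 : 0 < \prod_l h l `^ lambda l by apply: prodr_gt0 => l _; rewrite powR_gt0.
have [n sn] := cubeseq_cover sp.
apply: (@le_trans _ _ ((\prod_l h l `^ lambda l)%:E *
   \esum_(J in [set J | pos_index J]) (term h xi J)%:E)%E); last first.
  by apply: ereal_sup_ubound; exists xi, h.
rewrite EFinM lee_pmul2l ?lte_fin//; apply: le_trans (cube_le_esum _ n).
rewrite lee_fin; apply: le_sum_uniq_subset => //; first exact: uniq_cubeseq.
by move=> J /cubeseq_pos; exact: term_ge0.
Qed.

(** If all truncations stayed below the value, so would the infinite sums. Hence finite linear
    combinations suffice as nearly extremal functions. *)
Lemma sharp_const_approx (e : R) : 0 < e -> exists (xi : a.-tuple (borel M)) (h : 'I_m.+1 -> R) n,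
  (forall l, 0 < h l) /\
  fine (sharp_const mu phi lambda k r) - e < \prod_l h l `^ lambda l * \sum_(J <- cubeseq a n)
    (mu_pow mu (4 *: k) J * phi_tensor phi J xi ^+ 2 / \sum_l h l * mu_pow mu (4 *: r l) J).
Proof.
move=> e0; have := ub_ereal_sup_adherent e0 sharp_const_fin.
move=> [_ [xi [h [h0 ->]]]] lt.
have P0 : 0 < \prod_l h l `^ lambda l by apply: prodr_gt0 => l _; rewrite powR_gt0.
exists xi, h.
have [[n h1]|nh] := pselect (exists n, fine (sharp_const mu phi lambda k r) - e <
    \prod_l h l `^ lambda l * \sum_(J <- cubeseq a n) term h xi J).
  by exists n.
exfalso; move: lt; apply/negP; rewrite -leNgt -lee_pdivlMl//.
rewrite -[X in (_ * (X - _))%E]fineK ?sharp_const_fin// -EFinB -EFinM.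
apply: esum_le_cubes => [J|n]; first exact: term_ge0.
rewrite ler_pdivlMl// leNgt; apply/negP => h1; apply: nh; exists n.
exact: h1.
Qed.

End sharp_constant.

(** * Powers of the Laplacian *)

Section product_box.
Context {I : finType} {M : ptopologicalType}.

(** The sets that contain an open box around [f] form a filter that converges to [f] in every
    coordinate, hence in the product topology; it therefore contains the neighbourhoods of [f]. *)
Lemma nbhs_prod_box (f : prod_topology (fun _ : I => M)) (W : set (I -> M)) : nbhs f W ->
  exists U : I -> set M, (forall i, open (U i) /\ U i (f i)) /\
    forall g : I -> M, (forall i, U i (g i)) -> W g.
Proof.
pose F : set_system (prod_topology (fun _ : I => M)) := fun W => exists U : I -> set M, (forall i, open (U i) /\ U i (f i)) /\
    forall g : I -> M, (forall i, U i (g i)) -> W g.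
have FF : Filter F.
  split.
  - by exists (fun=> setT); split=> // i; split=> //; exact: openT.
  - move=> P Q [U [oU UP]] [V [oV VQ]]; exists (fun i => U i `&` V i); split.
      by move=> i; have [? ?] := oU i; have [? ?] := oV i; split => //; exact: openI.
    by move=> g UV; split; [apply: UP|apply: VQ] => i; have [] := UV i.
  - by move=> P Q PQ [U [oU UP]]; exists U; split=> // g /UP /PQ.
have cF : F --> (f : prod_topology (fun _ : I => M)).
  apply/cvg_sup => i U [V [[X oX <-] Ofi] OU].
  exists (fun j => if j == i then X else setT); split.
    by move=> j; case: eqP => [->|_]; split=> //; exact: openT.
  by move=> g Ug; apply: OU; have := Ug i; rewrite eqxx.
exact: cF.
Qed.

End product_box.

(** * Integrals of tensor products *)

Section tensor.
Context {R : realType} {M : ptopologicalType}.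
Variable vol : {finite_measure set (borel M) -> \bar R}.
Local Notation T n := (n.-tuple (borel M)).

Let voloo : (vol setT < +oo)%E. Proof. by rewrite ltey_eq fin_num_measure. Qed.

Lemma pboxT n : pbox (fun _ : 'I_n => [set: borel M]) = setT.
Proof. by apply/seteqP; split. Qed.

Lemma vol_pow_fin n : (vol_pow vol n setT < +oo)%E.
Proof. by rewrite -pboxT; apply: pbox_fin. Qed.

Lemma bmeas_prod {d'} {X : measurableType d'} (D : set X) (I : Type) (s : seq I) (f : I -> X -> R) :
  (forall i, bmeas D (f i)) -> bmeas D (fun x => \prod_(i <- s) f i x).
Proof.
move=> bf; elim: s => [|i s IH].
  by under eq_fun do rewrite big_nil; exact: bmeas_cst.
by under eq_fun do rewrite big_cons; exact: bmeasM.
Qed.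

Lemma bmeas_tnth n (F : borel M -> R) (i : 'I_n) : bmeas setT F ->
  bmeas setT (fun t : T n => F (tnth t i)).
Proof. by apply: bmeas_comp => //; exact: measurable_tnth. Qed.

Lemma Rintegral_tensor n (F : 'I_n -> borel M -> R) : (forall i, bmeas setT (F i)) ->
  \int[vol_pow vol n]_t (\prod_i F i (tnth t i)) = \prod_i \int[vol]_p F i p.
Proof.
elim: n F => [|n IH] F bF.
  under eq_Rintegral do rewrite big_ord0.
  rewrite big_ord0 Rintegral_cst//.
  by rewrite mul1r [X in fine X](_ : _ = 1%E)//; exact: diracT.
have bP : bmeas (pbox (fun=> setT)) (fun t : T n.+1 => \prod_i F i (tnth t i)).
  by rewrite pboxT; apply: bmeas_prod => i; exact: bmeas_tnth.
rewrite -{1}(pboxT n.+1) (@Rintegral_pbox _ _ _ vol n (fun=> setT) _ (fun=> measurableT) (fun=> voloo) bP).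
rewrite pboxT big_ord_recl -(IH (fun i => F (lift ord0 i)))//.
set c := \int[vol_pow vol n]_t _.
rewrite -[RHS]mulrC -RintegralZl//; last first.
  by apply: bmeas_integrable.
apply: eq_Rintegral => x _; rewrite mulrC -RintegralZl//; last first.
  by apply: (bmeas_integrable (mu := vol_pow vol n)) => //;
    [exact: vol_pow_fin|apply: bmeas_prod => i; exact: bmeas_tnth].
apply: eq_Rintegral => t _; rewrite big_ord_recl /tuple_cons/=; congr (_ * _).
by apply: eq_bigr => i _; rewrite tnthS.
Qed.

End tensor.

Section laplacian_power.
Context {R : realType} {d : nat} {M : ptopologicalType}.
Hypothesis M_compact : compact [set: M].
Context {A : smooth_atlas R d M} (g : riemannian_metric A).
Variable vol : {finite_measure set (borel M) -> \bar R}.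
Variables (mu : nat -> R) (phi : nat -> M -> R) (a : nat).
Hypothesis mu_phi : is_eigenbasis g vol mu phi.
Local Notation T := (a.-tuple (borel M)).
Local Notation nu := (vol_pow vol a : {measure set T -> \bar R}).
Local Notation Phi := (@phi_tensor R M phi a).

Let nuoo : (nu setT < +oo)%E. Proof. exact: vol_pow_fin. Qed.

Lemma tensor_bmeas J : bmeas setT (Phi J).
Proof.
by apply: bmeas_prod => i; apply: bmeas_tnth; exact: (eigenfunction_bmeas M_compact mu_phi).
Qed.

Lemma tensor_L2 J : L2 nu (Phi J).
Proof. by apply: bmeas_L2 => //; exact: tensor_bmeas. Qed.

Lemma tensor_orthonormal J K : L2dot nu (Phi J) (Phi K) = (J == K)%:R.
Proof.
have -> : L2dot nu (Phi J) (Phi K) = \prod_i L2dot vol (phi (tnth J i)) (phi (tnth K i)).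
  have bF (i : 'I_a) : bmeas [set: borel M] (fun p => phi (tnth J i) p * phi (tnth K i) p).
    by apply: bmeasM; exact: (eigenfunction_bmeas M_compact mu_phi).
  rewrite /L2dot -(Rintegral_tensor vol bF).
  by apply: eq_Rintegral => t _; rewrite -big_split.
under eq_bigr do rewrite (eigenfunction_orthonormal mu_phi).
have [->|/eqP JK] := eqVneq J K; first by rewrite big1// => i _; rewrite eqxx.
have [i Ji] : exists i, tnth J i != tnth K i.
  apply/existsP; apply: contra_notT JK; rewrite negb_exists => /forallP h.
  by apply: eq_from_tnth => i; apply/eqP; rewrite -[_ == _]negbK.
by rewrite (bigD1 i)//= (negbTE Ji) mul0r.
Qed.

Definition tcomb (s : seq (a.-tuple nat)) (c : a.-tuple nat -> R) (t : T) :=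
  \sum_(J <- s) c J * Phi J t.

Lemma tcomb_bmeas s c : bmeas setT (tcomb s c).
Proof. by apply: bmeas_sum => J; apply: bmeasM; [exact: bmeas_cst|exact: tensor_bmeas]. Qed.

Lemma tcomb_L2 s c : L2 nu (tcomb s c).
Proof. by apply: bmeas_L2 => //; exact: tcomb_bmeas. Qed.

Lemma tcomb_dot s c f : L2 nu f -> L2dot nu (tcomb s c) f = \sum_(J <- s) c J * L2dot nu (Phi J) f.
Proof.
move=> Lf; rewrite L2dot_suml//; last by move=> J _; apply: L2Z; exact: tensor_L2.
by apply: eq_bigr => J _; rewrite L2dotZl//; exact: tensor_L2.
Qed.

Lemma tcomb_coef s c K : uniq s -> L2dot nu (tcomb s c) (Phi K) = if K \in s then c K else 0.
Proof.
move=> us; rewrite tcomb_dot; last exact: tensor_L2.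
under eq_bigr do rewrite tensor_orthonormal.
case: ifPn => [Ks|/negP Ks].
  rewrite (bigD1_seq K)//= eqxx mulr1 big1 ?addr0// => J /negbTE ->.
  by rewrite mulr0.
rewrite big_seq big1// => J Js; case: eqP => [JK|]; last by rewrite mulr0.
by case: Ks; rewrite -JK.
Qed.

Lemma tcomb_norm s c : uniq s -> L2norm nu (tcomb s c) ^+ 2 = \sum_(J <- s) c J ^+ 2.
Proof.
move=> us; have Lc := tcomb_L2 s c.
rewrite L2norm_sqrE; last exact: L2_measurable Lc.
rewrite tcomb_dot// big_seq [RHS]big_seq; apply: eq_bigr => J Js.
by rewrite L2dotC tcomb_coef// Js.
Qed.

Lemma laplacian_pow_sumE s x n :
  laplacian_pow_sum vol mu phi s x n =
  tcomb (cubeseq a n) (fun J => coef vol phi x J * mu_pow mu (2 *: s) J).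
Proof. by apply/funext => t; rewrite /tcomb big_cubeseq. Qed.

Lemma tcomb_sub s s' c : uniq s -> uniq s' -> {subset s <= s'} ->
  (fun t => tcomb s' c t - tcomb s c t) = tcomb [seq J <- s' | J \notin s] c.
Proof.
move=> us us' ss; apply/funext => t.
by rewrite /tcomb (sum_uniq_subset _ us us' ss) addrAC subrr add0r.
Qed.

(** Orthonormality turns the squared distance of two partial sums into a difference of the
    increasing bounded energies [E], hence a Cauchy sequence. *)
Lemma tcomb_cvg c (B : R) : (forall n, \sum_(J <- cubeseq a n) c J ^+ 2 <= B) ->
  exists2 y, L2 nu y & L2cvg nu (fun n => tcomb (cubeseq a n) c) y.
Proof.
move=> EB; pose E n := \sum_(J <- cubeseq a n) c J ^+ 2.
have sub n p : (n <= p)%N -> E p - E n =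
    \sum_(J <- [seq J <- cubeseq a p | J \notin cubeseq a n]) c J ^+ 2.
  move=> np; rewrite /E (sum_uniq_subset _ (uniq_cubeseq a n) (uniq_cubeseq a p) (cubeseq_sub np)).
  by rewrite addrAC subrr add0r.
have Eh n p : (n <= p)%N -> E n <= E p.
  by move=> np; rewrite -subr_ge0 sub//; apply: sumr_ge0 => J _; exact: sqr_ge0.
have cE : cvgn E.
  apply: nondecreasing_is_cvgn; first by move=> n p /Eh.
  by exists B => _ [n _ <-]; exact: EB.
apply: L2_complete => // [n|e e0]; first exact: tcomb_L2.
have e20 : 0 < e ^+ 2 by rewrite exprn_gt0.
have e220 : 0 < e ^+ 2 / 2 by rewrite divr_gt0.
have [N _ NP] := (cvgrPdist_le _ _).1 cE _ e220.
have key n p : (N <= n)%N -> (n <= p)%N ->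
    L2norm nu (fun t => tcomb (cubeseq a p) c t - tcomb (cubeseq a n) c t) <= e.
  move=> Nn np; rewrite -(@ler_pXn2r _ 2)// ?nnegrE ?L2norm_ge0 ?(ltW e0)//.
  rewrite (tcomb_sub _ (uniq_cubeseq a n) (uniq_cubeseq a p) (cubeseq_sub np)).
  rewrite tcomb_norm; last by rewrite filter_uniq ?uniq_cubeseq.
  rewrite -(sub n p np).
  have := NP n Nn; have := NP p (leq_trans Nn np); rewrite /= !ler_norml.
  move=> /andP[h1 h2] /andP[h3 h4]; lra.
exists N => n p Nn Np; have [np|pn] := leqP n p; last exact: key (ltnW pn).
by rewrite L2normB; exact: key.
Qed.

(** [laplacian_pow] is a choice with default value 0; the chosen function has the expected
    properties once a limit of the partial sums is known to exist. *)
Lemma laplacian_powP s x (B : R) :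
  (forall n, \sum_(J <- cubeseq a n) (coef vol phi x J * mu_pow mu (2 *: s) J) ^+ 2 <= B) ->
  L2 nu (laplacian_pow vol mu phi s x) /\
  L2cvg nu (laplacian_pow_sum vol mu phi s x) (laplacian_pow vol mu phi s x).
Proof.
move=> h; have [y Ly cy] := tcomb_cvg h.
have := @xgetPex _ (cst 0) [set y | L2 nu y /\ L2cvg nu (laplacian_pow_sum vol mu phi s x) y].
apply; exists y; split => //.
have -> // : laplacian_pow_sum vol mu phi s x =
  (fun n => tcomb (cubeseq a n) (fun J => coef vol phi x J * mu_pow mu (2 *: s) J)).
by apply/funext => n; exact: laplacian_pow_sumE.
Qed.

(** Bessel's inequality: the norms of the partial sums increase to the norm of the limit. *)
Lemma laplacian_pow_norm s x (B : R) n :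
  (forall n, \sum_(J <- cubeseq a n) (coef vol phi x J * mu_pow mu (2 *: s) J) ^+ 2 <= B) ->
  \sum_(J <- cubeseq a n) (coef vol phi x J * mu_pow mu (2 *: s) J) ^+ 2 <=
  L2norm nu (laplacian_pow vol mu phi s x) ^+ 2.
Proof.
move=> h; have [Ly cy] := laplacian_powP h.
set c := fun J => coef vol phi x J * mu_pow mu (2 *: s) J.
have LS p : L2 nu (laplacian_pow_sum vol mu phi s x p).
  by rewrite laplacian_pow_sumE; exact: tcomb_L2.
have lim := L2cvg_norm LS Ly cy.
pose N p := L2norm nu (laplacian_pow_sum vol mu phi s x p).
have lim2 : (fun p => N p * N p) @ \oo -->
    L2norm nu (laplacian_pow vol mu phi s x) * L2norm nu (laplacian_pow vol mu phi s x).
  exact: cvgM.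
rewrite expr2 -(cvg_lim _ lim2)//; apply: limr_ge; first by apply/cvg_ex; eexists; exact: lim2.
near=> p; have np : (n <= p)%N by near: p; exact: nbhs_infty_ge.
rewrite -[leRHS]expr2 /N laplacian_pow_sumE tcomb_norm ?uniq_cubeseq//.
apply: le_sum_uniq_subset; [exact: uniq_cubeseq|exact: uniq_cubeseq|exact: cubeseq_sub|].
by move=> J _; exact: sqr_ge0.
Unshelve. all: by end_near. Qed.

End laplacian_power.

(** * The inequality *)

Lemma sum_CS (R : realFieldType) (I : Type) (s : seq I) (u v : I -> R) :
  (\sum_(i <- s) u i * v i) ^+ 2 <= (\sum_(i <- s) u i ^+ 2) * (\sum_(i <- s) v i ^+ 2).
Proof.
elim: s => [|i s]; first by rewrite !big_nil expr0n/= mul0r.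
rewrite !big_cons.
have : 0 <= \sum_(j <- s) u j ^+ 2 by apply: sumr_ge0 => j _; exact: sqr_ge0.
have : 0 <= \sum_(j <- s) v j ^+ 2 by apply: sumr_ge0 => j _; exact: sqr_ge0.
move: (\sum_(j <- s) _ * _) (\sum_(j <- s) v j ^+ 2) (\sum_(j <- s) u j ^+ 2).
move: (u i) (v i) => x y Z Y X Y0 X0 ZXY.
have xx := sqr_ge0 x; have yy := sqr_ge0 y.
have h0 : 0 <= x ^+ 2 * Y + y ^+ 2 * X by apply: addr_ge0; apply: mulr_ge0.
have h1 : 2 * x * y * Z <= x ^+ 2 * Y + y ^+ 2 * X.
  apply: le_trans (ler_norm _) _; rewrite -(@ler_pXn2r _ 2)// real_normK ?num_real//.
  have h2 : 4 * (x ^+ 2 * y ^+ 2) * Z ^+ 2 <= 4 * (x ^+ 2 * y ^+ 2) * (X * Y).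
    by apply: ler_wpM2l => //; apply: mulr_ge0 => //; apply: mulr_ge0.
  rewrite (_ : (2 * x * y * Z) ^+ 2 = 4 * (x ^+ 2 * y ^+ 2) * Z ^+ 2); last by ring.
  apply: le_trans h2 _; rewrite -subr_ge0.
  rewrite (_ : _ - _ = (x ^+ 2 * Y - y ^+ 2 * X) ^+ 2) ?sqr_ge0//; ring.
rewrite (_ : (x * y + Z) ^+ 2 = x ^+ 2 * y ^+ 2 + 2 * x * y * Z + Z ^+ 2); last by ring.
rewrite (_ : (x ^+ 2 + X) * (y ^+ 2 + Y) =
  x ^+ 2 * y ^+ 2 + (x ^+ 2 * Y + y ^+ 2 * X) + X * Y); last by ring.
by rewrite !lerD// lerD2l.
Qed.

Section tuple_continuity.
Context {R : realType} {M : ptopologicalType} {a : nat}.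
Local Notation T := (a.-tuple (borel M)).
Implicit Types y z : T -> R.

Lemma tuple_continuous_tnth (f : M -> R) (i : 'I_a) : continuous f ->
  tuple_continuous (fun t : T => f (tnth t i)).
Proof.
move=> cf; rewrite /tuple_continuous.
rewrite (_ : (fun g => _) = (f \o (@proj 'I_a (fun=> M) i))).
  by move=> g; apply: continuous_comp; [exact: proj_continuous|exact: cf].
by apply/funext => g; rewrite /= tnth_mktuple.
Qed.

Lemma tuple_continuous_cst (c : R) : tuple_continuous (fun _ : T => c).
Proof. by move=> g; exact: cst_continuous. Qed.

Lemma tuple_continuousM y z : tuple_continuous y -> tuple_continuous z ->
  tuple_continuous (fun t => y t * z t).
Proof. by move=> cy cz g; apply: continuousM; [exact: cy|exact: cz]. Qed.

Lemma tuple_continuousD y z : tuple_continuous y -> tuple_continuous z ->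
  tuple_continuous (fun t => y t + z t).
Proof. by move=> cy cz g; apply: continuousD; [exact: cy|exact: cz]. Qed.

Lemma tuple_continuous_prod (I : Type) (s : seq I) (f : I -> T -> R) :
  (forall i, tuple_continuous (f i)) -> tuple_continuous (fun t => \prod_(i <- s) f i t).
Proof.
move=> cf; elim: s => [|i s IH].
  by under eq_fun do rewrite big_nil; exact: tuple_continuous_cst.
by under eq_fun do rewrite big_cons; exact: (tuple_continuousM (cf i) IH).
Qed.

Lemma tuple_continuous_sum (I : Type) (s : seq I) (f : I -> T -> R) :
  (forall i, tuple_continuous (f i)) -> tuple_continuous (fun t => \sum_(i <- s) f i t).
Proof.
move=> cf; elim: s => [|i s IH].
  by under eq_fun do rewrite big_nil; exact: tuple_continuous_cst.
by under eq_fun do rewrite big_cons; exact: (tuple_continuousD (cf i) IH).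
Qed.

Lemma tuple_continuous_unif (F : nat -> T -> R) y : (forall n, tuple_continuous (F n)) ->
  (forall e, 0 < e -> exists n, forall t, `|y t - F n t| <= e) -> tuple_continuous y.
Proof.
move=> cF Fy g; apply/cvgrPdist_le => e e0.
have e3 : 0 < e / 3 by rewrite divr_gt0.
have [n Fn] := Fy _ e3.
have /(_ (nbhs_filter _)) := (cvgrPdist_le _ _).1 (cF n g) _ e3.
apply: (@filterS _ (nbhs (g : prod_topology (fun _ : 'I_a => M))) (nbhs_filter _)) => g' h.
have h1 := Fn (mktuple g); have h2 := Fn (mktuple g').
rewrite (_ : _ - _ = (y (mktuple g) - F n (mktuple g)) +
  (F n (mktuple g) - F n (mktuple g')) + (F n (mktuple g') - y (mktuple g'))); last by ring.
have := ler_normD (y (mktuple g) - F n (mktuple g) +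
  (F n (mktuple g) - F n (mktuple g'))) (F n (mktuple g') - y (mktuple g')).
have := ler_normD (y (mktuple g) - F n (mktuple g)) (F n (mktuple g) - F n (mktuple g')).
rewrite [`|F n (mktuple g') - _|]distrC.
move: h h1 h2; lra.
Qed.

End tuple_continuity.

Section upper_bound.
Context {R : realType} {d : nat} {M : ptopologicalType}.
Hypothesis (d_gt0 : (0 < d)%N) (M_compact : compact [set: M]).
Context {A : smooth_atlas R d M} (g : riemannian_metric A).
Variable vol : {finite_measure set (borel M) -> \bar R}.
Variables (mu : nat -> R) (phi : nat -> M -> R) (a m : nat).
Hypothesis mu_phi : is_eigenbasis g vol mu phi.
Hypothesis a_gt0 : (0 < a)%N.
Variable W : R.
Hypotheses (W0 : 0 <= W) (weyl : forall N T xi, 0 < T ->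
  \sum_(1 <= j < N | mu j <= T) phi j xi ^+ 2 <= W * T ^+ d).
Variables (k : 'rV[R]_a) (r : 'I_m.+1 -> 'rV[R]_a) (lambda : 'I_m.+1 -> R).
Hypothesis k_int : (convex_hull r)° (k + ((2 * d%:R - 1) / 4) *: const_mx 1).
Hypothesis lambda_gt0 : forall l, 0 < lambda l.
Hypothesis lambda_sum : \sum_(l < m.+1) lambda l = 1.
Hypothesis k_le : forall i : 'I_a, (k + ((2 * d%:R - 1) / 4) *: const_mx 1) ord0 i <=
  (\sum_(l < m.+1) lambda l *: r l) ord0 i.
Local Notation T := (a.-tuple (borel M)).
Local Notation nu := (vol_pow vol a : {measure set T -> \bar R}).
Local Notation C := (fine (sharp_const mu phi lambda k r)).
Local Notation lap := (laplacian_pow vol mu phi).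
Local Notation lsum := (laplacian_pow_sum vol mu phi).

Let nuoo : (nu setT < +oo)%E. Proof. exact: vol_pow_fin. Qed.
Let mu1 := eigenvalue1 mu_phi.
Let mu_ge j : (0 < j)%N -> mu 1 <= mu j. Proof. exact: (mu_le mu_phi). Qed.

Lemma mu_pow_sqr (s : 'rV[R]_a) J : pos_index J -> mu_pow mu (2 *: s) J ^+ 2 = mu_pow mu (4 *: s) J.
Proof.
move=> J0; rewrite !(mu_powE mu1 mu_ge)// -expRM_natl mulr_sumr; congr expR.
by apply: eq_bigr => i _; rewrite !mxE; ring.
Qed.

(** The summand of [H0] at [2 *: s] carries the power [4 *: s], which is the square of the factor
    [mu_pow mu (2 *: s)] of [laplacian_pow]. *)
Lemma H0_sqr_bound (s : 'rV[R]_a) x : H0 vol mu phi (2 *: s) x -> exists B, forall n,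
  \sum_(J <- cubeseq a n) (coef vol phi x J * mu_pow mu (2 *: s) J) ^+ 2 <= B.
Proof.
move=> [_ _]; set E := esum _ _ => Eoo.
have E0 : (0 <= E)%E.
  apply: esum_ge0 => J J0; rewrite lee_fin; apply: mulr_ge0; first by rewrite exprn_ge0.
  exact: ltW (mu_pow_gt0 mu1 mu_ge _ J0).
have Efin : E \is a fin_num by rewrite ge0_fin_numE.
exists (fine E) => n; rewrite -lee_fin fineK//; apply: le_trans (cube_le_esum _ n).
rewrite lee_fin big_seq [leRHS]big_seq; apply: ler_sum => J /cubeseq_pos J0.
by rewrite exprMn mu_pow_sqr// real_normK ?num_real// scalerA (_ : 2 * 2 = 4)//; ring.
Qed.

Lemma laplacian_pow_ae (s : 'rV[R]_a) x y : L2 nu y -> L2cvg nu (lsum s x) y ->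
  L2 nu (lap s x) /\ y = lap s x %[ae nu].
Proof.
move=> Ly cy.
have [Ll cl] : L2 nu (lap s x) /\ L2cvg nu (lsum s x) (lap s x).
  by apply: (@xgetPex _ (cst 0) [set y | L2 nu y /\ L2cvg nu (lsum s x) y]); exists y.
split => //; apply: (L2cvg_ae_unique _ Ly Ll cy cl) => n.
by rewrite laplacian_pow_sumE; exact: (tcomb_L2 M_compact mu_phi).
Qed.

Lemma tcomb_continuous s c : tuple_continuous (tcomb phi s c : T -> R).
Proof.
apply: tuple_continuous_sum => J; apply: tuple_continuousM; first exact: tuple_continuous_cst.
apply: tuple_continuous_prod => i; apply: tuple_continuous_tnth.
exact: (eigenfunction_continuous mu_phi).
Qed.

Let D (h : 'I_m.+1 -> R) J := \sum_l h l * mu_pow mu (4 *: r l) J.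

Let D_gt0 h J : (forall l, 0 < h l) -> pos_index J -> 0 < D h J.
Proof.
move=> h0 J0; rewrite /D (bigD1 ord0)//= ltr_wpDr ?mulr_gt0 ?(mu_pow_gt0 mu1 mu_ge)//.
apply: sumr_ge0 => l _; apply: mulr_ge0; first exact: ltW.
exact: ltW (mu_pow_gt0 mu1 mu_ge _ J0).
Qed.

(** In the factors [u] and [v] the square root of the weight [D] is put on the coefficients and its
    inverse on the eigenfunctions. Both [h] and the finite set are left free: [h = 1] on differences
    of cubes gives uniform convergence, the optimal [h] gives the sharp constant. *)
Lemma tcomb_pointwise (al : a.-tuple nat -> R) (h : 'I_m.+1 -> R) s (t : T) :
  (forall l, 0 < h l) -> uniq s -> (forall J, J \in s -> pos_index J) ->
  tcomb phi s (fun J => al J * mu_pow mu (2 *: k) J) t ^+ 2 <=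
  (\sum_l h l * \sum_(J <- s) (al J * mu_pow mu (2 *: r l) J) ^+ 2) *
  (C / \prod_l h l `^ lambda l).
Proof.
move=> h0 us sp; have P0 : 0 < \prod_l h l `^ lambda l by apply: prodr_gt0 => l _; rewrite powR_gt0.
have := le_sharp_const d_gt0 a_gt0 mu1 mu_ge W0 weyl k_int lambda_gt0 lambda_sum k_le t h0 us sp.
rewrite mulrC -ler_pdivlMr// => leC.
pose u J := al J * Num.sqrt (D h J).
pose v J := mu_pow mu (2 *: k) J * phi_tensor phi J t / Num.sqrt (D h J).
have -> : tcomb phi s (fun J => al J * mu_pow mu (2 *: k) J) t = \sum_(J <- s) u J * v J.
  rewrite /tcomb big_seq [RHS]big_seq; apply: eq_bigr => J Js.
  have : Num.sqrt (D h J) != 0 by rewrite gt_eqF// sqrtr_gt0 D_gt0// sp.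
  by rewrite /u /v; move: (Num.sqrt _) => q q0; field.
apply: le_trans (sum_CS s u v) _; apply: ler_pM.
- by apply: sumr_ge0 => J _; exact: sqr_ge0.
- by apply: sumr_ge0 => J _; exact: sqr_ge0.
- under [leRHS]eq_bigr do rewrite mulr_sumr.
  rewrite exchange_big/= big_seq [leRHS]big_seq; apply: ler_sum => J Js.
  rewrite /u exprMn sqr_sqrtr; last by rewrite ltW// D_gt0// sp.
  rewrite /D mulr_sumr; apply: ler_sum => l _.
  by rewrite exprMn mu_pow_sqr ?sp// mulrCA.
apply: le_trans leC; rewrite big_seq [leRHS]big_seq; apply: ler_sum => J Js.
rewrite /v expr_div_n sqr_sqrtr; last by rewrite ltW// D_gt0// sp.
by rewrite exprMn mu_pow_sqr ?sp.
Qed.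

Let K := Num.sqrt (C * \prod_(l < m.+1) lambda l `^ (- lambda l)).

Let C_ge0 : 0 <= C.
Proof.
have := le_sharp_const d_gt0 a_gt0 mu1 mu_ge W0 weyl k_int lambda_gt0 lambda_sum k_le
  [tuple point | i < a] (h := fun=> 1) (s := [::]) (fun=> ltr01) isT.
by rewrite big_nil mulr0; apply.
Qed.

Lemma tcomb_sharp (al : a.-tuple nat -> R) (N : 'I_m.+1 -> R) s (t : T) :
  (forall l, 0 <= N l) -> uniq s -> (forall J, J \in s -> pos_index J) ->
  (forall l, \sum_(J <- s) (al J * mu_pow mu (2 *: r l) J) ^+ 2 <= N l ^+ 2) ->
  `|tcomb phi s (fun J => al J * mu_pow mu (2 *: k) J) t| <= K * \prod_l N l `^ lambda l.
Proof.
move=> N0 us sp sN.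
have K0 : 0 <= K * \prod_l N l `^ lambda l.
  by rewrite mulr_ge0 ?sqrtr_ge0//; apply: prodr_ge0 => l _; rewrite powR_ge0.
(* The optimal [h] below divides by [N l]. If some [N l] is 0, all coefficients vanish because the
   powers of the eigenvalues are positive. *)
have [[l Nl]|Npos] := pselect (exists l, N l = 0).
  have al0 J : J \in s -> al J = 0.
    move=> Js; have := sN l; rewrite Nl expr0n/= => h.
    have h0 : \sum_(J <- s) (al J * mu_pow mu (2 *: r l) J) ^+ 2 == 0.
      by rewrite eq_le h/=; apply: sumr_ge0 => J' _; exact: sqr_ge0.
    rewrite psumr_eq0 in h0; last by move=> J' _; exact: sqr_ge0.
    have /allP/(_ J Js) := h0; rewrite /= sqrf_eq0 mulf_eq0 => /orP[/eqP//|].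
    by rewrite gt_eqF// (mu_pow_gt0 mu1 mu_ge)// sp.
  rewrite /tcomb big_seq big1 ?normr0// => J Js.
  by rewrite al0// !mul0r.
have {}Npos l : 0 < N l.
  by rewrite lt_neqAle N0 andbT eq_sym; apply/eqP => Nl; apply: Npos; exists l.
(* The maximiser of [\prod_l h l `^ lambda l] given [\sum_l h l * N l ^+ 2 = 1]. *)
pose h l := lambda l / N l ^+ 2.
have h0 l : 0 < h l by rewrite divr_gt0// exprn_gt0.
rewrite -(@ler_pXn2r _ 2)// ?nnegrE// real_normK ?num_real//.
apply: le_trans (tcomb_pointwise al t h0 us sp) _.
have hl : \sum_l h l * \sum_(J <- s) (al J * mu_pow mu (2 *: r l) J) ^+ 2 <= 1.
  rewrite -[leRHS]lambda_sum; apply: ler_sum => l _.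
  rewrite /h mulrAC ler_pdivrMr ?exprn_gt0//; apply: ler_wpM2l; [exact: ltW|exact: sN].
have P0 : 0 < \prod_l h l `^ lambda l by apply: prodr_gt0 => l _; rewrite powR_gt0.
apply: (@le_trans _ _ (1 * (C / \prod_l h l `^ lambda l))).
  by rewrite ler_wpM2r// divr_ge0// ltW.
rewrite mul1r exprMn sqr_sqrtr; last first.
  by rewrite mulr_ge0//; apply: prodr_ge0 => l _; rewrite powR_ge0.
rewrite -[leRHS]mulrA ler_wpM2l// -prodfV -prodrXl -big_split/=.
rewrite le_eqVlt; apply/orP; left; apply/eqP; apply: eq_bigr => l _.
rewrite -powRN /powR !gt_eqF// -expRM_natl -expRD; congr expR.
rewrite /h lnM ?posrE ?invr_gt0 ?exprn_gt0// lnV ?posrE ?exprn_gt0// lnXn//.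
by rewrite mulr2n; ring.
Qed.

(** The continuous version is the uniform limit of the partial sums over cubes. It inherits the
    bound of [tcomb_sharp], and on a space of finite measure it is also their L2 limit, hence a
    representative of [laplacian_pow]. *)
Lemma upper_bound x : (forall l, H0 vol mu phi (2 *: r l) x) ->
  exists2 y, continuous_version vol (lap k x) y &
    maxnorm y <= K * \prod_(l < m.+1) L2norm nu (lap (r l) x) `^ lambda l.
Proof.
move=> xH; pose al := coef vol phi x.
pose N l := L2norm nu (lap (r l) x).
pose E l n := \sum_(J <- cubeseq a n) (al J * mu_pow mu (2 *: r l) J) ^+ 2.
have EN l n : E l n <= N l ^+ 2.
  have [B BP] := H0_sqr_bound (xH l).
  exact: (laplacian_pow_norm M_compact mu_phi n BP).
have N0 l : 0 <= N l by exact: L2norm_ge0.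
pose b J := al J * mu_pow mu (2 *: k) J.
pose S n : T -> R := tcomb phi (cubeseq a n) b.
pose Et n := \sum_l E l n.
have E_sub l n p : (n <= p)%N -> E l p - E l n =
    \sum_(J <- [seq J <- cubeseq a p | J \notin cubeseq a n]) (al J * mu_pow mu (2 *: r l) J) ^+ 2.
  move=> np; rewrite /E (sum_uniq_subset _ (uniq_cubeseq a n) (uniq_cubeseq a p) (cubeseq_sub np)).
  by rewrite addrAC subrr add0r.
have Eth n p : (n <= p)%N -> Et n <= Et p.
  move=> np; apply: ler_sum => l _; rewrite -subr_ge0 E_sub//.
  by apply: sumr_ge0 => J _; exact: sqr_ge0.
have cE : cvgn Et.
  apply: nondecreasing_is_cvgn; first by move=> n p /Eth.
  by exists (\sum_l N l ^+ 2) => _ [n _ <-]; apply: ler_sum => l _; exact: EN.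
(* With all [h l = 1], [tcomb_pointwise] on the difference of two cubes lets the total energy [Et]
   control the uniform distance. *)
have Sdiff n p t : (n <= p)%N -> (S p t - S n t) ^+ 2 <= (Et p - Et n) * C.
  move=> np.
  have /(congr1 (fun f => f t)) /= -> := tcomb_sub phi b (uniq_cubeseq a n) (uniq_cubeseq a p) (cubeseq_sub np).
  apply: le_trans (tcomb_pointwise al t (h := fun=> 1) (fun=> ltr01) _ _) _.
  - by rewrite filter_uniq// uniq_cubeseq.
  - by move=> J; rewrite mem_filter => /andP[_ /cubeseq_pos].
  rewrite [\prod_(_ < _) _]big1 ?divr1 => [|l _]; last by rewrite powR1.
  rewrite /Et -sumrB; apply: ler_wpM2r => //; apply: ler_sum => l _.
  by rewrite mul1r E_sub.
have cauchy e : 0 < e -> exists n0, forall n p t, (n0 <= n)%N -> (n <= p)%N -> `|S p t - S n t| <= e.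
  move=> e0; have e1 : 0 < e ^+ 2 / (2 * (C + 1)).
    by rewrite divr_gt0 ?exprn_gt0// mulr_gt0// ltr_wpDl.
  have [n0 _ n0P] := (cvgrPdist_le _ _).1 cE _ e1.
  exists n0 => n p t n0n np; rewrite -(@ler_pXn2r _ 2)// ?nnegrE ?(ltW e0)//.
  rewrite real_normK ?num_real//; apply: le_trans (Sdiff n p t np) _.
  have := n0P n n0n; have := n0P p (leq_trans n0n np); rewrite /= !ler_norml.
  move=> /andP[h1 h2] /andP[h3 h4].
  apply: (@le_trans _ _ (e ^+ 2 / (C + 1) * C)).
    rewrite ler_wpM2r//.
    have -> : e ^+ 2 / (C + 1) = e ^+ 2 / (2 * (C + 1)) + e ^+ 2 / (2 * (C + 1)).
      by field; rewrite gt_eqF// ltr_wpDl.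
    lra.
  rewrite mulrAC ler_pdivrMr ?ltr_wpDl// ler_wpM2l ?exprn_ge0 ?(ltW e0)//.
  by rewrite lerDl.
have cS t : cvgn (S^~ t).
  apply/cauchy_cvgP; apply: cauchy_exP => e e0.
  have [n0 n0P] := cauchy _ (divr_gt0 e0 (ltr0n R 2)).
  exists (S n0 t); exists n0 => // p /= n0p; rewrite /ball/= distrC.
  apply: le_lt_trans (n0P n0 p t (leqnn _) n0p) _.
  by rewrite ltr_pdivrMr// ltr_pMr// ltr1n.
pose y t := limn (S^~ t).
have yS e : 0 < e -> exists n0, forall n t, (n0 <= n)%N -> `|y t - S n t| <= e.
  move=> e0; have [n0 n0P] := cauchy e e0; exists n0 => n t n0n.
  have lim : (fun p => `|S p t - S n t|) @ \oo --> `|y t - S n t|.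
    by apply: cvg_norm; apply: cvgB; [exact: cS|exact: cvg_cst].
  rewrite -(cvg_lim _ lim)//; apply: limr_le; first by apply/cvg_ex; eexists; exact: lim.
  by near=> p; apply: n0P => //; near: p; exact: nbhs_infty_ge.
have Sle n t : `|S n t| <= K * \prod_(l < m.+1) N l `^ lambda l.
  apply: tcomb_sharp => //; first exact: uniq_cubeseq.
    by move=> J; exact: cubeseq_pos.
  by move=> l; exact: EN.
have yle t : `|y t| <= K * \prod_(l < m.+1) N l `^ lambda l.
  have lim : (fun p => `|S p t|) @ \oo --> `|y t| by apply: cvg_norm; exact: cS.
  rewrite -(cvg_lim _ lim)//; apply: limr_le; first by apply/cvg_ex; eexists; exact: lim.
  by apply: nearW => p; exact: Sle.
have bS n : bmeas setT (S n) by exact: (tcomb_bmeas M_compact mu_phi).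
have by_ : bmeas setT y.
  split; last by eexists => t _; exact: yle.
  by apply: (@measurable_fun_cvg _ _ _ _ S) => [n|t _]; [case: (bS n)|exact: cS].
have Ly : L2 nu y by exact: bmeas_L2.
exists y; last first.
  apply: ge_sup; first by exists `|y [tuple point | i < a]|, [tuple point | i < a].
  by move=> _ [t _ <-]; exact: yle.
split.
  apply: (@tuple_continuous_unif _ _ _ S) => [n|e /yS[n0 n0P]]; first exact: tcomb_continuous.
  by exists n0 => t; exact: n0P.
apply: (laplacian_pow_ae Ly _).2.
have -> : lsum k x = S by apply/funext => n; rewrite laplacian_pow_sumE.
pose c := L2norm nu (fun=> 1).
(* A uniform distance of at most [e / (c + 1)] gives an L2 distance of at most [e c / (c + 1)],
   where [c] is the norm of the constant 1; adding 1 makes the denominator positive. *)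
apply/cvgrPdist_le => e e0.
have c1 : 0 < c + 1 by rewrite ltr_wpDl// L2norm_ge0.
have [n0 n0P] := yS _ (divr_gt0 e0 c1).
exists n0 => // n /= n0n; rewrite sub0r normrN ger0_norm ?L2norm_ge0//.
have L1 : L2 nu (fun=> e / (c + 1) * 1) by apply: L2Z; apply: bmeas_L2 => //; exact: bmeas_cst.
have LB : L2 nu (S n \- y) by apply: L2B => //; apply: bmeas_L2.
apply: (@le_trans _ _ (e / (c + 1) * c)); last first.
  rewrite mulrAC ler_pdivrMr//; apply: ler_wpM2l; first exact: ltW.
  by rewrite lerDl.
have ec : 0 <= e / (c + 1) by apply: divr_ge0; exact: ltW.
have ecc : 0 <= e / (c + 1) * c by apply: mulr_ge0 => //; exact: L2norm_ge0.
rewrite -(@ler_pXn2r _ 2)// ?nnegrE ?L2norm_ge0//.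
rewrite exprMn !L2norm_sqr//; last exact: L2_measurable LB.
have b1 : bmeas [set: T] (fun=> 1 ^+ 2 : R) by exact: bmeas_cst.
rewrite -RintegralZl//; last exact: bmeas_integrable b1.
apply: le_Rintegral => //.
- exact: L2_sqr_integrable LB.
- by apply: bmeas_integrable => //; apply: bmeasM => //; exact: bmeas_cst.
- move=> t _; rewrite expr1n mulr1 -real_normK ?num_real// lerXn2r// ?nnegrE//.
  by rewrite /= distrC n0P.
Unshelve. all: by end_near. Qed.

End upper_bound.

(** * Sharpness *)

(** From [t <= expR (t - 1)] at [t = x l / s], with [s] the weighted mean: the product of the
    exponentials is 1 since their weighted exponents sum to 0. *)
Lemma weighted_AMGM (R : realType) n (lambda x : 'I_n.+1 -> R) :
  (forall l, 0 < lambda l) -> \sum_l lambda l = 1 -> (forall l, 0 <= x l) ->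
  \prod_l x l `^ lambda l <= \sum_l lambda l * x l.
Proof.
move=> l0 l1 x0; set s := \sum_l _ * _.
have lx0 l : 0 <= lambda l * x l by rewrite mulr_ge0// ltW.
have : 0 <= s by apply: sumr_ge0.
rewrite le_eqVlt => /predU1P[s0|s0].
  have /(_ ord0 isT)/eqP := psumr_eq0P (fun i _ => lx0 i) (esym s0).
  rewrite mulf_eq0 gt_eqF//= => /eqP x00.
  by rewrite (bigD1 ord0)//= x00 powR0 ?gt_eqF// mul0r -s0.
apply: (@le_trans _ _ (\prod_l expR (lambda l * ln s + lambda l * (x l / s - 1)))).
  apply: ler_prod => l _; rewrite powR_ge0/= -mulrDr.
  have -> : expR (lambda l * (ln s + (x l / s - 1))) = (s * expR (x l / s - 1)) `^ lambda l.
    by rewrite /powR gt_eqF ?mulr_gt0 ?expR_gt0// lnM ?posrE ?expR_gt0// expRK.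
  apply: ge0_ler_powR; rewrite ?nnegrE//; first exact: ltW.
    by rewrite mulr_ge0 ?expR_ge0// ltW.
  rewrite mulrC -ler_pdivrMr//.
  by have := expR_ge1Dx (x l / s - 1); rewrite subrKC.
rewrite -expR_sum big_split/= -mulr_suml l1 mul1r expRD lnK ?posrE//.
under [X in expR X]eq_bigr do rewrite mulrBr mulr1 mulrA.
by rewrite sumrB -mulr_suml l1 -/s divff ?gt_eqF// subrr expR0 mulr1.
Qed.

Section sharpness.
Context {R : realType} {d : nat} {M : ptopologicalType}.
Hypothesis (d_gt0 : (0 < d)%N) (M_compact : compact [set: M]).
Context {A : smooth_atlas R d M} (g : riemannian_metric A).
Variable vol : {finite_measure set (borel M) -> \bar R}.
Hypothesis vol_riemannian : is_riemannian_volume g vol.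
Variables (mu : nat -> R) (phi : nat -> M -> R) (a m : nat).
Hypothesis mu_phi : is_eigenbasis g vol mu phi.
Hypothesis a_gt0 : (0 < a)%N.
Variable W : R.
Hypotheses (W0 : 0 <= W) (weyl : forall N T xi, 0 < T ->
  \sum_(1 <= j < N | mu j <= T) phi j xi ^+ 2 <= W * T ^+ d).
Variables (k : 'rV[R]_a) (r : 'I_m.+1 -> 'rV[R]_a) (lambda : 'I_m.+1 -> R).
Hypothesis k_int : (convex_hull r)° (k + ((2 * d%:R - 1) / 4) *: const_mx 1).
Hypothesis lambda_gt0 : forall l, 0 < lambda l.
Hypothesis lambda_sum : \sum_(l < m.+1) lambda l = 1.
Hypothesis k_le : forall i : 'I_a, (k + ((2 * d%:R - 1) / 4) *: const_mx 1) ord0 i <=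
  (\sum_(l < m.+1) lambda l *: r l) ord0 i.
Local Notation T := (a.-tuple (borel M)).
Local Notation nu := (vol_pow vol a : {measure set T -> \bar R}).
Local Notation C := (fine (sharp_const mu phi lambda k r)).
Local Notation lap := (laplacian_pow vol mu phi).
Local Notation lsum := (laplacian_pow_sum vol mu phi).

Let nuoo : (nu setT < +oo)%E. Proof. exact: vol_pow_fin. Qed.
Let mu1 := eigenvalue1 mu_phi.
Let mu_ge j : (0 < j)%N -> mu 1 <= mu j. Proof. exact: (mu_le mu_phi). Qed.

(** The set where two continuous functions differ is open, so it would contain a box of positive
    measure. A continuous version, specified only almost everywhere, can thus be evaluated at a
    point. *)
Lemma tuple_continuous_ae_eq (y z : T -> R) : tuple_continuous y -> tuple_continuous z ->
  y = z %[ae nu] -> y =1 z.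
Proof.
move=> cy cz [B [mB B0 sub]] t; apply/eqP/negPn/negP => yz.
pose f : prod_topology (fun _ : 'I_a => M) := tnth t.
have mkf : mktuple f = t by apply: eq_from_tnth => i; rewrite tnth_mktuple.
pose h (e : prod_topology (fun _ : 'I_a => M)) := y (mktuple e) - z (mktuple e).
have ch : {for f, continuous h} by apply: continuousB; [exact: cy|exact: cz].
have hf : h f != 0 by rewrite /h mkf subr_eq0.
have /nbhs_prod_box[U [oU UP]] : nbhs f [set e | h e != 0].
  have on : nbhs (h f) [set s : R | s != 0] 
    by exact: (open_nbhs_nbhs (conj (@open_neq R 0) hf)).
  exact: (ch _ on).
have mU i : measurable (U i : set (borel M)) by apply: sub_sigma_algebra; case: (oU i).
have : (vol_pow vol a (pbox (fun i => U i : set (borel M))) <= nu B)%E.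
  apply: le_measure; rewrite ?inE//; first exact: measurable_pbox.
  move=> s Us; apply: sub => /= h1; have := UP (tnth s) Us; rewrite /h/=.
  have -> : mktuple (tnth s) = s by apply: eq_from_tnth => i; rewrite tnth_mktuple.
  by rewrite h1// subrr eqxx.
rewrite [X in (_ <= X)%E]B0 /vol_pow measure_power_box//.
apply/negP; rewrite -ltNge; elim/big_ind : _ => //= [x1 x2|i _]; first exact: mule_gt0.
have [oi Ui] := oU i; exact: (vol_open_gt0 vol_riemannian oi Ui).
Qed.

Lemma laplacian_pow_norm_eq (s : 'rV[R]_a) x y : L2 nu y -> L2cvg nu (lsum s x) y ->
  L2norm nu (lap s x) = L2norm nu y.
Proof.
move=> Ly cy.
have [Ll cl] : L2 nu (lap s x) /\ L2cvg nu (lsum s x) (lap s x).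
  by apply: (@xgetPex _ (cst 0) [set y | L2 nu y /\ L2cvg nu (lsum s x) y]); exists y.
have LS n : L2 nu (lsum s x n).
  by rewrite laplacian_pow_sumE; exact: (tcomb_L2 M_compact mu_phi).
have h1 := L2cvg_norm LS Ll cl; have h2 := L2cvg_norm LS Ly cy.
by rewrite -(cvg_lim _ h1)// (cvg_lim _ h2).
Qed.

Section finite_combination.
Variables (n : nat) (al : a.-tuple nat -> R).
Let x : T -> R := tcomb phi (cubeseq a n) al.

Lemma finite_coef J : coef vol phi x J = if J \in cubeseq a n then al J else 0.
Proof. exact: (tcomb_coef M_compact mu_phi al J (uniq_cubeseq a n)). Qed.

(** The partial sums are constant from the cube [n] on. *)
Lemma finite_lsum s : L2cvg nu (lsum s x)
  (tcomb phi (cubeseq a n) (fun J => al J * mu_pow mu (2 *: s) J)).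
Proof.
have E p : (n <= p)%N -> lsum s x p =
    tcomb phi (cubeseq a n) (fun J => al J * mu_pow mu (2 *: s) J).
  move=> np; rewrite laplacian_pow_sumE; apply/funext => t; rewrite /tcomb.
  rewrite (sum_uniq_subset _ (uniq_cubeseq a n) (uniq_cubeseq a p) (cubeseq_sub np)).
  rewrite [X in _ + X]big_seq [X in _ + X]big1 ?addr0 => [|J]; last first.
    by rewrite mem_filter => /andP[/negbTE Jn _]; rewrite finite_coef Jn !mul0r.
  by rewrite big_seq [RHS]big_seq; apply: eq_bigr => J Jn; rewrite finite_coef Jn.
apply: cvg_near_cst; exists n => // p /= np; rewrite (E p np).
set f := tcomb _ _ _; rewrite L2norm_sqrt; last first.
  by apply: measurable_funB; exact: L2_measurable (tcomb_L2 M_compact mu_phi _ _).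
under eq_Rintegral do rewrite /= subrr expr0n.
by rewrite /Rintegral integral0 sqrtr0.
Qed.

Lemma finite_H0 s : H0 vol mu phi s x.
Proof.
split; first exact: (tcomb_L2 M_compact mu_phi).
  move=> J J0; rewrite finite_coef ifN//; apply/negP => /cubeseq_pos.
  by apply/negP.
pose F J := `|coef vol phi x J| ^+ 2 * mu_pow mu (2 *: s) J.
have F0 J : pos_index J -> 0 <= F J.
  move=> J0; apply: mulr_ge0; first by rewrite exprn_ge0.
  exact: ltW (mu_pow_gt0 mu1 mu_ge _ J0).
apply: (@le_lt_trans _ _ (\sum_(J <- cubeseq a n) F J)%:E); last exact: ltry.
apply: esum_le_cubes => // p.
apply: (@le_trans _ _ (\sum_(J <- cubeseq a (maxn n p)) F J)).
  apply: le_sum_uniq_subset; [exact: uniq_cubeseq|exact: uniq_cubeseq| |].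
    exact: cubeseq_sub (leq_maxr _ _).
  by move=> J /cubeseq_pos; exact: F0.
rewrite (sum_uniq_subset _ (uniq_cubeseq a n) (uniq_cubeseq a (maxn n p))
  (cubeseq_sub (leq_maxl _ _))).
rewrite [X in _ + X]big_seq [X in _ + X]big1 ?addr0// => J.
by rewrite mem_filter => /andP[/negbTE Jn _]; rewrite /F finite_coef Jn normr0 expr0n mul0r.
Qed.

End finite_combination.

Let L := \prod_(l < m.+1) lambda l `^ (- lambda l).
Let L_gt0 : 0 < L. Proof. by apply: prodr_gt0 => l _; rewrite powR_gt0. Qed.

(** A single term of the series, with [J = (1, ..., 1)] and a point where [phi 1] does not vanish,
    is already positive. In [lower_bound] this serves to show that [c] is positive. *)
Lemma sharp_const_gt0 : 0 < C.
Proof.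
have [p p0] : exists p, phi 1 p != 0.
  apply: contrapT => np; have := eigenfunction_orthonormal mu_phi 1 1.
  have phi0 p : phi 1 p = 0 by apply/eqP/negPn/negP => p0; apply: np; exists p.
  rewrite eqxx /L2dot; under eq_Rintegral do rewrite phi0 mul0r.
  by rewrite /Rintegral integral0 => /eqP; rewrite eq_sym oner_eq0.
pose J : a.-tuple nat := [tuple 1%N | i < a].
have J0 : pos_index J by apply/forallP => i; rewrite tnth_mktuple.
pose xi : T := [tuple p | i < a].
have := le_sharp_const d_gt0 a_gt0 mu1 mu_ge W0 weyl k_int lambda_gt0 lambda_sum k_le
  xi (h := fun=> 1) (s := [:: J]) (fun=> ltr01) isT.
have Jpos K : K \in [:: J] -> pos_index K by rewrite inE => /eqP ->.
rewrite big_seq1 => /(_ Jpos); apply: lt_le_trans.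
apply: mulr_gt0; first by apply: prodr_gt0 => l _; rewrite powR_gt0.
apply: divr_gt0.
  rewrite mulr_gt0 ?(mu_pow_gt0 mu1 mu_ge)// lt0r sqr_ge0 andbT sqrf_eq0.
  by rewrite prodf_seq_neq0; apply/allP => i _; rewrite !tnth_mktuple.
rewrite big_ord_recl/= ltr_wpDr ?mul1r ?(mu_pow_gt0 mu1 mu_ge)//.
by apply: sumr_ge0 => l _; rewrite mul1r ltW// (mu_pow_gt0 mu1 mu_ge).
Qed.

Lemma lower_bound (c : R) :
  (forall x, (forall l, H0 vol mu phi (2 *: r l) x) ->
    exists2 y, continuous_version vol (lap k x) y &
    maxnorm y <= c * \prod_(l < m.+1) L2norm nu (lap (r l) x) `^ lambda l) ->
  Num.sqrt (C * L) <= c.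
Proof.
move=> H; have C0 := sharp_const_gt0.
(* [e < C] makes the truncated sum [S] positive, from which the positivity of [c] follows; the
   latter permits taking square roots at the end. *)
have key e : 0 < e -> e < C -> 0 < c /\ (C - e) * L <= c ^+ 2.
  move=> e0 eC.
  have [xi [h [n [h0 lt]]]] := sharp_const_approx d_gt0 a_gt0 mu1 mu_ge W0 weyl k_int
    lambda_gt0 lambda_sum k_le e0.
  pose D J := \sum_l h l * mu_pow mu (4 *: r l) J.
  have D0 J : pos_index J -> 0 < D J.
    move=> J0; rewrite /D (bigD1 ord0)//= ltr_wpDr ?mulr_gt0 ?(mu_pow_gt0 mu1 mu_ge)//.
    apply: sumr_ge0 => l _; apply: mulr_ge0; first exact: ltW.
    exact: ltW (mu_pow_gt0 mu1 mu_ge _ J0).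
  move: lt; set P := \prod_l _; set S := \sum_(J <- _) _ => lt.
  have P0 : 0 < P by apply: prodr_gt0 => l _; rewrite powR_gt0.
  have S0 : 0 < S.
    by rewrite -(pmulr_rgt0 _ P0); apply: lt_trans lt; rewrite subr_gt0.
  (* The equality case of the Cauchy-Schwarz inequality in [tcomb_pointwise]. *)
  pose al J := mu_pow mu (2 *: k) J * phi_tensor phi J xi / D J.
  pose x : T -> R := tcomb phi (cubeseq a n) al.
  have [y [cy yl] ymax] := H x (fun l => finite_H0 n al _).
  pose z : T -> R := tcomb phi (cubeseq a n) (fun J => al J * mu_pow mu (2 *: k) J).
  have Lz : L2 nu z by exact: (tcomb_L2 M_compact mu_phi).
  have [_ zl] := laplacian_pow_ae M_compact mu_phi Lz (finite_lsum n al k).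
  have yz : y =1 z.
    apply: tuple_continuous_ae_eq => //; first exact: (tcomb_continuous mu_phi).
    by apply: filterS2 yl zl => t h1 h2 tT; rewrite h1// h2.
  have zxi : z xi = S.
    rewrite /z /tcomb /S big_seq [RHS]big_seq; apply: eq_bigr => J /cubeseq_pos J0.
    have := D0 J J0; rewrite -(mu_pow_sqr mu_phi)// -/(D J) /al.
    by move: (D J) => q q0; field; rewrite gt_eqF.
  have Smax : S <= maxnorm y.
    rewrite -[S]gtr0_norm// -zxi -yz; apply: ub_le_sup; last by exists xi.
    have [_ [B zB]] := tcomb_bmeas M_compact mu_phi (cubeseq a n) (fun J => al J * mu_pow mu (2 *: k) J).
    by exists B => _ [t _ <-]; rewrite yz; exact: zB.
  pose N l := L2norm nu (lap (r l) x).
  have N2 l : N l ^+ 2 = \sum_(J <- cubeseq a n) (al J * mu_pow mu (2 *: r l) J) ^+ 2.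
    rewrite -(tcomb_norm M_compact mu_phi _ (uniq_cubeseq a n)); congr (_ ^+ 2).
    apply: laplacian_pow_norm_eq; first exact: (tcomb_L2 M_compact mu_phi).
    exact: finite_lsum.
  have hN : \sum_l h l * N l ^+ 2 = S.
    under eq_bigr do rewrite N2 mulr_sumr.
    rewrite exchange_big/= /S big_seq [RHS]big_seq; apply: eq_bigr => J /cubeseq_pos J0.
    have -> : \sum_l h l * (al J * mu_pow mu (2 *: r l) J) ^+ 2 = al J ^+ 2 * D J.
      rewrite /D mulr_sumr; apply: eq_bigr => l _.
      by rewrite exprMn (mu_pow_sqr mu_phi)// mulrCA.
    have := D0 J J0; rewrite -(mu_pow_sqr mu_phi k)// -/(D J) /al.
    by move: (D J) => q q0; field; rewrite gt_eqF.
  set q := \prod_(l < m.+1) L2norm _ _ `^ _ in ymax.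
  have q0 : 0 <= q by apply: prodr_ge0 => l _; rewrite powR_ge0.
  (* The AM-GM inequality at [h l * N l ^+ 2 / lambda l], whose mean with the weights [lambda l] is
     [S]. *)
  have amgm : P * q ^+ 2 * L <= S.
    have := weighted_AMGM lambda_gt0 lambda_sum (x := fun l => h l * N l ^+ 2 / lambda l).
    have -> : \sum_l lambda l * (h l * N l ^+ 2 / lambda l) = S.
      by rewrite -hN; apply: eq_bigr => l _; rewrite mulrC divfK// gt_eqF.
    have hN0 l : 0 <= h l * N l ^+ 2 / lambda l.
      by apply: divr_ge0; [apply: mulr_ge0; [exact: ltW|exact: sqr_ge0]|exact: ltW].
    move=> /(_ hN0); apply: le_trans.
    rewrite /P /q /L -prodrXl -!big_split/= le_eqVlt; apply/orP; left; apply/eqP.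
    apply: eq_bigr => l _; have Nl0 : 0 <= N l by exact: L2norm_ge0.
    have hl := ltW (h0 l); have ll := lambda_gt0 l.
    have -> : h l * N l ^+ 2 / lambda l = h l * (N l * N l) * (lambda l)^-1 by [].
    rewrite !powRM ?mulr_ge0// ?invr_ge0 ?(ltW ll)//.
    by rewrite -/(N l) -expr2 powRN; congr (_ * _); rewrite /powR invr_eq0 gt_eqF// lnV ?posrE// mulrN expRN.
  have Scq : S <= c * q by exact: le_trans Smax ymax.
  have cq0 : 0 < c * q by exact: lt_le_trans Scq.
  have c0 : 0 < c.
    rewrite ltNge; apply/negP => c0; move: cq0; apply/negP; rewrite -leNgt.
    by rewrite mulr_le0_ge0.
  split => //; have PL0 : 0 < P * L by rewrite mulr_gt0.
  apply: (@le_trans _ _ (P * S * L)); first by rewrite ler_wpM2r// ltW// ltW.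
  (* Multiplied by [S], the inequality follows from [S <= c * q] and [P * q ^+ 2 * L <= S]. *)
  rewrite -(ler_pM2r S0); apply: (@le_trans _ _ (P * L * (c * q) ^+ 2)).
    rewrite (_ : P * S * L * S = P * L * S ^+ 2); last by ring.
    rewrite ler_wpM2l ?(ltW PL0)// lerXn2r// nnegrE; exact: ltW.
  rewrite (_ : P * L * (c * q) ^+ 2 = c ^+ 2 * (P * q ^+ 2 * L)); last by ring.
  by rewrite ler_wpM2l ?sqr_ge0.
have C2 : 0 < C / 2 by rewrite divr_gt0.
have C2C : C / 2 < C by rewrite ltr_pdivrMr// ltr_pMr// ltr1n.
have [c0 _] := key _ C2 C2C.
rewrite -[c]gtr0_norm// -sqrtr_sqr ler_wsqrtr//.
apply/ler_addgt0Pr => e e0.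
(* [C / 2] keeps the parameter below [C], and [e / L] makes the error at most [e] after
   multiplication by [L]. *)
have em : 0 < Num.min (C / 2) (e / L) by rewrite lt_min C2 divr_gt0.
have mC : Num.min (C / 2) (e / L) < C by rewrite (le_lt_trans _ C2C)// ge_min lexx.
have [_] := key _ em mC.
have : Num.min (C / 2) (e / L) * L <= e by rewrite -ler_pdivlMr// ge_min lexx orbT.
rewrite mulrBl; lra.
Qed.

End sharpness.

Theorem theorem14 (R : realType) (d : nat) (d_gt0 : (0 < d)%N)
  (M : ptopologicalType)
  (M_hausdorff : hausdorff_space M) (M_compact : compact [set: M])
  (A : smooth_atlas R d M) (g : riemannian_metric A)
  (vol : {finite_measure set (borel M) -> \bar R})
  (vol_riemannian : is_riemannian_volume g vol)
  (mu : nat -> R) (phi : nat -> M -> R)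
  (mu_phi : is_eigenbasis g vol mu phi)
  (a m : nat) (a_gt0 : (0 < a)%N) (m_gt0 : (0 < m)%N)
  (k : 'rV[R]_a) (r : 'I_m.+1 -> 'rV[R]_a)
  (k_int : (convex_hull r)°
             (k + ((2 * d%:R - 1) / 4) *: const_mx 1))
  (lambda : 'I_m.+1 -> R)
  (lambda_gt0 : forall l, 0 < lambda l)
  (lambda_sum : \sum_(l < m.+1) lambda l = 1)
  (k_le : forall i : 'I_a,
     (k + ((2 * d%:R - 1) / 4) *: const_mx 1) ord0 i <=
     (\sum_(l < m.+1) lambda l *: r l) ord0 i) :
  let C := sharp_const mu phi lambda k r in
  let K := Num.sqrt (fine C * \prod_(l < m.+1) lambda l `^ (- lambda l)) in
  let bounded_by (c : R) := forall x : a.-tuple (borel M) -> R,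
    (forall l, H0 vol mu phi (2 *: r l) x) ->
    exists2 y, continuous_version vol (laplacian_pow vol mu phi k x) y &
      maxnorm y <= c * \prod_(l < m.+1)
        L2norm (vol_pow vol a) (laplacian_pow vol mu phi (r l) x) `^ lambda l in
  [/\ C \is a fin_num, bounded_by K & forall c : R, bounded_by c -> K <= c].
Proof.
move=> C K bounded_by.
have [W W0 weyl] := weyl_bound M_compact vol_riemannian mu_phi.
have mu_ge j : (0 < j)%N -> mu 1 <= mu j by exact: (mu_le mu_phi).
split.
- exact: (sharp_const_fin d_gt0 a_gt0 (eigenvalue1 mu_phi) mu_ge W0 weyl k_int
    lambda_gt0 lambda_sum k_le).
- exact: (upper_bound d_gt0 M_compact mu_phi a_gt0 W0 weyl k_int lambda_gt0 lambda_sum k_le).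
- exact: (lower_bound d_gt0 M_compact vol_riemannian mu_phi a_gt0 W0 weyl k_int
    lambda_gt0 lambda_sum k_le).
Qed.
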